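(* For real $\alpha$ let $\hat{Q}_\alpha(X|Y)=\operatorname{tr}(X(X^{-1/2}YX^{-1/2})^{1-\alpha})$. (1) For $\alpha\in[0,1]$, $\hat{Q}_\alpha$ is well-defined and concave on $\mathbf{H}^n_+\times\mathbf{H}^n_+$. The function $(X,Y,z)\mapsto-\log(\hat{Q}_\alpha(X|Y)-z)-\log\det X-\log\det Y$ defined on $\mathbf{H}^n_{++}\times\mathbf{H}^n_{++}\times\mathbb{R}$ is a $(2n+1)$-logarithmically homogeneous self-concordant barrier for $$\operatorname{hypo}(\hat{Q}_\alpha)=\{(X,Y,z)\in\mathbf{H}^n_+\times\mathbf{H}^n_+\times\mathbb{R}:\hat{Q}_\alpha(X|Y)\ge z\}.$$ Moreover, this barrier is optimal in the sense that any self-concordant barrier for $\operatorname{hypo}(\hat{Q}_\alpha)$ has parameter at least $2n+1$. (2) For $\alpha\in[-1,0)\cup(1,2]$, $\hat{Q}_\alpha$ is well-defined and convex on $$\hat{\mathcal{D}}_\alpha=\begin{cases}\{(X,Y)\in\mathbf{H}^n_+\times\mathbf{H}^n_+:Y\ll X\}&\text{for }\alpha\in[-1,0)\\ \{(X,Y)\in\mathbf{H}^n_+\times\mathbf{H}^n_+:X\ll Y\}&\text{for }\alpha\in(1,2].\end{cases}$$ The function $(X,Y,z)\mapsto-\log(z-\hat{Q}_\alpha(X|Y))-\log\det X-\log\det Y$ defined on $\mathbf{H}^n_{++}\times\mathbf{H}^n_{++}\times\mathbb{R}$ is a $(2n+1)$-self-concordant barrier for $$\operatorname{epi}(\hat{Q}_\alpha)=\{(X,Y,z)\in\mathbf{H}^n_+\times\mathbf{H}^n_+\times\mathbb{R}:(X,Y)\in\hat{\mathcal{D}}_\alpha\text{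 and }\hat{Q}_\alpha(X|Y)\le z\}.$$ Moreover, this barrier is optimal in the sense that any self-concordant barrier for $\operatorname{epi}(\hat{Q}_\alpha)$ has parameter at least $2n+1$.
   Context: $\mathbf{H}^n$ is the real vector space of $n\times n$ complex Hermitian matrices; $\mathbf{H}^n_+$ and $\mathbf{H}^n_{++}$ are the sets of positive semidefinite and positive definite ones. For positive semidefinite $X,Y$, $X\ll Y$ means $\ker(Y)\subset\ker(X)$. The formula for $\hat{Q}_\alpha(X|Y)$ is used for $X,Y\in\mathbf{H}^n_{++}$; at other pairs of positive semidefinite matrices, $\hat{Q}_\alpha(X|Y)=\lim_{\epsilon\downarrow0}\hat{Q}_\alpha(X+\epsilon I|Y+\epsilon I)$, and ''well-defined'' means that this limit exists and is finite. For $f$ defined on a subset of a finite-dimensional real vector space $E$, $D^kf(x)[h]=\frac{d^k}{dt^k}f(x+th)|_{t=0}$. A convex function $f:E\to\mathbb{R}\cup\{+\infty\}$ is self-concordant if $\operatorname{dom}f=\{x:f(x)<+\infty\}$ is open, its epigraph $\{(x,t)\in E\times\mathbb{R}:f(x)\le t\}$ is closed, and $f$ is $C^3$ on $\operatorname{dom}f$ with $|D^3f(x)[h]|\le2(D^2f(x)[h])^{3/2}$ for all $x\in\operatorname{dom}f$, $h\in E$. It is a self-concordant barrier for a closed convex set $Q$ if moreover $\operatorname{cl}(\operatorname{dom}f)=Q$; it has parameter $\nu$ (is a $\nu$-self-concordant barrier) if moreover $2Df(x)[h]-D^2f(x)[h]\le\nu$ for all $x\in\operatorname{dom}f$, $h\in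 E$. When $\operatorname{dom}f$ is a convex cone, $f$ is $\nu$-logarithmically homogeneous if $f(\tau x)=f(x)-\nu\log\tau$ for all $x\in\operatorname{dom}f$, $\tau>0$; a $\nu$-logarithmically homogeneous self-concordant barrier is automatically a $\nu$-self-concordant barrier. Convention: $-\log t=+\infty$ for $t\le0$, and the barrier functions take the value $+\infty$ when $X$ or $Y$ is not positive definite. *)

(* Defs.v *)
From HB Require Import structures.
From mathcomp Require Import all_boot all_order all_algebra.
From mathcomp Require Import complex.
From mathcomp Require Import all_classical all_reals all_analysis.

Set Implicit Arguments.
Unset Strict Implicit.
Unset Printing Implicit Defensive.

Import Order.TTheory GRing.Theory Num.Theory.
Import numFieldNormedType.Exports.

Local Open Scope classical_set_scope.
Local Open Scope ring_scope.
Local Open Scope complex_scope.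
Local Open Scope sesquilinear_scope.

Section Hermitian.
Variables (R : realType) (n : nat).

Definition hermitian_pred : {pred 'M[R[i]]_n} := fun A => A \is hermsymmx.

Record herm := Herm { herm_val :> 'M[R[i]]_n ; _ : hermitian_pred herm_val }.

HB.instance Definition _ := [isSub for herm_val].
HB.instance Definition _ := [Choice of herm by <:].

Lemma hermitian_predE (A : 'M[R[i]]_n) : (A \in hermitian_pred) = (A == A ^t* ).
Proof. by rewrite unfold_in /hermitian_pred qualifE /= expr0 scale1r. Qed.

Lemma hermitian_zmod_closed : zmod_closed hermitian_pred.
Proof.
split=> [|A B]; first by rewrite hermitian_predE trmx0 map_mx0.
rewrite !hermitian_predE => /eqP hA /eqP hB.
by rewrite linearB /= map_mxB -hA -hB.
Qed.

HB.instance Definition _ :=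
  GRing.isZmodClosed.Build 'M[R[i]]_n hermitian_pred hermitian_zmod_closed.
HB.instance Definition _ := [SubChoice_isSubZmodule of herm by <:].

Lemma hermitian_scale (a : R) (A : 'M[R[i]]_n) :
  A \in hermitian_pred -> a%:C *: A \in hermitian_pred.
Proof.
rewrite !hermitian_predE => /eqP hA.
rewrite linearZ /= map_mxZ -hA; apply/eqP; congr (_ *: _).
exact/esym/conjc_real.
Qed.

Definition herm_scale (a : R) (X : herm) : herm :=
  Herm (hermitian_scale a (valP X)).

Lemma herm_scalerA a b X :
  herm_scale a (herm_scale b X) = herm_scale (a * b) X.
Proof. by apply/val_inj; rewrite /= scalerA rmorphM. Qed.

Lemma herm_scale1r : left_id 1 herm_scale.
Proof. by move=> X; apply/val_inj; rewrite /= rmorph1 scale1r. Qed.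

Lemma herm_scalerDr : right_distributive herm_scale +%R.
Proof. by move=> a X Y; apply/val_inj; rewrite /= scalerDr. Qed.

Lemma herm_scalerDl X : {morph herm_scale^~ X : a b / a + b}.
Proof. by move=> a b; apply/val_inj; rewrite /= rmorphD scalerDl. Qed.

HB.instance Definition _ := GRing.Zmodule_isLmodule.Build R herm
  herm_scalerA herm_scale1r herm_scalerDr herm_scalerDl.

(* Any norm would do: [herm] is finite-dimensional over R, and norms are only
   used through the topology they induce. *)
Definition herm_norm (X : herm) : R := \sum_i \sum_j Normc.normc (X i j).

Lemma herm_normD X Y : herm_norm (X + Y) <= herm_norm X + herm_norm Y.
Proof.
rewrite /herm_norm -big_split /=; apply: ler_sum => i _.
rewrite -big_split /=; apply: ler_sum => j _; rewrite mxE.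
by have := ler_normD (X i j) (Y i j); rewrite -lecR rmorphD.
Qed.

Lemma herm_normZ (a : R) X : herm_norm (a *: X) = `|a| * herm_norm X.
Proof.
rewrite /herm_norm mulr_sumr; apply: eq_bigr => i _.
rewrite mulr_sumr; apply: eq_bigr => j _.
by rewrite mxE Normc.normcM /= expr0n addr0 sqrtr_sqr.
Qed.

Lemma normc_ge0 (z : R[i]) : 0 <= Normc.normc z.
Proof. by case: z => a b; exact: sqrtr_ge0. Qed.

Lemma herm_norm0_eq0 X : herm_norm X = 0 -> X = 0.
Proof.
move=> /eqP; rewrite psumr_eq0 => [/allP h|i _]; last first.
  by apply: sumr_ge0 => j _; exact: normc_ge0.
apply/val_inj/matrixP => i j; rewrite mxE.
have := h i (mem_index_enum _); rewrite psumr_eq0 => [/allP|k _]; last first.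
  exact: normc_ge0.
by move=> /(_ j (mem_index_enum _)) /eqP /Normc.eq0_normc.
Qed.

HB.instance Definition _ := Lmodule_isNormed.Build R herm
  herm_normD herm_normZ herm_norm0_eq0.

Lemma hermitian1 : (1%:M : 'M[R[i]]_n) \in hermitian_pred.
Proof. exact: hermitian1mx_subproof. Qed.

Definition herm1 : herm := Herm hermitian1.

End Hermitian.

Section MatrixFunctions.
Variables (R : realType) (n : nat).
Implicit Types (A : 'M[R[i]]_n) (X Y : herm R n).

(* In the order of R[i], 0 <= z means that z is real and nonnegative. *)
Definition psd X := forall v : 'cV[R[i]]_n, 0 <= (v ^t* *m X *m v) 0 0.

Definition pd X :=
  forall v : 'cV[R[i]]_n, v != 0 -> 0 < (v ^t* *m X *m v) 0 0.

(* Written X << Y: Y is the dominating matrix. *)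
Definition abs_cont X Y := forall v : 'cV[R[i]]_n, Y *m v = 0 -> X *m v = 0.

(* The power A ^ s of a positive definite matrix A, obtained by applying
   t |-> t `^ s to the eigenvalues in a unitary diagonalization of A; the
   eigenvalues of a Hermitian matrix are real elements of R[i], whence Re. *)
Definition mxpowR A (s : R) : 'M[R[i]]_n :=
  invmx (spectralmx A)
  *m diag_mx (map_mx (fun z : R[i] => (complex.Re z `^ s)%:C) (spectral_diag A))
  *m spectralmx A.

(* The trace is a real element of R[i], whence Re. *)
Definition Qpd (alpha : R) X Y : R :=
  let S := mxpowR X (- 2^-1) in
  complex.Re (\tr (X *m mxpowR (S *m Y *m S) (1 - alpha))).

Definition Qeps (alpha : R) X Y (eps : R) : R :=
  Qpd alpha (X + eps *: herm1 R n) (Y + eps *: herm1 R n).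

Definition Qhat (alpha : R) X Y : R :=
  if `[< pd X /\ pd Y >] then Qpd alpha X Y
  else lim (Qeps alpha X Y eps @[eps --> 0^'+]).

Definition Qhat_well_defined (alpha : R) (D : set (herm R n * herm R n)) :=
  forall P, D P -> ~ (pd P.1 /\ pd P.2) ->
    cvg (Qeps alpha P.1 P.2 eps @[eps --> 0^'+]).

Definition logdet X : \bar R := lne (complex.Re (\det X))%:E.

Definition psd_pairs : set (herm R n * herm R n) :=
  [set P | psd P.1 /\ psd P.2].

(* Only meant for alpha in [-1, 0) or (1, 2]. *)
Definition Dhat (alpha : R) : set (herm R n * herm R n) :=
  [set P | psd_pairs P /\
           if alpha < 0 then abs_cont P.2 P.1 else abs_cont P.1 P.2].

Definition hypoQ (alpha : R) : set (herm R n * herm R n * R) :=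
  [set p | psd_pairs p.1 /\ p.2 <= Qhat alpha p.1.1 p.1.2].

Definition epiQ (alpha : R) : set (herm R n * herm R n * R) :=
  [set p | [/\ psd_pairs p.1, Dhat alpha p.1 & Qhat alpha p.1.1 p.1.2 <= p.2]].

(* [lne] is the extended logarithm: lne t = -oo for t <= 0. *)
Definition hypo_barrier (alpha : R) (p : herm R n * herm R n * R) : \bar R :=
  let: (X, Y, z) := p in
  if `[< pd X /\ pd Y >]
  then (- lne (Qhat alpha X Y - z)%:E - logdet X - logdet Y)%E else +oo%E.

Definition epi_barrier (alpha : R) (p : herm R n * herm R n * R) : \bar R :=
  let: (X, Y, z) := p in
  if `[< pd X /\ pd Y >]
  then (- lne (z - Qhat alpha X Y)%:E - logdet X - logdet Y)%E else +oo%E.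

End MatrixFunctions.

Definition convex_on (R : realType) (E : lmodType R) (D : set E)
    (f : E -> R) :=
  convex_set (D : set (convex_lmodType E)) /\
  convex_function (D : set (convex_lmodType E)) f.

Definition concave_on (R : realType) (E : lmodType R) (D : set E)
    (f : E -> R) := convex_on D (fun x => - f x).

Section SelfConcordance.
Variables (R : realType) (E : normedModType R).
Implicit Types (f : E -> \bar R) (x h : E) (nu : R) (Q : set E).

Definition dom f : set E := [set x | (f x < +oo)%E].

Definition econvex f := forall x y (t : R), 0 <= t <= 1 ->
  (f (t *: x + (1 - t) *: y)%R <= t%:E * f x + (1 - t)%:E * f y)%E.

Definition Dk (k : nat) f x h : R :=
  derive1n k (fun t : R => fine (f (x + t *: h))) 0.

(* Class C^k on the open set U: all iterated directional derivatives of order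
   at most k exist and are continuous on U. *)
Fixpoint Ck (k : nat) (U : set E) (g : E -> R) : Prop :=
  (forall x, U x -> {for x, continuous g}) /\
  if k is k'.+1 then
    forall h, (forall x, U x -> derivable g x h) /\ Ck k' U ('D_h g)
  else True.

Definition self_concordant f :=
  [/\ (forall x, f x != -oo%E), econvex f, open (dom f),
      closed [set p : E * R | (f p.1 <= p.2%:E)%E] &
      Ck 3 (dom f) (fine \o f) /\
      forall x h, dom f x -> `|Dk 3 f x h| <= 2 * Dk 2 f x h `^ (3 / 2)].

(* Q is then closed and convex, as the closure of the convex set dom f. *)
Definition sc_barrier Q f := self_concordant f /\ closure (dom f) = Q.

Definition has_parameter nu f :=
  forall x h, dom f x -> 2 * Dk 1 f x h - Dk 2 f x h <= nu.

Definition nu_sc_barrier nu Q f := sc_barrier Q f /\ has_parameter nu f.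

Definition log_homogeneous nu f :=
  convex_set (dom f : set (convex_lmodType E)) /\
  forall x (tau : R), dom f x -> 0 < tau ->
    dom f (tau *: x) /\ f (tau *: x) = (f x - (nu * ln tau)%:E)%E.

Definition lh_sc_barrier nu Q f := sc_barrier Q f /\ log_homogeneous nu f.

Definition parameters_at_least nu Q :=
  forall (g : E -> \bar R) (mu : R), nu_sc_barrier mu Q g -> nu <= mu.

End SelfConcordance.

(* Main.v *)
Require Import Defs.
From mathcomp Require Import all_boot all_order all_algebra.
From mathcomp Require Import ring lra.
From mathcomp Require Import complex.
From mathcomp Require Import all_classical all_reals all_analysis measurable_realfun.

(** Put s = 1 - alpha. For positive definite X and Y, a basis that diagonalizes
both writes Q(X|Y) as a positive combination of the t^s over the eigenvalues t of Y
relative to X ([Qpd_cong]), so integral representations of t^s carry over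
to matrices.

For 0 <= s <= 1, t^s is the average over a probability measure on [0, 1] of the
weighted harmonic means t / ((1 - v) t + v) ([exists_power_functional]). A harmonic
mean is the arithmetic one minus v (1 - v) (t - 1)^2 / ((1 - v) t + v), and the cases
1 <= s <= 2 and -1 <= s <= 0 follow on multiplying or dividing by t. Hence, up to trace terms,
Q or -Q is an average of w(v) tr (L Z^-1 L) with L = a X + b Y and
Z = (1 - v) Y + v X ([repG], [repG_Qpd]).

The function tr (L Z^-1 L) is jointly convex and homogeneous. Along a line,
diagonalizing Z and its increment together turns it into a sum of
(a + b t)^2 / (1 + d t), whose third derivative at 0 is -3 d times the second. So
its third derivative is at most 3 r times the second when the increment is
bounded by r times the base point, and this compatibility survives averaging
([repG_compatible]). For -log of the slack together with -log det X and -log det Y,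
self-concordance then amounts to a polynomial inequality in three
numbers ([self_concordance_scalar]), and the parameter counts the 2n + 1 logarithms.

For the extension to singular pairs, sublinearity makes
G(X + e I, Y + e I) - e G(I, I) nonincreasing in e, so the limit at 0 exists as soon as
these values are bounded; sets of pairs with a bound inherit convexity, and the
closure of the domain of the barrier is the epigraph of the limit
([closure_barrier_dom], [shifted_limit]). For alpha in [0, 1] there is a trivial
bound. Otherwise boundedness is the inclusion of kernels: it implies X <= c Y and a
bound by c tr X, while a vector in ker Y outside ker X makes the shifted values
explode ([closure_le_dominated], [closure_le_abs_cont]).

For optimality, let g be a barrier with parameter mu for the same set, and V its
domain. Then Dg(x)[y - x] <= mu for x, y in V ([derivative_le_parameter]), and
-Dg(x)[p] >= 1/b when p is a recession direction and x - b p is outside V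
([recession_derivative_ge]). At (I, y I, z) there are n directions with b = 1, n with
b = y and one with b close to z, and going back along almost all of each remains in V;
summing gives mu >= 2n + 1 in the limit ([optimal_parameter]). *)

Set Implicit Arguments.
Unset Strict Implicit.
Unset Printing Implicit Defensive.

Import Order.TTheory GRing.Theory Num.Theory.
Import numFieldNormedType.Exports.

Local Open Scope classical_set_scope.
Local Open Scope ring_scope.

(** * Powers as averages of weighted harmonic means *)

Lemma comb_gt0 (R : realType) (p q x y : R) : 0 <= p -> 0 <= q -> 0 < p + q ->
  0 < x -> 0 < y -> 0 < p * x + q * y.
Proof.
rewrite le_eqVlt => /predU1P[<- _|p0 q0 _ x0 y0].
  by rewrite !add0r mul0r add0r => q0 _; exact: mulr_gt0.
by rewrite ltr_pwDl ?mulr_gt0// mulr_ge0// ltW.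
Qed.

Section PositiveFunctional.
Variable R : realType.
Implicit Types (f g : R -> R) (s t : R).
Local Notation mu := (@lebesgue_measure R).

(** Lets a function on [0, 1] be handled as a total continuous function on the line. *)
Definition clamp (x : R) : R := Num.max 0 (Num.min x 1).

Lemma clamp_itv x : 0 <= clamp x <= 1.
Proof. by rewrite /clamp le_max lexx /= ge_max ler01 /= ge_min lexx orbT. Qed.

Lemma clamp_id x : 0 <= x <= 1 -> clamp x = x.
Proof.
by move=> /andP[x0 x1]; rewrite /clamp (min_idPl _)// (max_idPr _).
Qed.

Lemma continuous_clamp : continuous clamp.
Proof.
move=> x; apply: (@continuous_max R R (cst 0) (fun x => Num.min x 1) x).
  exact: cst_continuous.
apply: (@continuous_min R R id (cst 1) x); [exact: cvg_id|exact: cst_continuous].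
Qed.

(** An abstract integral against a finite measure on [0, 1], for continuous
integrands only. *)
Definition positive_functional (J : (R -> R) -> R) :=
  [/\ forall f g, continuous f -> continuous g ->
        J (fun x => f x + g x) = J f + J g,
      forall a f, continuous f -> J (fun x => a * f x) = a * J f &
      forall f, continuous f -> (forall x, 0 <= x <= 1 -> 0 <= f x) -> 0 <= J f].

(** The kernel is the harmonic mean of 1 and t with weights 1 - v and v. *)
Definition represents_power (J : (R -> R) -> R) s :=
  forall t, 0 < t ->
    J (fun x => t / ((1 - clamp x) * t + clamp x)) = t `^ s.

Lemma positive_functional_eval a : 0 <= a <= 1 ->
  positive_functional (fun f => f a).
Proof. by move=> ha; split=> // f _; apply. Qed.

(** In the coordinate u, with v = e^u / (1 + e^u), this is the density
v^(s-1) (1-v)^(-s) dv, up to normalization. *)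
Definition logistic_density s (u : R) : R := expR (s * u) / (1 + expR u).

Definition logistic (u : R) : R := expR u / (1 + expR u).

Lemma expR1_gt0 u : 0 < 1 + expR u :> R.
Proof. by rewrite addr_gt0 ?expR_gt0. Qed.

Lemma expR1_neq0 u : 1 + expR u != 0 :> R.
Proof. by rewrite gt_eqF ?expR1_gt0. Qed.

Lemma logistic_itv u : 0 <= logistic u <= 1.
Proof.
have := expR1_gt0 u; have := expR_gt0 u => e0 e1.
rewrite /logistic ler_pdivrMr// mul1r lerDr ler01 andbT.
by rewrite divr_ge0 ?ltW.
Qed.

Lemma continuous_exp_scale s : continuous (fun u : R => expR (s * u)).
Proof.
move=> u; apply: continuous_comp; last exact: continuous_expR.
by apply: continuousM; [exact: cst_continuous|exact: cvg_id].
Qed.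

Lemma continuous_expR1 : continuous (fun u : R => 1 + expR u).
Proof.
by move=> u; apply: continuousD; [exact: cst_continuous|exact: continuous_expR].
Qed.

Lemma continuous_logistic_density s : continuous (logistic_density s).
Proof.
move=> u; apply: (@continuousM _ _ (fun u => expR (s * u)) (fun u => (1 + expR u)^-1) u).
  exact: continuous_exp_scale.
by apply: (@continuousV _ _ (fun u => 1 + expR u) u); [exact: expR1_neq0|exact: continuous_expR1].
Qed.

Lemma continuous_logistic : continuous logistic.
Proof.
move=> u; apply: (@continuousM _ _ (@expR R) (fun u => (1 + expR u)^-1) u).
  exact: continuous_expR.
by apply: (@continuousV _ _ (fun u => 1 + expR u) u); [exact: expR1_neq0|exact: continuous_expR1].
Qed.

Lemma logistic_density_gt0 s u : 0 < logistic_density s u.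
Proof. by rewrite divr_gt0 ?expR_gt0 ?expR1_gt0. Qed.

Lemma logistic_density_le s r u : 0 < r -> r <= s -> r <= 1 - s ->
  logistic_density s u <= expR (- r * `|u|).
Proof.
move=> r0 rs r1s; rewrite ler_pdivrMr ?expR1_gt0// mulrDr mulr1 -expRD.
have [u0|u0] := leP 0 u.
  rewrite ger0_norm//; apply: (@le_trans _ _ (expR (- r * u + u))).
    by rewrite ler_expR; nra.
  by rewrite lerDr expR_ge0.
rewrite ltr0_norm//; apply: (@le_trans _ _ (expR (- r * - u))).
  by rewrite ler_expR; nra.
by rewrite lerDl expR_ge0.
Qed.

Lemma integral_exp_abs_lty r : 0 < r ->
  (\int[mu]_u (expR (- r * `|u|))%:E < +oo)%E.
Proof.
move=> r0; rewrite (@ge0_symfun_integralT R (fun u => expR (- r * `|u|))).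
- rewrite lte_mul_pinfty//.
  have -> : (\int[mu]_(x in [set x : R | (0 <= x)%R]) (expR (- r * `|x|))%:E =
             \int[mu]_(x in `[0%R, +oo[) (r^-1%:E * (exponential_pdf r x)%:E))%E.
    rewrite -set_itvcy; apply: eq_integral => x /[!inE]/=.
    rewrite in_itv/= andbT => x0.
    rewrite exponential_pdfE// -EFinM mulrA mulVf ?gt_eqF//.
    by rewrite mul1r ger0_norm.
  apply: integrable_lty => //; apply: integrableZl => //.
  exact: integrableS (integrable_exponential_pdf r0).
- by move=> x; exact: expR_ge0.
- move=> x; apply: continuous_comp; last exact: continuous_expR.
  by apply: continuousM; [exact: cst_continuous|exact: norm_continuous].
- by move=> x /=; rewrite normrN.
Qed.

(** The density decays like e^(-r |u|) with r the smaller of s and 1 - s, and f is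
bounded on [0, 1]. *)
Lemma integrable_logistic_density s f : 0 < s < 1 -> continuous f ->
  mu.-integrable setT (EFin \o (fun u => logistic_density s u * f (logistic u))).
Proof.
move=> /andP[s0 s1] cf.
pose r := Num.min s (1 - s).
have r0 : 0 < r by rewrite lt_min s0 subr_gt0.
have cw : continuous (fun u => logistic_density s u * f (logistic u)).
  move=> u; apply: continuousM; first exact: continuous_logistic_density.
  by apply: continuous_comp; [exact: continuous_logistic|exact: cf].
have [M [_ HM]] : bounded_set (f @` `[0, 1]).
  apply: compact_bounded; apply: continuous_compact.
    exact: continuous_subspaceT.
  exact: segment_compact.
have {}HM x : 0 <= x <= 1 -> `|f x| <= `|M| + 1.
  move=> hx; apply: HM; first by rewrite (le_lt_trans (ler_norm M))// ltrDl.
  by exists x => //=; rewrite in_itv.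
apply: (@le_integrable _ _ R mu setT measurableT _
    (EFin \o (fun u => (`|M| + 1) * expR (- r * `|u|)))).
- by apply/measurable_EFinP; exact: continuous_measurable_fun.
- move=> u _; rewrite /= lee_fin normrM [leRHS]normrM.
  rewrite (ger0_norm (ltW (logistic_density_gt0 _ _))) mulrC.
  apply: ler_pM => //; first exact/ltW/logistic_density_gt0.
    by rewrite (le_trans (HM _ _)) ?logistic_itv// ler_norm.
  rewrite (le_trans _ (ler_norm _))//; apply: logistic_density_le => //.
  - by rewrite ge_min lexx.
  - by rewrite ge_min lexx orbT.
- have : mu.-integrable setT (EFin \o (fun u => expR (- r * `|u|))).
    apply/integrableP; split.
      apply/measurable_EFinP; apply: continuous_measurable_fun => x.
      apply: continuous_comp; last exact: continuous_expR.
      by apply: continuousM; [exact: cst_continuous|exact: norm_continuous].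
    under eq_integral do rewrite /= ger0_norm ?expR_ge0//.
    exact: integral_exp_abs_lty.
  by move=> /(integrableZl measurableT (`|M| + 1)).
Qed.

Lemma Rintegral_logistic_density_gt0 s : 0 < s < 1 ->
  0 < Rintegral mu setT (logistic_density s).
Proof.
move=> s01; have s0 : 0 < s by case/andP: s01.
have inte : mu.-integrable setT (EFin \o logistic_density s).
  have : mu.-integrable setT
      (EFin \o (fun u => logistic_density s u * cst 1 (logistic u))).
    by apply: integrable_logistic_density => // x; exact: cst_continuous.
  by congr (mu.-integrable _ _); apply/funext => u /=; rewrite mulr1.
pose m : R := (1 + expR 1)^-1.
have m0 : 0 < m by rewrite invr_gt0 expR1_gt0.
apply: (@lt_le_trans _ _ m) => //.
rewrite -lee_fin /Rintegral fineK; last exact: integrable_fin_num.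
apply: (@le_trans _ _ (\int[mu]_(u in `[0%R, 1%R]) m%:E)%E).
  by rewrite integral_cst//= lebesgue_measure_itv/= lte_fin ltr01 oppr0 adde0 mule1.
apply: (@le_trans _ _ (\int[mu]_(u in `[0%R, 1%R]) (logistic_density s u)%:E)%E).
  apply: ge0_le_integral => //=.
  - by move=> u _; rewrite lee_fin ltW.
  - apply/measurable_EFinP/measurable_funTS; apply: continuous_measurable_fun.
    exact: continuous_logistic_density.
  - move=> u /= /[!in_itv]/= /andP[u0 u1]; rewrite lee_fin /m /logistic_density.
    rewrite -[leLHS]mul1r ler_pM ?invr_ge0 ?(ltW (expR1_gt0 _))//.
      by rewrite -expR0 ler_expR mulr_ge0// ltW.
    rewrite lef_pV2 ?posrE ?expR1_gt0//.
    by rewrite lerD2l ler_expR.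
apply: ge0_subset_integral => //=.
  apply/measurable_EFinP; apply: continuous_measurable_fun.
  exact: continuous_logistic_density.
by move=> u _; rewrite lee_fin ltW// logistic_density_gt0.
Qed.

(** In the coordinate u the integrand is t e^(su) / (t + e^u), and the translation
u |-> u + log t turns it into t^s times the density itself. *)
Lemma logistic_density_power s t : 0 < s < 1 -> 0 < t ->
  Rintegral mu setT (fun u =>
    logistic_density s u *
    (t / ((1 - clamp (logistic u)) * t + clamp (logistic u)))) =
  t `^ s * Rintegral mu setT (logistic_density s).
Proof.
move=> s01 t0; have s0 : 0 < s by case/andP: s01.
pose G (u : R) := t * expR (s * u) / (t + expR u).
have tD0 u : 0 < t + expR u by rewrite addr_gt0 ?expR_gt0.
have cG : continuous G.
  move=> u; apply: (@continuousM _ _ (fun u => t * expR (s * u))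
    (fun u => (t + expR u)^-1) u).
    apply: (@continuousM _ _ (cst t) (fun u => expR (s * u)) u).
      exact: cst_continuous.
    exact: continuous_exp_scale.
  apply: (@continuousV _ _ (fun u => t + expR u) u); first by rewrite gt_eqF.
  apply: (@continuousD _ _ _ (cst t) expR u); first exact: cst_continuous.
  exact: continuous_expR.
pose F (u : R) := u + ln t.
have dF (u : R) : is_derive u 1 F 1.
  by rewrite -[X in is_derive _ _ _ X]addr0; apply: is_deriveD.
have F' : derive1 F = cst 1.
  by apply/funext => u; rewrite derive1E derive_val.
rewrite -RintegralZl//; last first.
  have : mu.-integrable setT
      (EFin \o (fun u => logistic_density s u * cst 1 (logistic u))).
    by apply: integrable_logistic_density => // x; exact: cst_continuous.
  by congr (mu.-integrable _ _); apply/funext => u /=; rewrite mulr1.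
rewrite /Rintegral; congr fine.
under eq_integral => u _.
  rewrite clamp_id ?logistic_itv//.
  have -> : logistic_density s u * (t / ((1 - logistic u) * t + logistic u)) =
      G u.
    rewrite /logistic_density /logistic /G.
    have /lt0r_neq0 := tD0 u; have := expR1_neq0 u => e1 e2.
    by field; rewrite e1 e2.
  over.
rewrite (@increasing_ge0_integration_by_substitutionT _ F G); first last.
- by move=> u; rewrite /G divr_ge0 ?mulr_ge0 ?expR_ge0// ltW.
- exact: cG.
- apply/cvgryPge => A; exists (A - ln t); split; first exact: num_real.
  by move=> u /ltW; rewrite /F lerBlDr.
- apply/cvgrNyPle => A; exists (A - ln t); split; first exact: num_real.
  by move=> u /ltW; rewrite /F lerBrDr.
- by move=> u; case: (dF u).
- by rewrite F'; exact: is_cvg_cst.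
- by rewrite F'; exact: is_cvg_cst.
- by rewrite F' => u; exact: cst_continuous.
- by move=> x y; rewrite /F ltrD2r.
apply: eq_integral => u _; rewrite F' /= mulr1; congr _%:E.
rewrite [LHS]/= /G /F /logistic_density mulrDr !expRD (lnK t0).
rewrite /powR gt_eqF//.
have e1 := expR1_neq0 u; have e2 := lt0r_neq0 t0.
field.
by rewrite e1 -[X in X + _]mul1r -mulrDl mulf_neq0.
Qed.

(** For s = 0 and s = 1 the measure degenerates to a point mass at the end points. *)
Lemma exists_power_functional s : 0 <= s <= 1 ->
  exists J, positive_functional J /\ represents_power J s.
Proof.
move=> /andP[]; rewrite le_eqVlt => /predU1P[<- _|s0].
  exists (fun f => f 0); split.
    by apply: (@positive_functional_eval 0); rewrite lexx ler01.
  move=> t t0; rewrite clamp_id ?lexx ?ler01// subr0 mul1r addr0 powRr0.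
  by rewrite divff// gt_eqF.
rewrite le_eqVlt => /predU1P[->|s1].
  exists (fun f => f 1); split.
    by apply: (@positive_functional_eval 1); rewrite ler01 lexx.
  move=> t t0; rewrite clamp_id ?lexx ?ler01// subrr mul0r add0r divr1.
  by rewrite powRr1// ltW.
have s01 : 0 < s < 1 by rewrite s0.
pose c := Rintegral mu setT (logistic_density s).
have c0 : 0 < c := Rintegral_logistic_density_gt0 s01.
exists (fun f => c^-1 * Rintegral mu setT (fun u =>
  logistic_density s u * f (logistic u))); split; last first.
  move=> t t0; rewrite logistic_density_power// mulrC -mulrA mulfV ?mulr1//.
  by rewrite gt_eqF.
split=> [f g cf cg|a f cf|f cf f0].
- rewrite -mulrDr -RintegralD//; try exact: integrable_logistic_density.
  by congr (_ * _); apply: eq_Rintegral => u _; rewrite mulrDr.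
- rewrite [RHS]mulrCA -[in RHS]RintegralZl//; last exact: integrable_logistic_density.
  by congr (_ * _); apply: eq_Rintegral => u _; rewrite mulrCA.
- rewrite mulr_ge0 ?invr_ge0 ?(ltW c0)//; apply: Rintegral_ge0 => u _.
  by rewrite mulr_ge0 ?(ltW (logistic_density_gt0 _ _))// f0 ?logistic_itv.
Qed.

End PositiveFunctional.

(** * Complex matrices up to congruence *)

Section ComplexMatrices.
Local Open Scope complex_scope.
Local Open Scope sesquilinear_scope.
Variable R : realType.
Local Notation C := R[i].
Implicit Types (z : C).

(** Squared modulus, with values in R rather than in R[i]. *)
Definition sqn z : R := complex.Re z ^+ 2 + complex.Im z ^+ 2.

Lemma sqn_ge0 z : 0 <= sqn z.
Proof. by rewrite addr_ge0 ?sqr_ge0. Qed.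

Lemma sqn_eq0 z : (sqn z == 0) = (z == 0).
Proof.
case: z => a b; rewrite /sqn /= paddr_eq0 ?sqr_ge0// !sqrf_eq0.
by rewrite eq_complex.
Qed.

Lemma sqn_gt0 z : (0 < sqn z) = (z != 0).
Proof. by rewrite lt_def sqn_ge0 andbT sqn_eq0. Qed.

Lemma conjM_sqn z : Num.conj z * z = (sqn z)%:C.
Proof.
case: z => a b; rewrite /sqn; apply/eqP; rewrite eq_complex /=.
by apply/andP; split; apply/eqP; ring.
Qed.

Lemma sqnM x y : sqn (x * y) = sqn x * sqn y.
Proof. by case: x y => [a b] [c d]; rewrite /sqn /=; ring. Qed.

Lemma sqnR (a : R) : sqn a%:C = a ^+ 2.
Proof. by rewrite /sqn /= expr0n addr0. Qed.

Lemma ReM_real (a : R) z : complex.Re (a%:C * z) = a * complex.Re z.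
Proof. by case: z => x y /=; rewrite mul0r subr0. Qed.

Lemma ImM_real (a : R) z : complex.Im (a%:C * z) = a * complex.Im z.
Proof. by case: z => x y /=; rewrite mul0r addr0. Qed.

Lemma Re_sum I (r : seq I) (P : pred I) (F : I -> C) :
  complex.Re (\sum_(i <- r | P i) F i) = \sum_(i <- r | P i) complex.Re (F i).
Proof.
by apply: (big_morph (@complex.Re R)) => // -[a b] [c d].
Qed.

Lemma Im_sum I (r : seq I) (P : pred I) (F : I -> C) :
  complex.Im (\sum_(i <- r | P i) F i) = \sum_(i <- r | P i) complex.Im (F i).
Proof.
by apply: (big_morph (@complex.Im R)) => // -[a b] [c d].
Qed.

Lemma ltr0c (a : R) : (0 < a%:C :> C) = (0 < a).
Proof. exact: (ltcR 0 a). Qed.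

Lemma conjC_real (a : R) : Num.conj (a%:C : C) = a%:C.
Proof. exact: conjc_real. Qed.

Lemma ctmx_mul m n p (A : 'M[C]_(m, n)) (B : 'M[C]_(n, p)) :
  (A *m B) ^t* = B ^t* *m A ^t*.
Proof. by rewrite trmx_mul map_mxM. Qed.

Lemma ctmx_inv n (A : 'M[C]_n) : (invmx A) ^t* = invmx (A ^t*).
Proof. by rewrite trmx_inv map_invmx. Qed.

Lemma ctmx_unit n (A : 'M[C]_n) : (A ^t* \in unitmx) = (A \in unitmx).
Proof. by rewrite map_unitmx unitmx_tr. Qed.

Definition rdiag n (d : 'I_n -> R) : 'M[C]_n := diag_mx (\row_i (d i)%:C).

Lemma ctmx_rdiag n (d : 'I_n -> R) : (rdiag d) ^t* = rdiag d.
Proof.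
rewrite /rdiag tr_diag_mx map_diag_mx; congr diag_mx.
by apply/rowP => i; rewrite !mxE; exact: conjC_real.
Qed.

Lemma rdiagM n (d e : 'I_n -> R) : rdiag d *m rdiag e = rdiag (fun i => d i * e i).
Proof.
rewrite /rdiag mulmx_diag; congr diag_mx.
by apply/rowP => i; rewrite !mxE rmorphM.
Qed.

Lemma rdiagD n (d e : 'I_n -> R) : rdiag d + rdiag e = rdiag (fun i => d i + e i).
Proof.
rewrite /rdiag -raddfD; congr diag_mx.
by apply/rowP => i; rewrite !mxE rmorphD.
Qed.

Lemma rdiagZ n a (d : 'I_n -> R) : a%:C *: rdiag d = rdiag (fun i => a * d i).
Proof.
rewrite /rdiag -linearZ; congr diag_mx.
by apply/rowP => i; rewrite !mxE rmorphM.
Qed.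

Lemma rdiag1 n : rdiag (fun _ : 'I_n => 1) = 1%:M.
Proof.
rewrite /rdiag -diag_const_mx; congr diag_mx.
by apply/rowP => i; rewrite !mxE.
Qed.

Lemma eq_rdiag n (d e : 'I_n -> R) : d =1 e -> rdiag d = rdiag e.
Proof. by move=> /funext ->. Qed.

Lemma rdiagV n (d : 'I_n -> R) : (forall i, d i != 0) ->
  rdiag d *m rdiag (fun i => (d i)^-1) = 1%:M.
Proof.
move=> d0; rewrite rdiagM -rdiag1; apply: eq_rdiag => i.
by rewrite mulfV.
Qed.

(** All quantities below depend on Hermitian matrices through such decompositions
with a common invertible B, which reduces them to sums over scalars. *)
Definition cong n (B : 'M[C]_n) (d : 'I_n -> R) : 'M[C]_n :=
  B ^t* *m rdiag d *m B.

Lemma congD n (B : 'M[C]_n) d e : cong B d + cong B e = cong B (fun i => d i + e i).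
Proof. by rewrite /cong -mulmxDl -mulmxDr rdiagD. Qed.

Lemma congZ n (B : 'M[C]_n) a d : a%:C *: cong B d = cong B (fun i => a * d i).
Proof. by rewrite /cong -rdiagZ -scalemxAr -scalemxAl. Qed.

Lemma cong1 n (B : 'M[C]_n) : cong B (fun=> 1) = B ^t* *m B.
Proof. by rewrite /cong rdiag1 mulmx1. Qed.

Lemma eq_cong n (B : 'M[C]_n) d e : d =1 e -> cong B d = cong B e.
Proof. by move=> /funext ->. Qed.

Lemma ctmx_cong n (B : 'M[C]_n) d : (cong B d) ^t* = cong B d.
Proof. by rewrite /cong !ctmx_mul trmxCK ctmx_rdiag mulmxA. Qed.

Lemma cong_entry n m (M : 'M[C]_(n, m)) (d : 'I_n -> R) j :
  (M ^t* *m rdiag d *m M) j j = (\sum_i d i * sqn (M i j))%:C.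
Proof.
rewrite rmorph_sum /= mxE; apply: eq_bigr => i _.
rewrite mul_mx_diag !mxE rmorphM /= -conjM_sqn; ring.
Qed.

Lemma trace_cong n m (M : 'M[C]_(n, m)) (d : 'I_n -> R) :
  complex.Re (\tr (M ^t* *m rdiag d *m M)) =
  \sum_i \sum_j d i * sqn (M i j).
Proof.
rewrite /mxtrace exchange_big Re_sum; apply: eq_bigr => j _.
by rewrite cong_entry.
Qed.

Lemma det_cong n (B : 'M[C]_n) d :
  \det (cong B d) = (sqn (\det B) * \prod_i d i)%:C.
Proof.
rewrite /cong !det_mulmx det_diag det_map_mx det_tr mulrAC conjM_sqn rmorphM.
congr (_ * _); rewrite rmorph_prod /=; apply: eq_bigr => i _.
by rewrite mxE.
Qed.

Lemma invmx_cong n (B : 'M[C]_n) d : B \in unitmx -> (forall i, d i != 0) ->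
  invmx (cong B d) = invmx B *m rdiag (fun i => (d i)^-1) *m (invmx B) ^t*.
Proof.
move=> uB d0; have E : cong B d *m
    (invmx B *m rdiag (fun i => (d i)^-1) *m (invmx B) ^t*) = 1%:M.
  rewrite /cong !mulmxA mulmxK// -(mulmxA (B ^t* )) rdiagV// mulmx1.
  by rewrite ctmx_inv mulmxV// ctmx_unit.
have [u _] := mulmx1_unit E.
by rewrite -[LHS]mulmx1 -E mulKmx.
Qed.

Definition kform n (L Z : 'M[C]_n) : R := complex.Re (\tr (L *m invmx Z *m L)).

Lemma kform_cong n (L B : 'M[C]_n) d : L ^t* = L -> B \in unitmx ->
  (forall i, d i != 0) ->
  kform L (cong B d) = \sum_i \sum_j sqn (((invmx B) ^t* *m L) i j) / d i.
Proof.
move=> hL uB d0; rewrite /kform invmx_cong//.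
have -> : L *m (invmx B *m rdiag (fun i => (d i)^-1) *m (invmx B) ^t* ) *m L =
    ((invmx B) ^t* *m L) ^t* *m rdiag (fun i => (d i)^-1) *m ((invmx B) ^t* *m L).
  by rewrite ctmx_mul hL trmxCK !mulmxA.
rewrite trace_cong; apply: eq_bigr => i _; apply: eq_bigr => j _.
by rewrite mulrC.
Qed.

Lemma kform_cong2 n (B : 'M[C]_n) l d : B \in unitmx ->
  (forall i, d i != 0) ->
  kform (cong B l) (cong B d) = \sum_i \sum_j l i ^+ 2 / d i * sqn (B i j).
Proof.
move=> uB d0; rewrite kform_cong// ?ctmx_cong//.
apply: eq_bigr => i _; apply: eq_bigr => j _.
rewrite /cong !mulmxA ctmx_inv mulVmx ?ctmx_unit// mul1mx /rdiag.
by rewrite mul_diag_mx !mxE sqnM sqnR mulrAC.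
Qed.

Lemma cauchy_schwarz n (u v : 'cV[C]_n) :
  sqn ((u ^t* *m v) 0 0) <= (\sum_i sqn (u i 0)) * (\sum_i sqn (v i 0)).
Proof.
have : `|(v^T *m u^T ^t* ) 0 0| ^+ 2 <=
    (v^T *m v^T ^t* ) 0 0 * (u^T *m u^T ^t* ) 0 0.
  by rewrite -!dotmxE; case: (CauchySchwarz (@dotmx C n) v^T u^T).
rewrite -lecR rmorphM /=.
have E (w : 'cV[C]_n) : (w^T *m w^T ^t* ) 0 0 = (\sum_i sqn (w i 0))%:C.
  rewrite mxE rmorph_sum; apply: eq_bigr => i _; rewrite !mxE mulrC.
  exact: conjM_sqn.
rewrite !E [X in _ <= X]mulrC -add_Re2_Im2; congr (_ <= _).
congr (_%:C); rewrite -[LHS]/(sqn _); congr sqn.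
by rewrite !mxE; apply: eq_bigr => i _; rewrite !mxE mulrC.
Qed.

Lemma spectral_cong n (A : 'M[C]_n) : A ^t* = A ->
  A = cong (spectralmx A) (fun i => complex.Re (spectral_diag A 0 i)).
Proof.
move=> hA; have hA' : A \is hermsymmx.
  by apply/is_hermitianmxP; rewrite expr0 scale1r hA.
have /hermitian_normalmx/orthomx_spectralP {1}-> := hA'.
have <- : rdiag (fun i => complex.Re (spectral_diag A 0 i)) =
    diag_mx (spectral_diag A).
  congr diag_mx; apply/rowP => i; rewrite mxE.
  have /mxOverP /(_ 0 i) := hermitian_spectral_diag_real hA'.
  by move=> /RRe_real.
by rewrite invmx_unitary ?spectral_unitarymx.
Qed.

Lemma spectral_ctmxK n (A : 'M[C]_n) :
  (spectralmx A) ^t* *m spectralmx A = 1%:M.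
Proof.
by rewrite -invmx_unitary ?spectral_unitarymx// mulVmx ?spectral_unit.
Qed.

Definition qf n (A : 'M[C]_n) (v : 'cV[C]_n) : R :=
  complex.Re ((v ^t* *m A *m v) 0 0).

Lemma qfD n (A B : 'M[C]_n) v : qf (A + B) v = qf A v + qf B v.
Proof. by rewrite /qf mulmxDr mulmxDl mxE; case: (_ 0 0) (_ 0 0) => [? ?] []. Qed.

Lemma qfZ n a (A : 'M[C]_n) v : qf (a%:C *: A) v = a * qf A v.
Proof. by rewrite /qf -scalemxAr -scalemxAl mxE ReM_real. Qed.

Lemma qf_congE n (B : 'M[C]_n) d (v : 'cV[C]_n) :
  (v ^t* *m cong B d *m v) 0 0 = (\sum_i d i * sqn ((B *m v) i 0))%:C.
Proof. by rewrite -cong_entry ctmx_mul /cong !mulmxA. Qed.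

Lemma qf_cong n (B : 'M[C]_n) d (v : 'cV[C]_n) :
  qf (cong B d) v = \sum_i d i * sqn ((B *m v) i 0).
Proof. by rewrite /qf qf_congE. Qed.

End ComplexMatrices.

Section HermitianForms.
Local Open Scope complex_scope.
Local Open Scope sesquilinear_scope.
Variables (R : realType) (n : nat).
Local Notation C := R[i].
Local Notation H := (herm R n).
Implicit Types (X Y Z K : H) (B : 'M[C]_n) (d : 'I_n -> R).

Lemma herm_ct X : (X : 'M[C]_n) ^t* = X.
Proof.
have : (X : 'M[C]_n) \in @hermitian_pred R n := valP X.
by rewrite hermitian_predE => /eqP {2}->.
Qed.

Lemma hermP A : A ^t* = A -> A \in @hermitian_pred R n.
Proof. by move=> hA; rewrite hermitian_predE hA. Qed.

Lemma herm_valD X Y : herm_val (X + Y) = herm_val X + herm_val Y.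
Proof. by []. Qed.

Lemma herm_valB X Y : herm_val (X - Y) = herm_val X - herm_val Y.
Proof. by []. Qed.

Lemma herm_valZ (a : R) X : herm_val (a *: X) = a%:C *: herm_val X.
Proof. by []. Qed.

Lemma herm_spectral X : exists B d,
  [/\ B \in unitmx, B ^t* *m B = 1%:M & (X : 'M[C]_n) = cong B d].
Proof.
exists (spectralmx X), (fun i => complex.Re (spectral_diag X 0 i)).
by split; [exact: spectral_unit|exact: spectral_ctmxK|exact/spectral_cong/herm_ct].
Qed.

Lemma qf_herm X (v : 'cV[C]_n) : (v ^t* *m X *m v) 0 0 = (qf X v)%:C.
Proof. by have [B [d [_ _ E]]] := herm_spectral X; rewrite E qf_congE qf_cong. Qed.

Lemma pdE X : pd X <-> forall v, v != 0 -> 0 < qf X v.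
Proof.
by split=> h v /h; rewrite qf_herm ltr0c.
Qed.

Lemma psdE X : psd X <-> forall v, 0 <= qf X v.
Proof.
by split=> h v; have := h v; rewrite qf_herm ler0c.
Qed.

Lemma pd_psd X : pd X -> psd X.
Proof.
move=> /pdE h; apply/psdE => v; have [->|/h/ltW//] := eqVneq v 0.
by rewrite /qf mulmx0 mxE.
Qed.

(** The vector involved is the preimage under B of the i-th basis vector: it reads
the i-th coefficient off a matrix congruent to a diagonal one by B. *)
Lemma sqn_basis B i k : B \in unitmx ->
  sqn ((B *m (invmx B *m delta_mx i (0 : 'I_1))) k 0) = (k == i)%:R.
Proof.
move=> uB; rewrite mulKVmx// mxE eqxx andbT.
by case: eqP => _; rewrite /sqn /= ?expr0n ?expr1n addr0.
Qed.

Lemma basis_neq0 B i : B \in unitmx -> invmx B *m delta_mx i (0 : 'I_1) != 0.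
Proof.
move=> uB; apply: contra_eq_neq (sqn_basis i i uB) => /= ->.
by rewrite mulmx0 mxE /sqn /= expr0n addr0 eqxx eq_sym oner_neq0.
Qed.

Lemma qf_basis B d i : B \in unitmx ->
  qf (cong B d) (invmx B *m delta_mx i 0) = d i.
Proof.
move=> uB; rewrite qf_cong (bigD1 i)//= sqn_basis// eqxx mulr1 big1 ?addr0//.
by move=> k /negbTE ki; rewrite sqn_basis// ki mulr0.
Qed.

Lemma pd_cong X B d : B \in unitmx -> (X : 'M[C]_n) = cong B d ->
  pd X <-> forall i, 0 < d i.
Proof.
move=> uB E; split=> [/pdE h i|h].
  by rewrite -(qf_basis d i uB) -E h// basis_neq0.
apply/pdE => v v0; rewrite E qf_cong.
have d0 i : 0 <= d i * sqn ((B *m v) i 0) by rewrite mulr_ge0 ?sqn_ge0 ?ltW.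
rewrite lt_def sumr_ge0// andbT; apply: contra v0.
rewrite psumr_eq0// => /allP z; apply/eqP.
rewrite -(mulKmx uB v); apply/eqP; rewrite -[X in _ == X](mulmx0 _ (invmx B)).
apply/eqP; congr (_ *m _); apply/colP => i; rewrite [RHS]mxE; apply/eqP.
have := z i (mem_index_enum _); rewrite mulf_eq0 gt_eqF//= sqn_eq0.
by [].
Qed.

Lemma psd_cong X B d : B \in unitmx -> (X : 'M[C]_n) = cong B d ->
  psd X <-> forall i, 0 <= d i.
Proof.
move=> uB E; split=> [/psdE h i|h].
  by rewrite -(qf_basis d i uB) -E h.
apply/psdE => v; rewrite E qf_cong; apply: sumr_ge0 => i _.
by rewrite mulr_ge0 ?sqn_ge0.
Qed.

Lemma psd_factor X : psd X -> exists M : 'M[C]_n, (X : 'M[C]_n) = M ^t* *m M.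
Proof.
have [B [d [uB _ E]]] := herm_spectral X; move=> /(psd_cong uB E) d0.
exists (rdiag (fun i => Num.sqrt (d i)) *m B).
rewrite ctmx_mul ctmx_rdiag mulmxA -(mulmxA (B ^t* )) rdiagM E.
rewrite -[RHS]/(cong B _); apply: eq_cong => i.
by rewrite -expr2 sqr_sqrtr.
Qed.

Lemma qf_factor m (M : 'M[C]_(m, n)) (v : 'cV[C]_n) :
  qf (M ^t* *m M) v = \sum_i sqn ((M *m v) i 0).
Proof.
have := cong_entry (M *m v) (fun=> 1) 0; rewrite rdiag1 mulmx1 ctmx_mul.
rewrite /qf !mulmxA => -> /=.
by apply: eq_bigr => i _; rewrite mul1r.
Qed.

Lemma pd_unit_cong Z : pd Z ->
  exists2 B, B \in unitmx & (Z : 'M[C]_n) = B ^t* *m B.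
Proof.
have [B [d [uB _ E]]] := herm_spectral Z; move=> /(pd_cong uB E) d0.
exists (rdiag (fun i => Num.sqrt (d i)) *m B).
  rewrite unitmx_mul uB andbT; apply: (proj1 (mulmx1_unit (rdiagV _))) => i.
  by rewrite gt_eqF// sqrtr_gt0.
rewrite ctmx_mul ctmx_rdiag mulmxA -(mulmxA (B ^t* )) rdiagM E.
rewrite -[RHS]/(cong B _); apply: eq_cong => i.
by rewrite -expr2 sqr_sqrtr// ltW.
Qed.

(** Write Z = B0* B0 and diagonalize the Hermitian matrix B0^-* K B0^-1 by a
unitary matrix. *)
Lemma simultaneous_cong Z K : pd Z -> exists B d,
  [/\ B \in unitmx, (Z : 'M[C]_n) = cong B (fun=> 1) & (K : 'M[C]_n) = cong B d].
Proof.
move=> /pd_unit_cong[B0 uB0 EZ].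
pose K' := (invmx B0) ^t* *m K *m invmx B0.
have hK' : K' ^t* = K' by rewrite /K' !ctmx_mul trmxCK herm_ct mulmxA.
pose U := spectralmx K'.
have UU : U ^t* *m U = 1%:M by exact: spectral_ctmxK.
exists (U *m B0), (fun i => complex.Re (spectral_diag K' 0 i)); split.
- by rewrite unitmx_mul uB0 spectral_unit.
- by rewrite cong1 ctmx_mul mulmxA -(mulmxA _ _ U) UU mulmx1.
- have := spectral_cong hK'; rewrite -/U => EK.
  rewrite /cong ctmx_mul.
  transitivity (B0 ^t* *m K' *m B0).
    by rewrite /K' !mulmxA ctmx_inv mulmxV ?ctmx_unit// mul1mx mulmxKV.
  by rewrite {1}EK /cong !mulmxA.
Qed.

End HermitianForms.

(** * Convexity and bounds for the trace of L Z^-1 L *)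

Section FractionalForms.
Local Open Scope complex_scope.
Local Open Scope sesquilinear_scope.
Variables (R : realType) (n : nat).
Local Notation C := R[i].
Local Notation H := (herm R n).
Implicit Types (X Y Z K L : H) (B : 'M[C]_n) (d : 'I_n -> R).

Lemma pencil_cong B d Z K p q : (Z : 'M[C]_n) = cong B (fun=> 1) ->
  (K : 'M[C]_n) = cong B d ->
  herm_val (p *: Z + q *: K) = cong B (fun i => p + q * d i).
Proof.
move=> E1 E2; rewrite herm_valD !herm_valZ E1 E2 !congZ congD.
by apply: eq_cong => i; rewrite mulr1.
Qed.

(** After diagonalizing Z and K together, the form along the plane spanned by
(L1, Z) and (L2, K) is a sum of scalar functions (p a + q b)^2 / (p + q d). *)
Lemma kform_pencil B d Z K L1 L2 p q : B \in unitmx ->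
  (Z : 'M[C]_n) = cong B (fun=> 1) -> (K : 'M[C]_n) = cong B d ->
  (forall i, 0 < p + q * d i) ->
  kform (p *: L1 + q *: L2 : H) (p *: Z + q *: K : H) =
  \sum_i \sum_j sqn (p%:C * ((invmx B) ^t* *m L1) i j +
                     q%:C * ((invmx B) ^t* *m L2) i j) / (p + q * d i).
Proof.
move=> uB E1 E2 d0; rewrite (pencil_cong p q E1 E2) kform_cong//; first last.
- by move=> i; rewrite gt_eqF.
- exact: herm_ct.
apply: eq_bigr => i _; apply: eq_bigr => j _; congr (sqn _ / _).
by rewrite herm_valD !herm_valZ mulmxDr -!scalemxAr !mxE.
Qed.

(** Joint convexity of |z|^2 / d, which is the scalar case of the next lemma. *)
Lemma sqnD_le (a b : C) (p q d : R) : 0 <= p -> 0 <= q -> 0 < d ->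
  0 < p + q * d ->
  sqn (p%:C * a + q%:C * b) / (p + q * d) <= p * (sqn a) + q * (sqn b / d).
Proof.
move=> p0 q0 d0 pq0; rewrite ler_pdivrMr//.
have E : sqn b = sqn b / d * d by rewrite divfK// gt_eqF.
have [e [f [-> ->]]] : exists e f, b = d%:C * (e +i* f) /\
    sqn b / d = d * (e ^+ 2 + f ^+ 2).
  case: b E => x y _; exists (x / d), (y / d); split.
    apply/eqP; rewrite eq_complex /= !mul0r subr0 addr0.
    by apply/andP; split; apply/eqP; rewrite mulrC divfK// gt_eqF.
  by rewrite /sqn /=; field; rewrite gt_eqF.
case: a => x y; rewrite /sqn /= -subr_ge0.
have -> : (p * (x ^+ 2 + y ^+ 2) + q * (d * (e ^+ 2 + f ^+ 2))) * (p + q * d) -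
   ((p * x - 0 * y + (q * (d * e - 0 * f) - 0 * (d * f + 0 * e))) ^+ 2 +
    (p * y + 0 * x + (q * (d * f + 0 * e) + 0 * (d * e - 0 * f))) ^+ 2) =
   p * q * d * ((x - e) ^+ 2 + (y - f) ^+ 2) by ring.
by rewrite !mulr_ge0 ?addr_ge0 ?sqr_ge0// ltW.
Qed.

Lemma kform_sublinear Z1 Z2 L1 L2 p q : pd Z1 -> pd Z2 ->
  0 <= p -> 0 <= q -> 0 < p + q ->
  kform (p *: L1 + q *: L2 : H) (p *: Z1 + q *: Z2 : H) <=
  p * kform L1 Z1 + q * kform L2 Z2.
Proof.
move=> pd1 pd2 p0 q0 pq.
have [B [d [uB E1 E2]]] := simultaneous_cong Z2 pd1.
have d0 := (pd_cong uB E2).1 pd2.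
have pqd i : 0 < p + q * d i.
  by have := comb_gt0 p0 q0 pq ltr01 (d0 i); rewrite mulr1.
rewrite (kform_pencil _ _ uB E1 E2 pqd) E1 E2 !kform_cong ?herm_ct//; last first.
  by move=> i; rewrite gt_eqF.
rewrite !mulr_sumr -big_split; apply: ler_sum => i _.
rewrite !mulr_sumr -big_split; apply: ler_sum => j _ /=.
by rewrite divr1 sqnD_le.
Qed.

Lemma kform_ge0 Z L : pd Z -> 0 <= kform L Z.
Proof.
move=> /pd_unit_cong[B uB ->]; rewrite -cong1 kform_cong ?herm_ct//.
by do 2 (apply: sumr_ge0 => ? _); rewrite divr1 sqn_ge0.
Qed.

(** In coordinates where Z = 1 and X is diagonal the hypothesis bounds the
eigenvalues d of X by c, so d^2 <= c d. *)
Lemma kform_le_trace Z X c : pd Z -> psd X ->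
  (forall v : 'cV[C]_n, qf X v <= c * qf Z v) ->
  kform X Z <= c * complex.Re (\tr X).
Proof.
move=> pdZ psX h; have [B [d [uB E1 E2]]] := simultaneous_cong X pdZ.
have d0 := (psd_cong uB E2).1 psX.
rewrite E1 E2 kform_cong2// trace_cong mulr_sumr.
apply: ler_sum => i _; rewrite mulr_sumr; apply: ler_sum => j _.
have := h (invmx B *m delta_mx i 0); rewrite E1 E2 !qf_basis// mulr1 => dc.
by rewrite divr1 mulrA ler_wpM2r ?sqn_ge0// expr2 ler_wpM2r.
Qed.

Lemma sqn_mulmx_le m (M : 'M[C]_(m, n)) (v : 'cV[C]_n) :
  \sum_i sqn ((M *m v) i 0) <=
  (\sum_i \sum_j sqn (M i j)) * \sum_j sqn (v j 0).
Proof.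
rewrite mulr_suml; apply: ler_sum => i _.
have := cauchy_schwarz ((row i M) ^t* ) v; rewrite trmxCK.
rewrite -row_mul mxE => /le_trans; apply.
rewrite ler_wpM2r ?sumr_ge0// => [j _|]; first exact: sqn_ge0.
apply: ler_sum => j _; rewrite !mxE.
by case: (M i j) => a b; rewrite /sqn /= sqrrN.
Qed.

(** Cauchy-Schwarz for v* X v = (B v)* (B^-* X v), where Z = B* B. *)
Lemma kform_lower Z X (v : 'cV[C]_n) : pd Z ->
  qf X v ^+ 2 <= qf Z v * kform X Z * \sum_i sqn (v i 0).
Proof.
move=> /pd_unit_cong[B uB EZ].
rewrite {2}EZ -cong1 kform_cong ?herm_ct// EZ qf_factor.
set M := (invmx B) ^t* *m X.
have -> : qf X v = complex.Re (((B *m v) ^t* *m (M *m v)) 0 0).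
  have EM : B ^t* *m M = X.
    by rewrite /M mulmxA ctmx_inv mulmxV ?ctmx_unit// mul1mx.
  by rewrite /qf -EM ctmx_mul !mulmxA.
set z := (_ *m _) 0 0.
have : complex.Re z ^+ 2 <= sqn z by rewrite lerDl sqr_ge0.
move=> /le_trans; apply.
apply: (le_trans (cauchy_schwarz _ _)); rewrite -mulrA ler_wpM2l//.
  by apply: sumr_ge0 => i _; exact: sqn_ge0.
apply: (le_trans (sqn_mulmx_le _ _)); rewrite ler_wpM2r//.
  by apply: sumr_ge0 => i _; exact: sqn_ge0.
by apply: ler_sum => i _; apply: ler_sum => j _; rewrite divr1.
Qed.

Lemma unitary_congM (U : 'M[C]_n) d e : U ^t* *m U = 1%:M ->
  cong U d *m cong U e = cong U (fun i => d i * e i).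
Proof.
move=> UU; have UU' : U *m U ^t* = 1%:M by apply: mulmx1C.
have -> : cong U d *m cong U e =
    U ^t* *m rdiag d *m (U *m U ^t* ) *m (rdiag e *m U).
  by rewrite /cong -!mulmxA.
by rewrite UU' mulmx1 mulmxA -(mulmxA (U ^t* )) rdiagM.
Qed.

Lemma mxpowR_cong (A : 'M[C]_n) s : mxpowR A s =
  cong (spectralmx A) (fun i => complex.Re (spectral_diag A 0 i) `^ s).
Proof.
rewrite /mxpowR (invmx_unitary (spectral_unitarymx _)).
have -> : map_mx (fun z : C => (complex.Re z `^ s)%:C) (spectral_diag A) =
    \row_i (complex.Re (spectral_diag A 0 i) `^ s)%:C.
  by apply/rowP => i; rewrite !mxE.
reflexivity.
Qed.

Lemma mxpowR_inv_sqrt X : pd X -> exists S S' : 'M[C]_n,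
  [/\ S = mxpowR X (- 2^-1), S ^t* = S, S' ^t* = S', S *m S' = 1%:M &
      S' *m S' = X].
Proof.
move=> pdX.
pose U := spectralmx X; pose x i : R := complex.Re (spectral_diag X 0 i).
have UU : U ^t* *m U = 1%:M := spectral_ctmxK X.
have EX : (X : 'M[C]_n) = cong U x := spectral_cong (herm_ct X).
have x0 : forall i, 0 < x i := (pd_cong (spectral_unit X) EX).1 pdX.
exists (cong U (fun i => x i `^ (- 2^-1))), (cong U (fun i => x i `^ 2^-1)).
split; [by rewrite mxpowR_cong|exact: ctmx_cong|exact: ctmx_cong| |].
  rewrite (unitary_congM _ _ UU) -[RHS]UU -cong1; apply: eq_cong => i.
  by rewrite -powRD ?addNr ?powRr0// (gt_eqF (x0 i)) implybT.
rewrite EX (unitary_congM _ _ UU); apply: eq_cong => i.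
rewrite -powRD; last by rewrite (gt_eqF (x0 i)) implybT.
rewrite -mulr2n -[_ *+ 2]mulr_natr mulVf ?pnatr_eq0// powRr1//.
exact/ltW/x0.
Qed.

(** With T = X^-1/2 Y X^-1/2 = V* diag(d) V, the matrix B = V X^1/2 diagonalizes
X and Y together; the entropy is then a sum over relative eigenvalues. *)
Lemma Qpd_cong X Y : pd X -> pd Y -> exists B d,
  [/\ B \in unitmx, (X : 'M[C]_n) = cong B (fun=> 1), (Y : 'M[C]_n) = cong B d &
   forall alpha, Qpd alpha X Y =
     \sum_i \sum_j d i `^ (1 - alpha) * sqn (B i j)].
Proof.
move=> pdX pdY.
have [S [S' [ES hS hS' SS' S'S']]] := mxpowR_inv_sqrt pdX.
have S'S : S' *m S = 1%:M by apply: mulmx1C.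
pose T := S *m Y *m S.
have hT : T ^t* = T by rewrite /T !ctmx_mul hS herm_ct mulmxA.
pose V := spectralmx T; pose t i : R := complex.Re (spectral_diag T 0 i).
have VV : V ^t* *m V = 1%:M := spectral_ctmxK T.
have ET : T = cong V t := spectral_cong hT.
have EB e : cong (V *m S') e = S' *m cong V e *m S'.
  by rewrite /cong ctmx_mul hS' !mulmxA.
exists (V *m S'), t; split.
- by rewrite unitmx_mul spectral_unit; case: (mulmx1_unit S'S).
- by rewrite EB cong1 VV mulmx1.
- by rewrite EB -ET /T !mulmxA S'S mul1mx -mulmxA SS' mulmx1.
move=> alpha; rewrite -trace_cong -[_ *m _ *m _]/(cong (V *m S') _) EB.
rewrite /Qpd -ES -/T mxpowR_cong -/V -[in LHS]S'S'.
by rewrite -mulmxA mxtrace_mulC mulmxA.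
Qed.

End FractionalForms.

(** * Third-order expansions *)

Section Calculus.
Variable R : realType.

Section Directional.
Variable E : normedModType R.
Implicit Types (f g : E -> R) (x h : E).

Lemma is_derive_line f x h (t : R) d :
  is_derive (x + t *: h) h f d <-> is_derive t (1 : R) (fun s => f (x + s *: h)) d.
Proof.
have E1 : (fun s : R => s^-1 *: (((fun s => f (x + s *: h)) \o shift t) (s *: 1) -
     f (x + t *: h))) =
    (fun s : R => s^-1 *: ((f \o shift (x + t *: h)) (s *: h) - f (x + t *: h))).
  apply/funext => s /=; congr (_ *: (f _ - _)).
  by rewrite /shift /= scalerDl -mulr_algl mulr1 addrCA -scalerA scale1r.
by split=> -[c v]; split; move: c v; rewrite /derivable /derive E1.
Qed.

Lemma is_derive_along f x h (t : R) d : is_derive (x + t *: h) h f d ->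
  is_derive t (1 : R) (fun s => f (x + s *: h)) d.
Proof. by case: (is_derive_line f x h t d). Qed.

Lemma is_derive_line0 f x h d :
  is_derive x h f d <-> is_derive (0 : R) (1 : R) (fun s => f (x + s *: h)) d.
Proof. by rewrite -is_derive_line scale0r addr0. Qed.

Lemma is_derive_add f g x h a b : is_derive x h f a -> is_derive x h g b ->
  is_derive x h (fun y => f y + g y) (a + b).
Proof. by move=> ha hb; exact: is_deriveD. Qed.

Lemma is_derive_mul f g x h a b : is_derive x h f a -> is_derive x h g b ->
  is_derive x h (fun y => f y * g y) (a * g x + f x * b).
Proof.
move=> ha hb; apply: is_derive_eq (is_deriveM ha hb) _.
by rewrite addrC -[LHS]/(g x * a + f x * b) [g x * a]mulrC.
Qed.

Lemma is_derive_scale f x h (c : R) a : is_derive x h f a ->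
  is_derive x h (fun y => c * f y) (c * a).
Proof. by move=> ha; exact: (is_deriveZ c ha). Qed.

Lemma is_derive_inv f x h a : f x != 0 -> is_derive x h f a ->
  is_derive x h (fun y => (f y)^-1) (- a * ((f x)^-1 * (f x)^-1)).
Proof.
move=> f0 /is_derive_line0 da; apply/is_derive_line0.
have f0' : f (x + 0 *: h) != 0 by rewrite scale0r addr0.
have := is_deriveV f0' da; rewrite scale0r addr0 => H.
apply: is_derive_eq H _; rewrite -[LHS]/(_ * _) -exprVn expr2.
by rewrite mulNr mulrC mulNr.
Qed.

Lemma is_derive_ln f x h a : 0 < f x -> is_derive x h f a ->
  is_derive x h (fun y => ln (f y)) (a * (f x)^-1).
Proof.
move=> f0 /is_derive_line0 da; apply/is_derive_line0.
have f0' : 0 < f (x + 0 *: h) by rewrite scale0r addr0.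
have := is_derive1_comp (is_derive1_ln f0') da.
by rewrite scale0r addr0 => H; apply: is_derive_eq H _; rewrite mulrC.
Qed.

Lemma is_derive_ext f g x h a : (\forall y \near x, f y = g y) ->
  is_derive x h f a -> is_derive x h g a.
Proof.
have [->|h0] := eqVneq h 0.
  by move=> _ [_ <-]; apply: is_derive_eq (is_derive0 _ _) _; rewrite derive0.
by move=> fg; apply: near_eq_is_derive.
Qed.

End Directional.

Implicit Types (f g : R -> R) (a b : R).

Lemma near_line (E : normedModType R) (U : set E) x h : nbhs x U ->
  \forall t \near (0 : R), U (x + t *: h).
Proof.
have cl : {for (0 : R), continuous (fun t : R => x + t *: h)}.
  apply: (@continuousD _ _ _ (cst x) (fun t : R => t *: h)).
    exact: cst_continuous.
  exact: scalel_continuous.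
by move=> nU; apply: (cl U); rewrite scale0r addr0.
Qed.

Lemma near0_pos (P : R -> Prop) : (\forall t \near (0 : R), P t) ->
  exists2 t, 0 < t & P t /\ P (- t).
Proof.
move=> [d /= d0 hd]; have d2 : 0 < d / 2 by rewrite divr_gt0.
have d2d : d / 2 < d by rewrite ltr_pdivrMr// ltr_pMr// ltr1n.
exists (d / 2) => //; split; apply: hd; rewrite /= sub0r ?opprK ?normrN gtr0_norm//.
Qed.

(** Covers both signs of t, since directional difference quotients need both. *)
Lemma mean_value0 f g t : (forall s, `|s| <= `|t| -> is_derive s (1 : R) f (g s)) ->
  exists2 c, `|c| <= `|t| & f t - f 0 = g c * t.
Proof.
move=> df.
have cf (u v : R) : (forall s, u <= s <= v -> `|s| <= `|t|) ->
    {within `[u, v], continuous f}.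
  move=> uv; apply: derivable_within_continuous => s; rewrite in_itv/= => /uv.
  by move=> /df[].
have [t0|t0] := leP 0 t.
  have nt s : 0 <= s <= t -> `|s| <= `|t|.
    by move=> /andP[s0 st]; rewrite !ger0_norm.
  have [||c] := @MVT_segment R f g 0 t t0.
  - by move=> s; rewrite in_itv/= => /andP[/ltW s0 /ltW st]; apply/df/nt/andP.
  - exact: cf nt.
  - by rewrite in_itv/= subr0 => /nt ct ->; exists c.
have nt s : t <= s <= 0 -> `|s| <= `|t|.
  by move=> /andP[s0 st]; rewrite !ler0_norm ?lerN2// ltW.
have [||c] := @MVT_segment R f g t 0 (ltW t0).
- by move=> s; rewrite in_itv/= => /andP[/ltW s0 /ltW st]; apply/df/nt/andP.
- exact: cf nt.
- rewrite in_itv/= sub0r => /nt ct E; exists c => //.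
  by rewrite -[LHS]opprB E mulrN opprK.
Qed.

(** Third-order data at 0 stated by derivatives near 0, so that jets add, scale and
compose by the differentiation rules alone. *)
Definition jet f a1 a2 a3 := exists f1 f2 : R -> R,
  [/\ \forall t \near (0 : R), is_derive t (1 : R) f (f1 t),
      \forall t \near (0 : R), is_derive t (1 : R) f1 (f2 t),
      is_derive (0 : R) (1 : R) f2 a3, f1 0 = a1 & f2 0 = a2].

Lemma near_is_derive_derive1 f g : (\forall t \near (0 : R), is_derive t (1 : R) f (g t)) ->
  \forall t \near (0 : R), derive1 f t = g t.
Proof. by apply: filterS => t [_ <-]; rewrite derive1E. Qed.

Lemma near_near0 (P : R -> Prop) : (\forall t \near (0 : R), P t) ->
  \forall t \near (0 : R), \forall s \near t, P s.
Proof. by move=> h; exact: (near_join h). Qed.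

Lemma jet_derive1n f a1 a2 a3 : jet f a1 a2 a3 ->
  [/\ derive1n 1 f 0 = a1, derive1n 2 f 0 = a2 & derive1n 3 f 0 = a3].
Proof.
move=> [f1 [f2 [d1 d2 d3 e1 e2]]].
have E1 := near_is_derive_derive1 d1.
have d2' : \forall t \near (0 : R), is_derive t (1 : R) (derive1 f) (f2 t).
  near=> t; apply: (@is_derive_ext _ f1).
    by near: t; apply: filterS (near_near0 E1) => t; apply: filterS.
  by near: t.
have E2 := near_is_derive_derive1 d2'.
have [_ d3'] : is_derive (0 : R) (1 : R) (derive1 (derive1 f)) a3.
  by apply: (@is_derive_ext _ f2) d3; apply: filterS E2.
split; first by rewrite -e1; exact: nbhs_singleton E1.
  by rewrite -e2; exact: nbhs_singleton E2.
by rewrite -d3' -derive1E.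
Unshelve. all: by end_near. Qed.

Lemma jet_unique f a1 a2 a3 b1 b2 b3 : jet f a1 a2 a3 -> jet f b1 b2 b3 ->
  [/\ a1 = b1, a2 = b2 & a3 = b3].
Proof.
by move=> /jet_derive1n[<- <- <-] /jet_derive1n[<- <- <-].
Qed.

Lemma jet_eq f a1 a2 a3 b1 b2 b3 : jet f a1 a2 a3 ->
  a1 = b1 -> a2 = b2 -> a3 = b3 -> jet f b1 b2 b3.
Proof. by move=> h <- <- <-. Qed.

Lemma jet_ext f g a1 a2 a3 : (\forall t \near (0 : R), f t = g t) ->
  jet f a1 a2 a3 -> jet g a1 a2 a3.
Proof.
move=> fg [f1 [f2 [d1 d2 d3 e1 e2]]]; exists f1, f2; split => //.
near=> t; apply: (@is_derive_ext _ f); by near: t => //; exact: near_near0.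
Unshelve. all: by end_near. Qed.

Lemma jet_add f g a1 a2 a3 b1 b2 b3 : jet f a1 a2 a3 -> jet g b1 b2 b3 ->
  jet (fun t => f t + g t) (a1 + b1) (a2 + b2) (a3 + b3).
Proof.
move=> [f1 [f2 [df1 df2 df3 <- <-]]] [g1 [g2 [dg1 dg2 dg3 <- <-]]].
exists (fun t => f1 t + g1 t), (fun t => f2 t + g2 t); split => //.
- by near=> t; apply: is_derive_add; near: t.
- by near=> t; apply: is_derive_add; near: t.
- exact: is_derive_add.
Unshelve. all: by end_near. Qed.

Lemma jet_scale f c a1 a2 a3 : jet f a1 a2 a3 ->
  jet (fun t => c * f t) (c * a1) (c * a2) (c * a3).
Proof.
move=> [f1 [f2 [df1 df2 df3 <- <-]]].
exists (fun t => c * f1 t), (fun t => c * f2 t); split => //.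
- by near=> t; apply: is_derive_scale; near: t.
- by near=> t; apply: is_derive_scale; near: t.
- exact: is_derive_scale.
Unshelve. all: by end_near. Qed.

Lemma is_derive_affine a b t : is_derive t (1 : R) (fun t => a + b * t) b.
Proof.
apply: is_derive_eq (is_derive_add (is_derive_cst a t (1 : R))
  (is_derive_scale b (is_derive_id t (1 : R)))) _.
by rewrite add0r mulr1.
Qed.

Lemma is_derive_linear (E : normedModType R) (f : E -> R) (x h : E) :
  (forall y z, f (y + z) = f y + f z) ->
  (forall (a : R) y, f (a *: y) = a * f y) -> is_derive x h f (f h).
Proof.
move=> fD fZ; apply/is_derive_line0.
have -> : (fun s : R => f (x + s *: h)) = (fun s => f x + f h * s).
  by apply/funext => s; rewrite fD fZ mulrC.
exact: is_derive_affine.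
Qed.

Lemma jet_affine a b : jet (fun t => a + b * t) b 0 0.
Proof.
exists (cst b), (cst 0); split => //; last exact: is_derive_cst.
  by near=> t; exact: is_derive_affine.
by near=> t; exact: is_derive_cst.
Unshelve. all: by end_near. Qed.

Lemma jet_sum (I : eqType) (s : seq I) (F : I -> R -> R) (a1 a2 a3 : I -> R) :
  (forall i, jet (F i) (a1 i) (a2 i) (a3 i)) ->
  jet (fun t => \sum_(i <- s) F i t) (\sum_(i <- s) a1 i) (\sum_(i <- s) a2 i)
      (\sum_(i <- s) a3 i).
Proof.
move=> h; elim: s => [|i s IH].
  rewrite !big_nil; apply: jet_ext (jet_affine 0 0).
  by near=> t; rewrite big_nil mul0r addr0.
rewrite !big_cons; apply: jet_ext (jet_add (h i) IH).
by near=> t; rewrite big_cons.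
Unshelve. all: by end_near. Qed.

Lemma jet_ln f a1 a2 a3 : 0 < f 0 -> jet f a1 a2 a3 ->
  jet (fun t => ln (f t)) (a1 / f 0) (a2 / f 0 - (a1 / f 0) ^+ 2)
    (a3 / f 0 - 3 * (a1 / f 0) * (a2 / f 0) + 2 * (a1 / f 0) ^+ 3).
Proof.
move=> f0 [f1 [f2 [d1 d2 d3 <- <-]]].
have fpos : \forall t \near (0 : R), 0 < f t.
  have [/derivable1_diffP/differentiable_continuous cf _] := nbhs_singleton d1.
  exact: (cvgr_gt _ cf).
pose g1 t := f1 t * (f t)^-1.
pose g2 t := f2 t * (f t)^-1 + f1 t * (- f1 t * ((f t)^-1 * (f t)^-1)).
exists g1, g2; split.
- near=> t; apply: is_derive_ln; first by near: t.
  by near: t.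
- near=> t; apply: is_derive_mul; first by near: t.
  apply: is_derive_inv; first by rewrite gt_eqF//; near: t.
  by near: t.
- have d1' := nbhs_singleton d1; have d2' := nbhs_singleton d2.
  have di : is_derive (0 : R) (1 : R) (fun t => (f t)^-1)
      (- f1 0 * ((f 0)^-1 * (f 0)^-1)) by apply: is_derive_inv; rewrite ?gt_eqF.
  have dN : is_derive (0 : R) (1 : R) (fun t => - f1 t) (- f2 0).
    exact: (is_deriveN d2').
  apply: is_derive_eq (is_derive_add (is_derive_mul d3 di)
    (is_derive_mul d2' (is_derive_mul dN (is_derive_mul di di)))) _.
  rewrite /=; field; by rewrite gt_eqF.
- by [].
- rewrite /g2 /=; field; by rewrite gt_eqF.
Unshelve. all: by end_near. Qed.

(** The function equals an affine function plus ((b - l a)/l)^2 / (1 + l t) when l is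
nonzero: its third derivative is -3 l times the second, whatever a and b are.
This proportionality is the source of the compatibility of the entropies. *)
Lemma jet_square_over_affine a b l :
  jet (fun t => (a + b * t) ^+ 2 / (1 + l * t)) (2 * a * b - l * a ^+ 2)
    (2 * (b - l * a) ^+ 2) (- 6 * l * (b - l * a) ^+ 2).
Proof.
have daff := is_derive_affine.
pose i t := (1 + l * t)^-1.
have nz : \forall t \near (0 : R), 1 + l * t != 0.
  have [/derivable1_diffP/differentiable_continuous cf _] := daff 1 l 0.
  apply: (cvgr_neq0 _ cf).
  by rewrite mulr0 addr0 oner_neq0.
have di t : 1 + l * t != 0 -> is_derive t (1 : R) i (- l * (i t * i t)).
  by move=> h; apply: is_derive_inv => //; exact: daff.
pose f1 t := 2 * b * ((a + b * t) * i t) - l * ((a + b * t) * i t) ^+ 2.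
pose f2 t := 2 * (b - l * a) ^+ 2 * (i t * (i t * i t)).
exists f1, f2; split.
- near=> t.
  have h : 1 + l * t != 0 by near: t.
  have -> : (fun t => (a + b * t) ^+ 2 / (1 + l * t)) =
     (fun t => ((a + b * t) * (a + b * t)) * i t) by apply/funext => s; rewrite expr2.
  apply: is_derive_eq (is_derive_mul (is_derive_mul (daff a b t) (daff a b t))
    (di t h)) _.
  by rewrite /f1 /i; field.
- near=> t.
  have h : 1 + l * t != 0 by near: t.
  have -> : f1 = (fun t => 2 * b * ((a + b * t) * i t) +
      (- l) * (((a + b * t) * i t) * ((a + b * t) * i t))).
    by apply/funext => s; rewrite /f1 expr2 mulNr.
  have dw : is_derive t (1 : R) (fun t => (a + b * t) * i t)
      (b * i t + (a + b * t) * (- l * (i t * i t))).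
    exact: is_derive_mul (daff a b t) (di t h).
  apply: is_derive_eq (is_derive_add (is_derive_scale _ dw)
    (is_derive_scale _ (is_derive_mul dw dw))) _.
  by rewrite /f2 /i; field.
- have h : 1 + l * 0 != 0 :> R by rewrite mulr0 addr0 oner_neq0.
  have d0 := di _ h.
  apply: is_derive_eq (is_derive_scale _ (is_derive_mul d0
    (is_derive_mul d0 d0))) _.
  by rewrite /i !mulr0 !addr0 !invr1; ring.
- by rewrite /f1 /i !mulr0 !addr0 invr1; ring.
- by rewrite /f2 /i !mulr0 !addr0 invr1; ring.
Unshelve. all: by end_near. Qed.

Lemma powR_three_halves (x : R) : 0 <= x -> x `^ (3 / 2) = Num.sqrt x ^+ 3.
Proof.
move=> x0; rewrite -[in LHS](sqr_sqrtr x0) -powR_mulrn ?sqrtr_ge0// -powRrM.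
rewrite -powR_mulrn ?sqrtr_ge0//; congr powR.
by rewrite mulrC divfK// pnatr_eq0.
Qed.

End Calculus.

(** * Smooth families and their averages *)

Section PositiveFunctionalTheory.
Variables (R : realType) (J : (R -> R) -> R).
Hypothesis posJ : positive_functional J.
Implicit Types (f g : R -> R).

Lemma Jadd f g : continuous f -> continuous g ->
  J (fun x => f x + g x) = J f + J g.
Proof. by case: posJ => h _ _; exact: h. Qed.

Lemma Jscale a f : continuous f -> J (fun x => a * f x) = a * J f.
Proof. by case: posJ => _ h _; exact: h. Qed.

Lemma Jge0 f : continuous f -> (forall x, 0 <= x <= 1 -> 0 <= f x) -> 0 <= J f.
Proof. by case: posJ => _ _ h; exact: h. Qed.

Lemma continuous_scale a f : continuous f -> continuous (fun x => a * f x).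
Proof.
by move=> cf x; apply: (@continuousM _ _ (cst a) f x); [exact: cst_continuous|exact: cf].
Qed.

Lemma continuous_add (T : topologicalType) (f g : T -> R) :
  continuous f -> continuous g -> continuous (fun x => f x + g x).
Proof. by move=> cf cg x; apply: (@continuousD _ _ _ f g x); [exact: cf|exact: cg]. Qed.

Lemma Jsub f g : continuous f -> continuous g ->
  J (fun x => f x - g x) = J f - J g.
Proof.
move=> cf cg; have -> : (fun x => f x - g x) = (fun x => f x + -1 * g x).
  by apply/funext => x; rewrite mulN1r.
by rewrite Jadd ?Jscale ?mulN1r//; exact: continuous_scale.
Qed.

Lemma continuous_sub f g : continuous f -> continuous g ->
  continuous (fun x => f x - g x).
Proof.
by move=> cf cg x; apply: (@continuousB _ _ _ f g x); [exact: cf|exact: cg].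
Qed.

Lemma Jle f g : continuous f -> continuous g ->
  (forall x, 0 <= x <= 1 -> f x <= g x) -> J f <= J g.
Proof.
move=> cf cg fg; rewrite -subr_ge0 -Jsub//.
by apply: Jge0 => [|x /fg]; [exact: continuous_sub|rewrite subr_ge0].
Qed.

Lemma Jnorm_le f g : continuous f -> continuous g ->
  (forall x, 0 <= x <= 1 -> `|f x| <= g x) -> `|J f| <= J g.
Proof.
move=> cf cg fg; rewrite ler_norml -mulN1r -Jscale//; apply/andP; split.
  apply: Jle => //; first exact: continuous_scale.
  by move=> x /fg; rewrite mulN1r ler_norml => /andP[].
by apply: Jle => // x /fg; rewrite ler_norml => /andP[].
Qed.

Lemma continuous_cstR (c : R) : continuous (fun _ : R => c).
Proof. by move=> x; exact: cst_continuous. Qed.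

Lemma Jcst c : J (fun=> c) = c * J (fun=> 1).
Proof.
rewrite -Jscale; last exact: continuous_cstR.
by congr J; apply/funext => x; rewrite mulr1.
Qed.

Lemma J1_ge0 : 0 <= J (fun=> 1).
Proof. by apply: Jge0 => //; exact: continuous_cstR. Qed.

Lemma continuous_sumR (T : topologicalType) (I : eqType) (s : seq I)
    (F : I -> T -> R) :
  (forall i, continuous (F i)) -> continuous (fun x => \sum_(i <- s) F i x).
Proof.
move=> cF; elim: s => [|i s IH].
  by under eq_fun do rewrite big_nil; move=> x; exact: cst_continuous.
by under eq_fun do rewrite big_cons; exact: continuous_add.
Qed.

Lemma Jsum (I : eqType) (s : seq I) (F : I -> R -> R) :
  (forall i, continuous (F i)) ->
  J (fun x => \sum_(i <- s) F i x) = \sum_(i <- s) J (F i).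
Proof.
move=> cF; elim: s => [|i s IH].
  rewrite big_nil; under eq_fun do rewrite big_nil.
  by rewrite Jcst mul0r.
rewrite big_cons -IH; under eq_fun do rewrite big_cons.
by rewrite Jadd//; exact: continuous_sumR.
Qed.

End PositiveFunctionalTheory.

Lemma near_eq_continuous (R : realType) (T : topologicalType) (f g : T -> R) x :
  (\forall y \near x, f y = g y) -> {for x, continuous f} -> {for x, continuous g}.
Proof.
move=> fg cf; have e := nbhs_singleton fg.
have cf' : f @ x --> f x := cf.
suff : g @ x --> g x by [].
by rewrite -e; apply: cvg_trans cf'; exact: near_eq_cvg.
Qed.

Section SmoothFamilies.
Variables (R : realType) (E : normedModType R) (U : set E).
Hypothesis oU : open U.
Implicit Types (g : R -> E -> R) (x h : E).

(** Joint continuity in the parameter and the point is what makes convergence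
uniform over the parameters in [0, 1]. *)
Definition joint_cont g := forall (s : R) x, U x ->
  {for (s, x), continuous (fun p : R * E => g p.1 p.2)}.

(** Families of class C^k in x, uniformly in the parameter s: all iterated
directional derivatives are jointly continuous in (s, x). *)
Fixpoint smooth_family (k : nat) g : Prop := joint_cont g /\
  if k is k'.+1 then
    forall h, exists2 g', forall s x, U x -> is_derive x h (g s) (g' s x) &
                          smooth_family k' g'
  else True.

Lemma fam_joint_cont k g : smooth_family k g -> joint_cont g.
Proof. by case: k => [|k] []. Qed.

Lemma famW k g : smooth_family k.+1 g -> smooth_family k g.
Proof.
elim: k g => [|k IH] g [cg dg]; split => // h.
by have [g' dg' /IH fg'] := dg h; exists g'.
Qed.

Lemma joint_cont_snd g (s : R) x : joint_cont g -> U x -> {for x, continuous (g s)}.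
Proof.
move=> cg Ux; apply: (@continuous_comp _ _ _ (fun y => (s, y))
  (fun p : R * E => g p.1 p.2)); last exact: cg.
move=> A [[B1 B2] [/= nB1 nB2] BA]; apply: filterS nB2 => y B2y.
by apply: BA; split=> //=; exact: nbhs_singleton nB1.
Qed.

Lemma joint_cont_fst g x : joint_cont g -> U x -> continuous (g^~ x).
Proof.
move=> cg Ux s; apply: (@continuous_comp _ _ _ (fun s => (s, x))
  (fun p : R * E => g p.1 p.2)); last exact: cg.
move=> A [[B1 B2] [/= nB1 nB2] BA]; apply: filterS nB1 => t B1t.
by apply: BA; split=> //=; exact: nbhs_singleton nB2.
Qed.

Lemma fam_ext k g g' : (forall s x, U x -> g s x = g' s x) -> smooth_family k g -> smooth_family k g'.
Proof.
move=> gg'; have ext1 : joint_cont g -> joint_cont g'.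
  move=> cg s x Ux; have Us : \forall p \near (s, x), g p.1 p.2 = g' p.1 p.2.
    have : \forall y \near x, U y by exact: open_nbhs_nbhs.
    move=> nU; near=> p; apply: gg'; near: p.
    exact: (@cvg_snd _ _ (nbhs s) (nbhs x) _ _ nU).
  exact: near_eq_continuous Us (cg s x Ux).
case: k => [|k] [cg dg]; split; [exact: ext1|by []|exact: ext1|].
move=> h; have [d hd fd] := dg h; exists d => // s x Ux.
apply: is_derive_ext (hd s x Ux).
have : \forall y \near x, U y by exact: open_nbhs_nbhs.
by apply: filterS => y /gg'.
Unshelve. all: by end_near. Qed.

Lemma fam_cst k (c : R -> R) : continuous c -> smooth_family k (fun s _ => c s).
Proof.
elim: k c => [|k IH] c cc.
  split => // s x Ux; apply: (@continuous_comp _ _ _ fst c); last exact: cc.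
  exact: cvg_fst.
split; first exact: (fam_joint_cont (IH c cc)).
move=> h; exists (fun=> fun=> 0) => [s x Ux|]; first exact: is_derive_cst.
by apply: (IH (fun=> 0)); exact: continuous_cstR.
Qed.

Lemma fam_linear k (l : E -> R) : (forall y z, l (y + z) = l y + l z) ->
  (forall (a : R) y, l (a *: y) = a * l y) -> continuous l -> smooth_family k (fun=> l).
Proof.
move=> lD lZ cl.
have cc : joint_cont (fun=> l).
  move=> s x Ux; apply: (@continuous_comp _ _ _ snd l); last exact: cl.
  exact: cvg_snd.
case: k => [|k]; split=> // h; exists (fun=> fun=> l h) => [s x _|].
  exact: is_derive_linear.
exact: (fam_cst k (@continuous_cstR R (l h))).
Qed.

Lemma fam_add k g1 g2 : smooth_family k g1 -> smooth_family k g2 -> smooth_family k (fun s x => g1 s x + g2 s x).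
Proof.
elim: k g1 g2 => [|k IH] g1 g2 [c1 d1] [c2 d2].
  split=> // s x Ux; apply: (@continuousD _ _ _ (fun p => g1 p.1 p.2)
    (fun p => g2 p.1 p.2)); [exact: c1|exact: c2].
split.
  move=> s x Ux; apply: (@continuousD _ _ _ (fun p => g1 p.1 p.2)
    (fun p => g2 p.1 p.2)); [exact: c1|exact: c2].
move=> h; have [e1 he1 f1] := d1 h; have [e2 he2 f2] := d2 h.
exists (fun s x => e1 s x + e2 s x); last exact: IH.
by move=> s x Ux; apply: is_derive_add; [exact: he1|exact: he2].
Qed.

Lemma fam_mul k g1 g2 : smooth_family k g1 -> smooth_family k g2 -> smooth_family k (fun s x => g1 s x * g2 s x).
Proof.
have cM f1 f2 : joint_cont f1 -> joint_cont f2 ->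
    joint_cont (fun s x => f1 s x * f2 s x).
  move=> c1 c2 s x Ux; apply: (@continuousM _ _ (fun p => f1 p.1 p.2)
    (fun p => f2 p.1 p.2)); [exact: c1|exact: c2].
elim: k g1 g2 => [|k IH] g1 g2 fg1 fg2.
  by split=> //; apply: cM; [case: fg1|case: fg2].
split; first by apply: cM; [case: fg1|case: fg2].
move=> h; have [e1 he1 f1] := fg1.2 h; have [e2 he2 f2] := fg2.2 h.
exists (fun s x => e1 s x * g2 s x + g1 s x * e2 s x).
  by move=> s x Ux; apply: is_derive_mul; [exact: he1|exact: he2].
by apply: fam_add; apply: IH => //; exact: famW.
Qed.

Lemma fam_scale k a g : smooth_family k g -> smooth_family k (fun s x => a * g s x).
Proof.
move=> fg; apply: (@fam_mul k (fun _ _ => a) g) => //.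
exact: (fam_cst k (@continuous_cstR R a)).
Qed.

Lemma fam_opp k g : smooth_family k g -> smooth_family k (fun s x => - g s x).
Proof.
by move=> /(fam_scale (-1)); apply: fam_ext => s x _; rewrite mulN1r.
Qed.

Lemma fam_sub k g1 g2 : smooth_family k g1 -> smooth_family k g2 -> smooth_family k (fun s x => g1 s x - g2 s x).
Proof. by move=> f1 f2; apply: fam_add => //; exact: fam_opp. Qed.

Lemma fam_sum k (I : eqType) (r : seq I) (P : pred I) (F : I -> R -> E -> R) :
  (forall i, smooth_family k (F i)) -> smooth_family k (fun s x => \sum_(i <- r | P i) F i s x).
Proof.
move=> fF; elim: r => [|i r IH].
  apply: (fam_ext _ (fam_cst k (@continuous_cstR R 0))) => s x _.
  by rewrite big_nil.
case: (boolP (P i)) => Pi.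
  apply: (fam_ext _ (fam_add (fF i) IH)) => s x _.
  by rewrite big_cons Pi.
by apply: (fam_ext _ IH) => s x _; rewrite big_cons (negbTE Pi).
Qed.

Lemma fam_inv k g : (forall s x, U x -> g s x != 0) -> smooth_family k g ->
  smooth_family k (fun s x => (g s x)^-1).
Proof.
move=> g0; have cV : joint_cont g -> joint_cont (fun s x => (g s x)^-1).
  move=> cg s x Ux; apply: (@continuousV _ _ (fun p => g p.1 p.2)).
    exact: g0.
  exact: cg.
elim: k => [|k IH] fg; first by split=> //; apply: cV; case: fg.
split; first by apply: cV; case: fg.
move=> h; have [e he fe] := fg.2 h.
exists (fun s x => - e s x * ((g s x)^-1 * (g s x)^-1)).
  by move=> s x Ux; apply: is_derive_inv; [exact: g0|exact: he].
apply: fam_mul; first exact: fam_opp.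
by apply: fam_mul; apply: IH; exact: famW.
Qed.

Lemma fam_ln k g : (forall s x, U x -> 0 < g s x) -> smooth_family k g ->
  smooth_family k (fun s x => ln (g s x)).
Proof.
move=> g0; have cL : joint_cont g -> joint_cont (fun s x => ln (g s x)).
  move=> cg s x Ux; apply: (@continuous_comp _ _ _ (fun p => g p.1 p.2) (@ln R)).
    exact: cg.
  exact/continuous_ln/g0.
case: k => [|k] fg; first by split=> //; apply: cL; case: fg.
split; first by apply: cL; case: fg.
move=> h; have [e he fe] := fg.2 h.
exists (fun s x => e s x * (g s x)^-1).
  by move=> s x Ux; apply: is_derive_ln; [exact: g0|exact: he].
apply: fam_mul => //; apply: fam_inv; last exact: famW.
by move=> s x Ux; rewrite gt_eqF// g0.
Qed.

(** Each member of a family is of class C^k; members of constant families are how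
smoothness of individual functions is obtained. *)
Lemma fam_Ck k g f (s : R) : smooth_family k g -> (forall x, U x -> f x = g s x) -> Ck k U f.
Proof.
have nU x : U x -> \forall y \near x, U y by move=> Ux; exact: open_nbhs_nbhs.
elim: k g f => [|k IH] g f fg E1 /=.
  split=> // x Ux; apply: near_eq_continuous (@joint_cont_snd g s x fg.1 Ux).
  by apply: filterS (nU x Ux) => y /E1.
split.
  move=> x Ux; apply: near_eq_continuous (@joint_cont_snd g s x fg.1 Ux).
  by apply: filterS (nU x Ux) => y /E1.
move=> h; have [g' dg' fg'] := fg.2 h.
have df x : U x -> is_derive x h f (g' s x).
  move=> Ux; apply: is_derive_ext (dg' s x Ux).
  by apply: filterS (nU x Ux) => y /E1.
split=> [x /df[]//|]; apply: (IH g') => // x /df[_ ->].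
by [].
Qed.

(** Tube lemma over the compact interval [0, 1]. *)
Lemma tube g x e : joint_cont g -> U x -> 0 < e ->
  \forall y \near x, forall s, 0 <= s <= 1 -> `|g s y - g s x| <= e.
Proof.
move=> cg Ux e0.
have /compact_near_coveringP cov := @segment_compact R 0 1.
have := cov E (nbhs x) (fun y s => `|g s y - g s x| <= e) _.
have H : forall s : R, `[0, 1]%classic s -> \forall s' \near s & y \near x,
    `|g s' y - g s' x| <= e.
  move=> s _; have /cvgrPdist_lt /(_ (e / 2)) := cg s x Ux.
  rewrite divr_gt0// => /(_ isT) H.
  have H' : \forall s' \near s, `|g s x - g s' x| < e / 2.
    by have /cvgrPdist_lt /(_ (e / 2)) := @joint_cont_fst g x cg Ux s;
      rewrite divr_gt0// => /(_ isT).
  case: H => -[A B] [/= nA nB] AB.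
  exists (A `&` [set s' | `|g s x - g s' x| < e / 2], B).
    by split => //=; apply: filterI.
  move=> [s' y] /= [[As' Hs'] By].
  rewrite -(subrKA (g s x)) (splitr e).
  apply: (le_trans (ler_normD _ _)); apply: lerD; apply/ltW => //.
  by rewrite distrC; exact: (AB (s', y)).
move=> /(_ _ H); apply: filterS => y hy s hs.
by apply: hy; rewrite /= in_itv.
Qed.

Variable J : (R -> R) -> R.
Hypothesis posJ : positive_functional J.

Lemma joint_cont_J g : joint_cont g -> joint_cont (fun _ x => J (g^~ x)).
Proof.
move=> cg s x Ux; apply: (@continuous_comp _ _ _ snd (fun x => J (g^~ x))).
  exact: cvg_snd.
rewrite /continuous_at /=; apply/cvgrPdist_le => e e0.
pose c := J (fun=> 1) + 1.
have c0 : 0 < c by rewrite ltr_wpDl ?J1_ge0.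
have ec : 0 < e / c by rewrite divr_gt0.
have nU : \forall y \near x, U y by exact: open_nbhs_nbhs.
near=> y; have Uy : U y by near: y.
rewrite -Jsub//; [|exact: joint_cont_fst|exact: joint_cont_fst].
apply: (@le_trans _ _ (J (fun=> e / c))).
  apply: Jnorm_le => //.
  - by apply: continuous_sub; exact: joint_cont_fst.
  - exact: continuous_cstR.
  - by move=> t; rewrite distrC; move: t; near: y; exact: tube.
rewrite Jcst// mulrAC ler_pdivrMr// ler_pM2l//.
by rewrite lerDl.
Unshelve. all: by end_near. Qed.

(** Differentiation under the integral: by the mean value theorem the difference
quotient is a derivative at a nearby point, uniformly close by the tube lemma. *)
Lemma is_derive_J g g' x h : joint_cont g -> joint_cont g' -> U x ->
  (forall s x, U x -> is_derive x h (g s) (g' s x)) ->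
  is_derive x h (fun x => J (g^~ x)) (J (g'^~ x)).
Proof.
move=> cg cg' Ux dg.
suff H : (fun t : R => t^-1 *: (((fun x => J (g^~ x)) \o shift x) (t *: h) -
    J (g^~ x))) @ 0^' --> J (g'^~ x).
  by split; [apply/cvg_ex; exists (J (g'^~ x))|apply: cvg_lim].
apply/cvgrPdist_le => e e0.
pose c := J (fun=> 1) + 1.
have c0 : 0 < c by rewrite ltr_wpDl ?J1_ge0.
have ec : 0 < e / c by rewrite divr_gt0.
have nU : \forall y \near x, U y by exact: open_nbhs_nbhs.
have nT := tube cg' Ux ec.
have [d /= d0 hd] : \forall t \near (0 : R), U (x + t *: h) /\
    forall s, 0 <= s <= 1 -> `|g' s (x + t *: h) - g' s x| <= e / c.
  exact: (near_line h (filterI nU nT)).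
have Ht t : `|t| < d -> U (x + t *: h) /\
    forall s, 0 <= s <= 1 -> `|g' s (x + t *: h) - g' s x| <= e / c.
  by move=> td; apply: hd; rewrite /= sub0r normrN.
near=> t.
have t0 : t != 0 by near: t; exact: nbhs_dnbhs_neq.
have td : `|t| < d.
  near: t; apply: dnbhs0_lt; exact: d0.
have [Uxt _] := Ht t td.
have cgx y : U y -> continuous (g^~ y) by move=> Uy; exact: joint_cont_fst.
have cg'x : continuous (g'^~ x) by exact: joint_cont_fst.
rewrite /= /shift /= [t *: h + x]addrC -[t^-1 *: _]/(t^-1 * _).
have cgt := cgx _ Uxt; have cg0 := cgx _ Ux.
rewrite -Jsub// -Jscale//; last exact: continuous_sub.
rewrite -Jsub//; last by apply: continuous_scale; exact: continuous_sub.
apply: (@le_trans _ _ (J (fun=> e / c))); last first.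
  by rewrite Jcst// mulrAC ler_pdivrMr// ler_pM2l// lerDl.
apply: Jnorm_le => //; last 2 first.
- exact: continuous_cstR.
- move=> s s01.
  have [|r rt] := @mean_value0 R (fun t => g s (x + t *: h))
      (fun t => g' s (x + t *: h)) t.
    move=> r rt; apply: is_derive_along; apply: dg.
    by have [] := Ht r (le_lt_trans rt td).
  rewrite scale0r addr0 => ->; rewrite mulrCA mulVf// mulr1 distrC.
  by have [_ ->] := Ht r (le_lt_trans rt td).
- by apply: continuous_sub => //; apply: continuous_scale; exact: continuous_sub.
Unshelve. all: by end_near. Qed.

Lemma fam_J k g : smooth_family k g -> smooth_family k (fun _ x => J (g^~ x)).
Proof.
elim: k g => [|k IH] g [cg dg]; split=> //; try exact: joint_cont_J.
move=> h; have [g' dg' fg'] := dg h.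
exists (fun _ x => J (g'^~ x)); last exact: IH.
move=> _ x Ux; apply: is_derive_J => //; exact: fam_joint_cont fg'.
Qed.

(** The Taylor data of an average are the averages of the Taylor data, so that
pointwise inequalities between them can be integrated. *)
Lemma fam_jet g x h : smooth_family 3 g -> U x -> exists a1 a2 a3 : R -> R,
  [/\ continuous a1, continuous a2 & continuous a3] /\
  (forall s, jet (fun t => g s (x + t *: h)) (a1 s) (a2 s) (a3 s)) /\
  jet (fun t => J (g^~ (x + t *: h))) (J a1) (J a2) (J a3).
Proof.
move=> [cg /(_ h)[g1 dg1 [cg1 /(_ h)[g2 dg2 [cg2 /(_ h)[g3 dg3 [cg3 _]]]]]]] Ux.
have nU : \forall t \near (0 : R), U (x + t *: h).
  by apply: near_line; exact: open_nbhs_nbhs.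
exists (g1^~ x), (g2^~ x), (g3^~ x); split.
  by split; exact: joint_cont_fst.
split=> [s|].
  exists (fun t => g1 s (x + t *: h)), (fun t => g2 s (x + t *: h)).
  split; rewrite ?scale0r ?addr0//.
  - by apply: filterS nU => t Ut; apply: is_derive_along; exact: dg1.
  - by apply: filterS nU => t Ut; apply: is_derive_along; exact: dg2.
  - by apply: (is_derive_line0 (g2 s) x h _).1; exact: dg3.
exists (fun t => J (g1^~ (x + t *: h))), (fun t => J (g2^~ (x + t *: h))).
split; rewrite ?scale0r ?addr0//.
- by apply: filterS nU => t Ut; apply: (@is_derive_along _ _ (fun x => J (g^~ x))); exact: is_derive_J.
- by apply: filterS nU => t Ut; apply: (@is_derive_along _ _ (fun x => J (g1^~ x))); exact: is_derive_J.
- by apply: (is_derive_line0 (fun x => J (g2^~ x)) x h _).1; exact: is_derive_J.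
Qed.

End SmoothFamilies.

(** * Topology of the Hermitian matrices *)

Section HermitianTopology.
Local Open Scope complex_scope.
Local Open Scope sesquilinear_scope.
Variables (R : realType) (n : nat).
Local Notation C := R[i].
Local Notation H := (herm R n).
Implicit Types (X Y Z K : H).

Lemma sqn_normc (z : C) : sqn z = Normc.normc z ^+ 2.
Proof. by case: z => a b; rewrite /= sqr_sqrtr// addr_ge0 ?sqr_ge0. Qed.

Lemma normc_le_norm X i j : Normc.normc (X i j) <= `|X|.
Proof.
rewrite -[`|X|]/(herm_norm X) /herm_norm (bigD1 i)//= (bigD1 j)//= -addrA.
rewrite lerDl addr_ge0 ?sumr_ge0// => *; first exact: normc_ge0.
by apply: sumr_ge0 => *; exact: normc_ge0.
Qed.

Lemma sum_sqn_le_norm X : \sum_i \sum_j sqn (X i j) <= `|X| ^+ 2.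
Proof.
rewrite expr2 -[X in _ <= _ * X]/(herm_norm X) /herm_norm mulr_sumr.
apply: ler_sum => i _; rewrite mulr_sumr; apply: ler_sum => j _.
by rewrite sqn_normc expr2 ler_wpM2r ?normc_ge0// normc_le_norm.
Qed.

Lemma qf_norm_le X (v : 'cV[C]_n) : `|qf X v| <= `|X| * \sum_i sqn (v i 0).
Proof.
have S0 : 0 <= \sum_i sqn (v i 0) by apply: sumr_ge0 => i _; exact: sqn_ge0.
rewrite -(ler_pXn2r (n := 2))// ?nnegrE ?mulr_ge0// real_normK ?num_real//.
have : qf X v ^+ 2 <= sqn ((v ^t* *m (X *m v)) 0 0).
  by rewrite /qf mulmxA lerDl sqr_ge0.
move=> /le_trans; apply; apply: (le_trans (cauchy_schwarz _ _)).
set S := \sum_i sqn (v i 0).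
have -> : (`|X| * S) ^+ 2 = S * (`|X| ^+ 2 * S) by ring.
rewrite ler_wpM2l//; apply: (le_trans (sqn_mulmx_le _ _)).
by rewrite ler_wpM2r// sum_sqn_le_norm.
Qed.

(** The smallest eigenvalue is bounded below through the norm of B^-1, X = B* B. *)
Lemma pd_coercive X : pd X -> exists2 m, 0 < m &
  forall v : 'cV[C]_n, m * \sum_i sqn (v i 0) <= qf X v.
Proof.
move=> /pd_unit_cong[B uB EX].
pose c : R := \sum_i \sum_j sqn ((invmx B) i j) + 1.
have c0 : 0 < c.
  by rewrite ltr_wpDl// sumr_ge0// => *; apply: sumr_ge0 => *; exact: sqn_ge0.
exists c^-1; first by rewrite invr_gt0.
move=> v; rewrite mulrC ler_pdivrMr// mulrC EX qf_factor.
rewrite -{1}(mulKmx uB v); apply: (le_trans (sqn_mulmx_le _ _)).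
by rewrite ler_wpM2r ?lerDl// sumr_ge0// => *; exact: sqn_ge0.
Qed.

Lemma sum_sqn_gt0 (v : 'cV[C]_n) : v != 0 -> 0 < \sum_i sqn (v i 0).
Proof.
move=> v0; have h i : true -> 0 <= sqn (v i 0) by move=> _; exact: sqn_ge0.
rewrite lt_def sumr_ge0// andbT; apply: contra v0.
rewrite psumr_eq0// => /allP z; apply/eqP/colP => i; rewrite mxE.
by have := z i (mem_index_enum _); rewrite sqn_eq0 => /eqP.
Qed.

Lemma open_pd : open [set X : H | pd X].
Proof.
rewrite openE => X /= pdX; have [m m0 hm] := pd_coercive pdX.
apply/nbhs_ballP; exists m => //= Y; rewrite -ball_normE /= distrC => YX.
apply/pdE => v v0.
have YE : Y = X + (Y - X) by rewrite addrC subrK.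
rewrite {1}YE herm_valD qfD.
have S0 : 0 < \sum_i sqn (v i 0) := sum_sqn_gt0 v0.
have := qf_norm_le (Y - X) v; rewrite ler_norml => /andP[+ _].
have := hm v; have : `|Y - X| * \sum_i sqn (v i 0) < m * \sum_i sqn (v i 0).
  by rewrite ltr_pM2r.
by move: (qf X v) (qf _ v) (_ * _) (_ * _) => *; lra.
Qed.

Lemma bounded_linear_continuous (E : normedModType R) (f : E -> R) (M : R) :
  (forall x y, f (x - y) = f x - f y) -> (forall x, `|f x| <= M * `|x|) ->
  continuous f.
Proof.
move=> fB fM x; apply/cvgrPdist_lt => e e0.
have M0 : 0 < `|M| + 1 by rewrite ltr_wpDl.
have /cvgrPdist_lt /(_ _ (divr_gt0 e0 M0)) := @cvg_id E (nbhs x).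
apply: filterS => y hy; rewrite -fB; apply: (le_lt_trans (fM _)).
apply: (@le_lt_trans _ _ ((`|M| + 1) * `|x - y|)).
  by rewrite ler_wpM2r// (le_trans (ler_norm M))// lerDl.
by rewrite mulrC -ltr_pdivlMr.
Qed.

Lemma continuous_Re_entry i j : continuous (fun X : H => complex.Re (X i j)).
Proof.
apply: (@bounded_linear_continuous _ _ 1) => [X Y|X].
  by rewrite herm_valB !mxE; case: (X i j) (Y i j) => [? ?] [].
rewrite mul1r; apply: le_trans (normc_le_norm X i j).
by case: (X i j) => a b /=; rewrite -sqrtr_sqr ler_sqrt ?addr_ge0 ?sqr_ge0// lerDl sqr_ge0.
Qed.

Lemma continuous_Im_entry i j : continuous (fun X : H => complex.Im (X i j)).
Proof.
apply: (@bounded_linear_continuous _ _ 1) => [X Y|X].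
  by rewrite herm_valB !mxE; case: (X i j) (Y i j) => [? ?] [].
rewrite mul1r; apply: le_trans (normc_le_norm X i j).
by case: (X i j) => a b /=; rewrite -sqrtr_sqr ler_sqrt ?addr_ge0 ?sqr_ge0// lerDr sqr_ge0.
Qed.

Lemma qfB (A B : 'M[C]_n) v : qf (A - B) v = qf A v - qf B v.
Proof.
rewrite qfD; congr (_ + _); rewrite /qf mulmxN mulNmx mxE.
by case: (_ 0 0).
Qed.

Lemma continuous_qf v : continuous (fun X : H => qf X v).
Proof.
apply: (@bounded_linear_continuous _ _ (\sum_i sqn (v i 0))) => [X Y|X].
  by rewrite herm_valB qfB.
by rewrite mulrC; exact: qf_norm_le.
Qed.

Lemma pd_psd_add X Y : pd X -> psd Y -> pd (X + Y).
Proof.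
move=> /pdE hX /psdE hY; apply/pdE => v v0.
by rewrite herm_valD qfD ltr_wpDr// hX.
Qed.

Lemma pdZ (a : R) X : 0 < a -> pd X -> pd (a *: X).
Proof.
move=> a0 /pdE hX; apply/pdE => v v0.
by rewrite herm_valZ qfZ mulr_gt0// hX.
Qed.

Lemma psdZ (a : R) X : 0 <= a -> psd X -> psd (a *: X).
Proof.
by move=> a0 /psdE hX; apply/psdE => v; rewrite herm_valZ qfZ mulr_ge0.
Qed.

Lemma psdD X Y : psd X -> psd Y -> psd (X + Y).
Proof.
move=> /psdE hX /psdE hY; apply/psdE => v.
by rewrite herm_valD qfD addr_ge0.
Qed.

Lemma pd1 : pd (herm1 R n).
Proof.
have E : (herm1 R n : 'M[C]_n) = cong 1%:M (fun=> 1).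
  by rewrite cong1 trmx1 map_mx1 mulmx1.
by apply/(pd_cong (unitmx1 _ _) E).
Qed.

Lemma pd_comb X Y (p q : R) : pd X -> pd Y -> 0 <= p -> 0 <= q -> 0 < p + q ->
  pd (p *: X + q *: Y).
Proof.
move=> pX pY; rewrite le_eqVlt => /predU1P[<- _|p0 q0 _].
  by rewrite add0r => q0; rewrite scale0r add0r; exact: pdZ.
by apply: pd_psd_add; [exact: pdZ|apply: psdZ => //; exact: pd_psd].
Qed.

(** The determinant of a Hermitian matrix is real. *)
Definition detr X : R := complex.Re (\det X).

Lemma pd_detr X : pd X -> 0 < detr X /\ \det X = (detr X)%:C.
Proof.
move=> pdX; have [B uB EX] := pd_unit_cong pdX.
rewrite /detr EX -cong1 det_cong big1// mulr1; split => //=.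
by rewrite sqn_gt0 -unitfE -unitmxE.
Qed.

Lemma psd_detr_pd X : psd X -> detr X != 0 -> pd X.
Proof.
move=> psX; have [B [d [uB _ E]]] := herm_spectral X.
rewrite /detr E det_cong /= mulf_eq0 negb_or => /andP[_ d0].
apply/(pd_cong uB E) => i; rewrite lt_def ((psd_cong uB E).1 psX) andbT.
by apply: contraNneq d0 => di; apply/prodf_eq0; exists i; rewrite ?di.
Qed.

End HermitianTopology.

Section MatrixFamilies.
Local Open Scope complex_scope.
Local Open Scope sesquilinear_scope.
Variables (R : realType) (E : normedModType R) (U : set E).
Hypothesis oU : open U.
Local Notation C := R[i].
Variable k : nat.

(** Complex-valued smooth families, needed for the entries of matrices. *)
Definition smooth_cfamily (g : R -> E -> C) :=
  smooth_family U k (fun s x => complex.Re (g s x)) /\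
  smooth_family U k (fun s x => complex.Im (g s x)).

Lemma cfam_ext g g' : (forall s x, U x -> g s x = g' s x) -> smooth_cfamily g -> smooth_cfamily g'.
Proof.
by move=> e [h1 h2]; split; [apply: fam_ext h1|apply: fam_ext h2] => // s x /e ->.
Qed.

Lemma cfam_cst (c : C) : smooth_cfamily (fun _ _ => c).
Proof.
split; first exact: (fam_cst _ _ (@continuous_cstR R (complex.Re c))).
exact: (fam_cst _ _ (@continuous_cstR R (complex.Im c))).
Qed.

Lemma cfam_add g1 g2 : smooth_cfamily g1 -> smooth_cfamily g2 -> smooth_cfamily (fun s x => g1 s x + g2 s x).
Proof.
move=> [a1 b1] [a2 b2]; split.
  apply: fam_ext (fam_add a1 a2) => // s x _.
  by case: (g1 s x) (g2 s x) => [? ?] [].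
apply: fam_ext (fam_add b1 b2) => // s x _.
by case: (g1 s x) (g2 s x) => [? ?] [].
Qed.

Lemma cfam_mul g1 g2 : smooth_cfamily g1 -> smooth_cfamily g2 -> smooth_cfamily (fun s x => g1 s x * g2 s x).
Proof.
move=> [a1 b1] [a2 b2]; split.
  apply: fam_ext (fam_sub oU (fam_mul a1 a2) (fam_mul b1 b2)) => // s x _.
  by case: (g1 s x) (g2 s x) => [? ?] [].
apply: fam_ext (fam_add (fam_mul a1 b2) (fam_mul b1 a2)) => // s x _.
by case: (g1 s x) (g2 s x) => [? ?] [].
Qed.

Lemma cfam_sum (I : eqType) (r : seq I) (P : pred I) (F : I -> R -> E -> C) :
  (forall i, smooth_cfamily (F i)) -> smooth_cfamily (fun s x => \sum_(i <- r | P i) F i s x).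
Proof.
move=> fF; split; [have h := fam_sum oU r P (fun i => (fF i).1)
                  |have h := fam_sum oU r P (fun i => (fF i).2)].
  by apply: fam_ext h => // s x _; rewrite Re_sum.
by apply: fam_ext h => // s x _; rewrite Im_sum.
Qed.

Lemma cfam_prod (I : eqType) (r : seq I) (F : I -> R -> E -> C) :
  (forall i, smooth_cfamily (F i)) -> smooth_cfamily (fun s x => \prod_(i <- r) F i s x).
Proof.
move=> fF; elim: r => [|i r IH].
  by apply: cfam_ext (cfam_cst 1) => s x _; rewrite big_nil.
by apply: cfam_ext (cfam_mul (fF i) IH) => s x _; rewrite big_cons.
Qed.

Lemma cfam_mulmx m n p (A : R -> E -> 'M[C]_(m, n)) (B : R -> E -> 'M[C]_(n, p)) :
  (forall i j, smooth_cfamily (fun s x => A s x i j)) ->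
  (forall i j, smooth_cfamily (fun s x => B s x i j)) ->
  forall i j, smooth_cfamily (fun s x => (A s x *m B s x) i j).
Proof.
move=> fA fB i j.
apply: cfam_ext (cfam_sum (index_enum _) xpredT
  (fun l => cfam_mul (fA i l) (fB l j))) => s x _.
by rewrite mxE.
Qed.

Lemma cfam_det n (A : R -> E -> 'M[C]_n) :
  (forall i j, smooth_cfamily (fun s x => A s x i j)) -> smooth_cfamily (fun s x => \det (A s x)).
Proof.
move=> fA; rewrite /determinant; apply: cfam_sum => sg.
apply: cfam_mul; first exact: cfam_cst.
by apply: cfam_prod => i; exact: fA.
Qed.

Lemma cfam_adj n (A : R -> E -> 'M[C]_n) :
  (forall i j, smooth_cfamily (fun s x => A s x i j)) ->
  forall i j, smooth_cfamily (fun s x => (\adj (A s x)) i j).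
Proof.
move=> fA i j.
have fM : smooth_cfamily (fun s x => \det (row' j (col' i (A s x)))).
  apply: cfam_det => i' j'.
  by apply: cfam_ext (fA (lift j i') (lift i j')) => s x _; rewrite !mxE.
by apply: cfam_ext (cfam_mul (cfam_cst ((-1) ^+ (j + i))) fM) => s x _; rewrite mxE.
Qed.

(** Cramer's rule expresses the inverse polynomially, up to division by the
determinant. *)
Lemma fam_kform n (L Z : R -> E -> herm R n) :
  (forall s x, U x -> pd (Z s x)) ->
  (forall i j, smooth_cfamily (fun s x => L s x i j)) ->
  (forall i j, smooth_cfamily (fun s x => Z s x i j)) ->
  smooth_family U k (fun s x => kform (L s x) (Z s x)).
Proof.
move=> pdZ fL fZ.
have fd := cfam_det fZ.
have fT : smooth_cfamily (fun s x => \tr (L s x *m \adj (Z s x) *m L s x)).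
  apply: cfam_sum => i.
  by apply: cfam_mulmx => //; apply: cfam_mulmx => //; exact: cfam_adj.
apply: (fam_ext oU _ (fam_mul (fam_inv oU _ fd.1) fT.1)) => //.
  move=> s x Ux; have [d0 dE] := pd_detr (pdZ s x Ux).
  rewrite /kform /invmx unitmxE dE unitfE.
  have -> : (detr (Z s x))%:C != 0 by rewrite -[0]/(0%:C) eq_complex /= gt_eqF.
  rewrite -scalemxAr -scalemxAl linearZ /=.
  have -> : ((detr (Z s x))%:C)^-1 = ((detr (Z s x))^-1)%:C by rewrite fmorphV.
  by rewrite ReM_real.
by move=> s x Ux; rewrite gt_eqF//; case: (pd_detr (pdZ s x Ux)).
Qed.

End MatrixFamilies.

(** * Logarithm of the determinant *)

Section LogDeterminant.
Local Open Scope complex_scope.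
Variables (R : realType) (n : nat).
Local Notation C := R[i].
Local Notation H := (herm R n).
Implicit Types (X Y : H).

Definition trr X : R := complex.Re (\tr X).

Lemma trrD X Y : trr (X + Y) = trr X + trr Y.
Proof. by rewrite /trr herm_valD raddfD /=; case: (\tr _) (\tr _) => [? ?] []. Qed.

Lemma trrZ (a : R) X : trr (a *: X) = a * trr X.
Proof. by rewrite /trr herm_valZ linearZ /= ReM_real. Qed.

Lemma continuous_trr : continuous trr.
Proof.
have -> : trr = (fun X => \sum_i complex.Re (X i i)).
  by apply/funext => X; rewrite /trr /mxtrace Re_sum.
by apply: continuous_sumR => i; exact: continuous_Re_entry.
Qed.

Lemma cfam_herm (F : normedModType R) (U : set F) k (l : F -> H) i j :
  open U -> (forall x y, l (x + y) = l x + l y) ->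
  (forall (a : R) x, l (a *: x) = a *: l x) -> continuous l ->
  smooth_cfamily U k (fun _ x => (l x) i j).
Proof.
move=> oU lD lZ cl; split; apply: fam_linear => //.
- by move=> x y; rewrite lD herm_valD mxE; case: (l x i j) (l y i j) => [? ?] [].
- by move=> a x; rewrite lZ herm_valZ mxE ReM_real.
- by move=> x; apply: (@continuous_comp _ _ _ l (fun X : H => complex.Re (X i j)));
    [exact: cl|exact: continuous_Re_entry].
- by move=> x y; rewrite lD herm_valD mxE; case: (l x i j) (l y i j) => [? ?] [].
- by move=> a x; rewrite lZ herm_valZ mxE ImM_real.
- by move=> x; apply: (@continuous_comp _ _ _ l (fun X : H => complex.Im (X i j)));
    [exact: cl|exact: continuous_Im_entry].
Qed.

Lemma continuous_detr : continuous (@detr R n).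
Proof.
have oT : open [set: H] by exact: openT.
have [f _] : smooth_cfamily [set: H] 0 (fun _ X => \det X).
  by apply: cfam_det => // i j; apply: cfam_herm => // x; exact: cvg_id.
by move=> X; exact: (@joint_cont_snd _ _ _ (fun _ X => complex.Re (\det X)) 0 X (fam_joint_cont f) I).
Qed.

(** Tangent line inequality for the logarithm at the mean p a + q b. *)
Lemma ln_comb_le (p q a b : R) : 0 <= p -> 0 <= q -> p + q = 1 -> 0 < a -> 0 < b ->
  p * ln a + q * ln b <= ln (p * a + q * b).
Proof.
move=> p0 q0 pq a0 b0; set m := p * a + q * b.
have m0 : 0 < m by apply: comb_gt0; rewrite ?pq.
have L y : 0 < y -> ln y - ln m <= y / m - 1.
  move=> y0; rewrite -ln_div//.
  have h : -1 < y / m - 1 by rewrite ltrBrDl subrr divr_gt0.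
  by have := le_ln1Dx h; rewrite addrC subrK.
have := ler_wpM2l p0 (L a a0); have := ler_wpM2l q0 (L b b0).
have e : p * (a / m - 1) + q * (b / m - 1) = 0.
  transitivity (m / m - (p + q)); first by rewrite /m; ring.
  by rewrite pq divff ?subrr// gt_eqF.
have E : p * ln m + q * ln m = ln m by rewrite -mulrDl pq mul1r.
move: E e; move: (p * (a / m - 1)) (q * (b / m - 1)) => u v.
by rewrite !mulrBr; lra.
Qed.

Lemma sum_three_concave (a b l1 l2 l3 m1 m2 m3 k1 k2 k3 : R) :
  a * l1 + b * m1 <= k1 -> a * l2 + b * m2 <= k2 -> a * l3 + b * m3 <= k3 ->
  - k1 - k2 - k3 <= a * (- l1 - l2 - l3) + b * (- m1 - m2 - m3).
Proof. by lra. Qed.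

(** The d i are the eigenvalues of Y relative to X; the determinant along the
pencil and order relations between X and Y are both read on them. *)
Lemma detr_pencil X Y : pd X -> exists (d : 'I_n -> R) (b : R),
  [/\ 0 < b,
      forall p q, detr (p *: X + q *: Y) = b * \prod_i (p + q * d i),
      (pd Y -> forall i, 0 < d i) &
      forall r, (forall i, `|d i| <= r) ->
        forall v : 'cV[C]_n, `|qf Y v| <= r * qf X v].
Proof.
move=> pdX; have [B [d [uB E1 E2]]] := simultaneous_cong Y pdX.
exists d, (sqn (\det B)); split.
- by rewrite sqn_gt0 -unitfE -unitmxE.
- by move=> p q; rewrite /detr (pencil_cong p q E1 E2) det_cong.
- by move/(pd_cong uB E2).
- move=> r dr v; rewrite E1 E2 !qf_cong mulr_sumr.
  apply: (le_trans (ler_norm_sum _ _ _)); apply: ler_sum => i _.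
  by rewrite normrM (ger0_norm (sqn_ge0 _)) mul1r ler_wpM2r ?sqn_ge0.
Qed.

Lemma ln_prod (I : eqType) (s : seq I) (F : I -> R) : (forall i, 0 < F i) ->
  ln (\prod_(i <- s) F i) = \sum_(i <- s) ln (F i).
Proof.
move=> F0; elim: s => [|i s IH]; first by rewrite !big_nil ln1.
by rewrite !big_cons lnM ?IH ?posrE ?prodr_gt0.
Qed.

Lemma lndet_concave X Y (p q : R) : pd X -> pd Y -> 0 <= p -> 0 <= q -> p + q = 1 ->
  p * ln (detr X) + q * ln (detr Y) <= ln (detr (p *: X + q *: Y)).
Proof.
move=> pX pY p0 q0 pq; have [d [b [b0 hd dY _]]] := detr_pencil Y pX.
have {}dY := dY pY.
have eX : detr X = b.
  by have := hd 1 0; rewrite scale1r scale0r addr0 big1 ?mulr1// => i _; rewrite mul0r addr0.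
have eY : detr Y = b * \prod_i d i.
  have := hd 0 1; rewrite scale1r scale0r add0r => ->; congr (_ * _).
  by apply: eq_bigr => i _; rewrite mul1r add0r.
have pqd i : 0 < p + q * d i.
  by rewrite -[p]mulr1; apply: comb_gt0; rewrite ?pq.
rewrite hd eX eY !lnM ?posrE ?prodr_gt0// !ln_prod//.
rewrite mulrDr addrA -mulrDl pq mul1r lerD2l mulr_sumr ler_sum// => i _.
by have := ln_comb_le p0 q0 pq ltr01 (dY i); rewrite ln1 mulr0 add0r mulr1.
Qed.

(** Along a line log det is, up to a constant, the sum of the log (1 + d i t). *)
Lemma jet_lndet X Y : pd X -> exists d : 'I_n -> R,
  jet (fun t => ln (detr (X + t *: Y))) (\sum_i d i) (- \sum_i d i ^+ 2)
    (2 * \sum_i d i ^+ 3) /\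
  forall r, (forall i, `|d i| <= r) ->
    forall v : 'cV[C]_n, `|qf Y v| <= r * qf X v.
Proof.
move=> pX; have [d [b [b0 hd _ hr]]] := detr_pencil Y pX.
exists d; split=> //.
have J1 i : jet (fun t => ln (1 + d i * t)) (d i) (- d i ^+ 2) (2 * d i ^+ 3).
  have := @jet_ln R (fun t => 1 + d i * t) _ _ _ _ (jet_affine 1 (d i)).
  rewrite mulr0 addr0 !divr1 mulr0 subr0 !add0r => h.
  by apply: h; exact: ltr01.
have J2 := jet_add (jet_affine (ln b) 0) (jet_sum (index_enum 'I_n) J1).
rewrite !add0r sumrN -mulr_sumr in J2; apply: jet_ext J2.
have nd i : \forall t \near (0 : R), 0 < 1 + d i * t.
  have [/derivable1_diffP/differentiable_continuous cf _] := is_derive_affine 1 (d i) 0.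
  by apply: (cvgr_gt _ cf); rewrite mulr0 addr0.
have {}nd := @filter_forall R 'I_n (fun i t => 0 < 1 + d i * t) (nbhs (0 : R)) (nbhs_filter (0 : R)) nd.
apply: filterS nd => t ht; rewrite mul0r addr0.
have -> : detr (X + t *: Y) = b * \prod_i (1 + d i * t).
  have -> : X + t *: Y = 1 *: X + t *: Y by rewrite scale1r.
  by rewrite hd; congr (_ * _); apply: eq_bigr => i _; rewrite mulrC.
by rewrite lnM ?posrE ?prodr_gt0// ln_prod.
Qed.

(** With N the square root of a^2 + b + r^2, the difference of the two sides is
(N - (a + r))^2 (2 N + a + r). *)
Lemma self_concordance_scalar (a b r : R) : 0 <= a -> 0 <= b -> 0 <= r ->
  3 * r * b + 3 * a * b + 2 * a ^+ 3 + 2 * r ^+ 3 <=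
  2 * (a ^+ 2 + b + r ^+ 2) `^ (3 / 2).
Proof.
move=> a0 b0 r0; set N2 := a ^+ 2 + b + r ^+ 2.
have N20 : 0 <= N2 by rewrite !addr_ge0 ?sqr_ge0.
set N := Num.sqrt N2; have N0 : 0 <= N by exact: sqrtr_ge0.
have EN : N2 = N ^+ 2 by rewrite sqr_sqrtr.
rewrite powR_three_halves// -/N.
have Eb : b = N ^+ 2 - a ^+ 2 - r ^+ 2 by rewrite -EN /N2; ring.
rewrite -subr_ge0 Eb.
have -> : 2 * N ^+ 3 - (3 * r * (N ^+ 2 - a ^+ 2 - r ^+ 2) +
    3 * a * (N ^+ 2 - a ^+ 2 - r ^+ 2) + 2 * a ^+ 3 + 2 * r ^+ 3) =
    (N - (a + r)) ^+ 2 * (2 * N + (a + r)) by ring.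
by rewrite mulr_ge0 ?sqr_ge0// !addr_ge0 ?mulr_ge0.
Qed.

End LogDeterminant.

(** * Self-concordance and parameter of the barrier *)

Section AbstractBarrier.
Local Open Scope complex_scope.
Variables (R : realType) (n : nat).
Local Notation C := R[i].
Local Notation H := (herm R n).
Local Notation E := (H * H * R)%type.
Implicit Types (X Y : H) (p x h : E).

Definition pd_pair : set E := [set p | pd p.1.1 /\ pd p.1.2].

Lemma continuous_fst1 : continuous (fun p : E => p.1.1).
Proof. by move=> p; apply: (@continuous_comp _ _ _ fst fst); exact: cvg_fst. Qed.

Lemma continuous_snd1 : continuous (fun p : E => p.1.2).
Proof.
by move=> p; apply: (@continuous_comp _ _ _ fst snd); [exact: cvg_fst|exact: cvg_snd].
Qed.

Lemma open_pd_pair : open pd_pair.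
Proof.
apply: (@openI _ (fun p : E => pd p.1.1) (fun p : E => pd p.1.2)).
  apply: (@open_comp _ _ (fun p : E => p.1.1) [set X | pd X]); last exact: open_pd.
  by move=> p _; exact: continuous_fst1.
apply: (@open_comp _ _ (fun p : E => p.1.2) [set X | pd X]); last exact: open_pd.
by move=> p _; exact: continuous_snd1.
Qed.

Lemma fam_subset (V : set E) k g : V `<=` pd_pair -> smooth_family pd_pair k g -> smooth_family V k g.
Proof.
move=> VU; elim: k g => [|k IH] g [cg dg].
  by split=> // s x /VU; exact: cg.
split=> [s x /VU|h]; first exact: cg.
by have [g' hg' /IH fg'] := dg h; exists g' => // s x /VU; exact: hg'.
Qed.

Definition pd_sublinear (G : H -> H -> R) := forall X1 Y1 X2 Y2 (p q : R),
  pd X1 -> pd Y1 -> pd X2 -> pd Y2 -> 0 <= p -> 0 <= q -> 0 < p + q ->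
  G (p *: X1 + q *: X2) (p *: Y1 + q *: Y2) <= p * G X1 Y1 + q * G X2 Y2.

Definition pd_smooth (G : H -> H -> R) :=
  smooth_family pd_pair 3 (fun _ p => G p.1.1 p.1.2).

(** Compatibility with the cone of positive definite pairs: a direction dominated
by r times the base point changes the second derivative at relative speed at
most 3 r. Bounds on quadratic forms express -r X <= X' <= r X. *)
Definition pd_compatible (G : H -> H -> R) :=
  forall X Y X' Y' (r a1 a2 a3 : R), pd X -> pd Y -> 0 <= r ->
  (forall v : 'cV[C]_n, `|qf X' v| <= r * qf X v) ->
  (forall v : 'cV[C]_n, `|qf Y' v| <= r * qf Y v) ->
  jet (fun t => G (X + t *: X') (Y + t *: Y')) a1 a2 a3 ->
  0 <= a2 /\ `|a3| <= 3 * r * a2.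

Definition pd_trace_bounded (G : H -> H -> R) := exists c, forall X Y,
  pd X -> pd Y -> - (c * (trr X + trr Y)) <= G X Y.

Variables (G : H -> H -> R) (sg : R).
Hypothesis G_sublinear : pd_sublinear G.
Hypothesis G_smooth : pd_smooth G.
Hypothesis G_compatible : pd_compatible G.
Hypothesis G_lower : pd_trace_bounded G.

(** The sign sg selects the epigraph (1) or, applied to minus a concave function,
the hypograph (-1). *)
Definition slack p : R := sg * p.2 - G p.1.1 p.1.2.

Definition barrier p : \bar R :=
  if `[< pd p.1.1 /\ pd p.1.2 >]
  then (- lne (slack p)%:E - logdet p.1.1 - logdet p.1.2)%E else +oo%E.

Definition barrier_dom : set E := [set p | pd_pair p /\ 0 < slack p].

Definition rbarrier p : R :=
  - ln (slack p) - ln (detr p.1.1) - ln (detr p.1.2).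

Lemma logdetE X : pd X -> logdet X = (ln (detr X))%:E.
Proof. by move=> /pd_detr[d0 _]; rewrite /logdet -/(detr X) lne_EFin. Qed.

Lemma barrier_fin p : barrier_dom p -> barrier p = (rbarrier p)%:E.
Proof.
move=> [[pX pY] u0]; rewrite /barrier asboolT//.
by rewrite !logdetE// lne_EFin// -EFinN -!EFinB.
Qed.

Lemma barrier_out p : ~ barrier_dom p -> barrier p = +oo%E.
Proof.
move=> np; rewrite /barrier; case: asboolP => // -[pX pY].
rewrite !logdetE// le0_lneNy//= lee_fin leNgt; apply/negP => u0.
by apply: np; split.
Qed.

Lemma dom_barrier : dom barrier = barrier_dom.
Proof.
apply/seteqP; split => p; last by move=> /barrier_fin; rewrite /dom /= => ->; exact: ltry.
rewrite /dom /=; have [//|np] := pselect (barrier_dom p).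
by rewrite barrier_out// ltxx.
Qed.

Lemma continuous_G p : pd_pair p -> {for p, continuous (fun p => G p.1.1 p.1.2)}.
Proof. by move=> Up; exact: (@joint_cont_snd _ _ _ (fun _ p => G p.1.1 p.1.2) 0 p (fam_joint_cont G_smooth) Up). Qed.

Lemma continuous_slack p : pd_pair p -> {for p, continuous slack}.
Proof.
move=> Up; apply: (@continuousB _ _ _ (fun p : E => sg * p.2) (fun p => G p.1.1 p.1.2)).
  by apply: (@continuousM _ _ (cst sg) snd); [exact: cst_continuous|exact: cvg_snd].
exact: continuous_G.
Qed.

Lemma open_barrier_dom : open barrier_dom.
Proof.
rewrite openE => p [Up u0]; rewrite /interior.
have h1 : \forall y \near p, pd_pair y by apply: open_nbhs_nbhs; split => //; exact: open_pd_pair.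
have h2 : \forall y \near p, 0 < slack y by exact: (cvgr_gt _ (continuous_slack Up)).
by apply: filterS2 h1 h2.
Qed.

Lemma slack_concave p q (a b : R) : pd_pair p -> pd_pair q -> 0 <= a -> 0 <= b ->
  0 < a + b -> a * slack p + b * slack q <= slack (a *: p + b *: q).
Proof.
move=> [pX pY] [qX qY] a0 b0 ab; rewrite /slack /=.
have := G_sublinear pX pY qX qY a0 b0 ab.
move: (G _ _) (G _ _) (G _ _) => g1 g2 g3.
rewrite -[a *: p.2]/(a * p.2) -[b *: q.2]/(b * q.2); nra.
Qed.

Lemma convex_barrier_dom p q (a b : R) : barrier_dom p -> barrier_dom q ->
  0 <= a -> 0 <= b -> 0 < a + b -> barrier_dom (a *: p + b *: q).
Proof.
move=> [Up up] [Uq uq] a0 b0 ab; split.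
  have [pX pY] := Up; have [qX qY] := Uq.
  by split; [exact: (pd_comb pX qX a0 b0 ab)|exact: (pd_comb pY qY a0 b0 ab)].
exact: (lt_le_trans (comb_gt0 a0 b0 ab up uq) (slack_concave Up Uq a0 b0 ab)).
Qed.

Lemma rbarrier_convex p q (a b : R) : barrier_dom p -> barrier_dom q ->
  0 <= a -> 0 <= b -> a + b = 1 ->
  rbarrier (a *: p + b *: q) <= a * rbarrier p + b * rbarrier q.
Proof.
move=> dp dq a0 b0 ab; have [[pX pY] up] := dp; have [[qX qY] uq] := dq.
have ab0 : 0 < a + b by rewrite ab.
have h1 := lndet_concave pX qX a0 b0 ab; have h2 := lndet_concave pY qY a0 b0 ab.
have h3 : a * ln (slack p) + b * ln (slack q) <= ln (slack (a *: p + b *: q)).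
  have h0 := ln_comb_le a0 b0 ab up uq; apply: (le_trans h0).
  have [_ u0] := convex_barrier_dom dp dq a0 b0 ab0.
  have h := slack_concave dp.1 dq.1 a0 b0 ab0.
  by rewrite ler_ln ?posrE//; exact: (comb_gt0 a0 b0 ab0 up uq).
exact: sum_three_concave h3 h1 h2.
Qed.

Lemma econvex_barrier : econvex barrier.
Proof.
move=> p q t /andP[t0 t1].
have t1' : 0 <= 1 - t by rewrite subr_ge0.
have [->|tn0] := eqVneq t 0.
  by rewrite scale0r add0r subr0 scale1r mul0e add0e mul1e.
have [->|tn1] := eqVneq t 1.
  by rewrite subrr scale0r addr0 scale1r mul0e adde0 mul1e.
have tp : 0 < t by rewrite lt_def tn0.
have tp' : 0 < 1 - t by rewrite subr_gt0 lt_def eq_sym tn1.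
have nNy x : (barrier x != -oo)%E.
  by have [/barrier_fin ->|/barrier_out ->] := pselect (barrier_dom x).
have [dp|/barrier_out ->] := pselect (barrier_dom p); last first.
  rewrite gt0_muley ?lte_fin// addye ?leey//.
  have [/barrier_fin ->//|/barrier_out ->] := pselect (barrier_dom q).
  by rewrite gt0_muley ?lte_fin.
have [dq|/barrier_out ->] := pselect (barrier_dom q); last first.
  by rewrite (barrier_fin dp) gt0_muley ?lte_fin// -EFinM addey// leey.
have dpq : barrier_dom (t *: p + (1 - t) *: q).
  by apply: convex_barrier_dom => //; rewrite addrC subrK.
rewrite !barrier_fin// -!EFinM -EFinD lee_fin.
by apply: rbarrier_convex => //; rewrite addrC subrK.
Qed.

Lemma closure_ge0 (T : topologicalType) (S : set T) (f : T -> R) q :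
  closure S q -> {for q, continuous f} -> (forall y, S y -> 0 <= f y) -> 0 <= f q.
Proof.
move=> cS cf Sf; rewrite leNgt; apply/negP => f0.
have nf : \forall y \near q, f y < 0 by exact: (cvgr_lt _ cf).
by have [y [Sy /= fy]] := cS _ nf; have := Sf y Sy; rewrite leNgt fy.
Qed.

Lemma closure_psd (T : topologicalType) (S : set T) (f : T -> H) q :
  closure S q -> {for q, continuous f} -> (forall y, S y -> pd (f y)) -> psd (f q).
Proof.
move=> cS cf Sf; apply/psdE => v; apply: (closure_ge0 (f := fun q => qf (f q) v) cS).
  by apply: (@continuous_comp _ _ _ f (fun X : H => qf X v)); [exact: cf|exact: continuous_qf].
by move=> y /Sf/pd_psd/psdE.
Qed.

(** The inequality g <= t reads e^(-t) <= slack det X det Y, where G is not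
continuous at the boundary. Replacing the slack by a continuous upper bound
shows that limit points have nonzero determinants, hence are interior to the
cone, where the inequality itself passes to the limit. *)
Lemma closed_epigraph_barrier :
  closed [set q : E * R | (barrier q.1 <= q.2%:E)%E].
Proof.
set S := (X in closed X).
have SE q : S q -> barrier_dom q.1 /\
    expR (- q.2) <= slack q.1 * (detr q.1.1.1 * detr q.1.1.2).
  rewrite /S /=; have [dq|/barrier_out ->] := pselect (barrier_dom q.1); last first.
    by rewrite leye_eq.
  rewrite barrier_fin// lee_fin => h; split => //.
  have [[pX pY] u0] := dq; have [dX _] := pd_detr pX; have [dY _] := pd_detr pY.
  rewrite -ler_ln ?posrE ?expR_gt0 ?mulr_gt0// expRK !lnM ?posrE ?mulr_gt0//.
  by move: h; rewrite /rbarrier; move: (ln _) (ln _) (ln _) => *; lra.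
have cX : continuous (fun q : E * R => q.1.1.1).
  by move=> q; apply: (@continuous_comp _ _ _ fst (fun p : E => p.1.1)); [exact: cvg_fst|exact: continuous_fst1].
have cY : continuous (fun q : E * R => q.1.1.2).
  by move=> q; apply: (@continuous_comp _ _ _ fst (fun p : E => p.1.2)); [exact: cvg_fst|exact: continuous_snd1].
have cz : continuous (fun q : E * R => q.1.2).
  by move=> q; apply: (@continuous_comp _ _ _ fst snd); [exact: cvg_fst|exact: cvg_snd].
have ce : continuous (fun q : E * R => expR (- q.2)).
  move=> q; apply: (@continuous_comp _ _ _ (fun q : E * R => - q.2)).
    by apply: (@continuousN _ _ _ snd); exact: cvg_snd.
  exact: continuous_expR.
have cdet : continuous (fun q : E * R => detr q.1.1.1 * detr q.1.1.2).
  move=> q; apply: (@continuousM _ _ (fun q : E * R => detr q.1.1.1)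
    (fun q : E * R => detr q.1.1.2)).
    by apply: (@continuous_comp _ _ _ (fun q : E * R => q.1.1.1) (@detr R n));
      [exact: cX|exact: continuous_detr].
  by apply: (@continuous_comp _ _ _ (fun q : E * R => q.1.1.2) (@detr R n));
    [exact: cY|exact: continuous_detr].
have [c hc] := G_lower.
pose m (q : E * R) := sg * q.1.2 + c * (trr q.1.1.1 + trr q.1.1.2).
have cm : continuous m.
  move=> q; apply: (@continuousD _ _ _ (fun q : E * R => sg * q.1.2)
      (fun q : E * R => c * (trr q.1.1.1 + trr q.1.1.2))).
    by apply: (@continuousM _ _ (cst sg)); [exact: cst_continuous|exact: cz].
  apply: (@continuousM _ _ (cst c)); first exact: cst_continuous.
  apply: (@continuousD _ _ _ (fun q : E * R => trr q.1.1.1)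
      (fun q : E * R => trr q.1.1.2)).
    by apply: (@continuous_comp _ _ _ (fun q : E * R => q.1.1.1) (@trr R n));
      [exact: cX|exact: continuous_trr].
  by apply: (@continuous_comp _ _ _ (fun q : E * R => q.1.1.2) (@trr R n));
    [exact: cY|exact: continuous_trr].
move=> q cq.
have psX : psd q.1.1.1 by apply: (closure_psd cq (cX q)) => y /SE[[[]]].
have psY : psd q.1.1.2 by apply: (closure_psd cq (cY q)) => y /SE[[[]]].
(* m is the continuous upper bound of the slack *)
have hm : 0 <= m q * (detr q.1.1.1 * detr q.1.1.2) - expR (- q.2).
  apply: (closure_ge0 (f := fun q => m q * (detr q.1.1.1 * detr q.1.1.2) - expR (- q.2)) cq).
    apply: (@continuousB _ _ _ (fun q => m q * (detr q.1.1.1 * detr q.1.1.2))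
      (fun q : E * R => expR (- q.2))); last exact: ce.
    by apply: (@continuousM _ _ m); [exact: cm|exact: cdet].
  move=> y /SE[[[pX pY] u0]] h; rewrite subr_ge0 (le_trans h)// ler_wpM2r//.
    by rewrite mulr_ge0// ltW//; [case: (pd_detr pX)|case: (pd_detr pY)].
  by rewrite /slack /m lerD2l lerNl; exact: hc.
have dn0 : detr q.1.1.1 * detr q.1.1.2 != 0.
  apply: contraTneq hm => ->; rewrite mulr0 sub0r oppr_ge0 -ltNge.
  exact: expR_gt0.
have Uq : pd_pair q.1.
  move: dn0; rewrite mulf_eq0 negb_or => /andP[dX dY].
  by split; [exact: (psd_detr_pd psX dX)|exact: (psd_detr_pd psY dY)].
have cs : {for q, continuous (fun q : E * R => slack q.1)}.
  by apply: (@continuous_comp _ _ _ fst slack); [exact: cvg_fst|exact: continuous_slack].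
have s0 : 0 <= slack q.1.
  by apply: (closure_ge0 (f := fun q : E * R => slack q.1) cq) => // y /SE[[_ /ltW]].
have hs : 0 <= slack q.1 * (detr q.1.1.1 * detr q.1.1.2) - expR (- q.2).
  apply: (closure_ge0 (f := fun q => slack q.1 * (detr q.1.1.1 * detr q.1.1.2)
      - expR (- q.2)) cq).
    apply: (@continuousB _ _ _ (fun q => slack q.1 * (detr q.1.1.1 * detr q.1.1.2))
      (fun q : E * R => expR (- q.2))); last exact: ce.
    by apply: (@continuousM _ _ (fun q : E * R => slack q.1)); [exact: cs|exact: cdet].
  by move=> y /SE[_ h]; rewrite subr_ge0.
have sp : 0 < slack q.1.
  rewrite lt_def s0 andbT; apply: contraTneq hs => ->.
  by rewrite mul0r sub0r oppr_ge0 -ltNge expR_gt0.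
have [pX pY] := Uq; have [dX _] := pd_detr pX; have [dY _] := pd_detr pY.
rewrite /S /= barrier_fin// lee_fin.
move: hs; rewrite subr_ge0 -ler_ln ?posrE ?expR_gt0 ?mulr_gt0// expRK.
rewrite !lnM ?posrE ?mulr_gt0//.
by rewrite /rbarrier; move: (ln _) (ln _) (ln _) => *; lra.
Qed.

Lemma Ck_barrier : Ck 3 barrier_dom (fine \o barrier).
Proof.
have oV := open_barrier_dom.
have dU k (l : E -> H) : (forall x y, l (x + y) = l x + l y) ->
    (forall (a : R) x, l (a *: x) = a *: l x) -> continuous l ->
    (forall p, barrier_dom p -> pd (l p)) ->
    smooth_family barrier_dom k (fun _ p => ln (detr (l p))).
  move=> lD lZ cl pl.
  have [f _] : smooth_cfamily barrier_dom k (fun _ p => \det (l p)).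
    by apply: cfam_det => // i j; exact: cfam_herm.
  by apply: (fam_ln oV _ f) => s p /pl /pd_detr[].
have fG : smooth_family barrier_dom 3 (fun _ p => G p.1.1 p.1.2).
  by apply: fam_subset G_smooth => p [].
have fz' : smooth_family barrier_dom 3 (fun _ (p : E) => (p.2 : R)).
  by apply: fam_linear => // p; exact: cvg_snd.
have fz := fam_scale sg fz'.
have fs : smooth_family barrier_dom 3 (fun _ p => slack p) := fam_sub oV fz fG.
have fl := fam_opp oV (fam_ln oV (fun _ p (dp : barrier_dom p) => dp.2) fs).
have f1 := dU 3%N _ (fun _ _ => erefl) (fun _ _ => erefl) continuous_fst1
  (fun p dp => dp.1.1).
have f2 := dU 3%N _ (fun _ _ => erefl) (fun _ _ => erefl) continuous_snd1
  (fun p dp => dp.1.2).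
apply: (@fam_Ck _ _ _ oV 3 _ (fine \o barrier) 0 (fam_sub oV (fam_sub oV fl f1) f2)).
move=> p dp /=.
by rewrite barrier_fin.
Qed.

Lemma sum_sqr_ge0 (f : 'I_n -> R) : 0 <= \sum_i f i ^+ 2.
Proof. by apply: sumr_ge0 => i _; exact: sqr_ge0. Qed.

Lemma norm_le_sqrt_sum (d e : 'I_n -> R) i :
  `|d i| <= Num.sqrt (\sum_i d i ^+ 2 + \sum_i e i ^+ 2).
Proof.
rewrite -sqrtr_sqr ler_sqrt ?addr_ge0 ?sum_sqr_ge0// (bigD1 i)//= -addrA lerDl.
by rewrite addr_ge0 ?sum_sqr_ge0// sumr_ge0// => *; exact: sqr_ge0.
Qed.

(** Here u is the slack, a = u'/u, b = -u''/u, c = -u'''/u, and d, e are the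
relative eigenvalues of the two components of the direction. Since the largest
of them is at most the square root of D 2, compatibility bounds c. *)
Lemma barrier_jet p h : barrier_dom p -> exists (a b c : R) (d e : 'I_n -> R),
  let D k := \sum_i d i ^+ k + \sum_i e i ^+ k in
  [/\ 0 <= b, `|c| <= 3 * Num.sqrt (D 2) * b &
   jet (fun t => fine (barrier (p + t *: h)))
     (- a - D 1) (a ^+ 2 + b + D 2) (c - 3 * a * b - 2 * a ^+ 3 - 2 * D 3)].
Proof.
move=> dp; have [[pX pY] u0] := dp.
have [d [jX rX]] := jet_lndet h.1.1 pX.
have [e [jY rY]] := jet_lndet h.1.2 pY.
have pe : positive_functional (fun f : R -> R => f 0).
  by apply: positive_functional_eval; rewrite lexx ler01.
have [a1 [a2 [a3 [_ [_ jG]]]]] :=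
  fam_jet open_pd_pair pe h G_smooth (conj pX pY).
set D2 := \sum_i d i ^+ 2 + \sum_i e i ^+ 2.
pose r := Num.sqrt D2.
have r0 : 0 <= r by exact: sqrtr_ge0.
have dr i : `|d i| <= r := norm_le_sqrt_sum d e i.
have er i : `|e i| <= r by rewrite /r /D2 addrC; exact: norm_le_sqrt_sum.
have [a20 a3r] := G_compatible pX pY r0 (rX r dr) (rY r er) jG.
have js := jet_add (jet_affine (sg * p.2) (sg * h.2)) (jet_scale (-1) jG).
rewrite !add0r !mulN1r in js.
have e0 : sg * p.2 + sg * h.2 * 0 + -1 * G (p + 0 *: h).1.1 (p + 0 *: h).1.2 = slack p.
  by rewrite scale0r addr0 mulr0 addr0 mulN1r.
have s0 : 0 < sg * p.2 + sg * h.2 * 0 + -1 * G (p + 0 *: h).1.1 (p + 0 *: h).1.2.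
  by rewrite e0.
have jl := jet_scale (-1) (jet_ln s0 js).
have jj := jet_add (jet_add jl (jet_scale (-1) jX)) (jet_scale (-1) jY).
rewrite e0 in jj.
exists ((sg * h.2 - a1 0) / slack p), (a2 0 / slack p), (a3 0 / slack p), d, e.
split.
- by rewrite divr_ge0// ltW.
- rewrite normrM (ger0_norm (x := (slack p)^-1)) ?invr_ge0 ?(ltW u0)//.
  by rewrite mulrA ler_wpM2r ?invr_ge0 ?(ltW u0).
have un0 : slack p != 0 by rewrite gt_eqF.
refine (jet_eq (jet_ext _ jj) _ _ _); last 3 first.
- have D1 (f : 'I_n -> R) : \sum_i f i ^+ 1 = \sum_i f i.
    by apply: eq_bigr => i _; rewrite expr1.
  by rewrite !D1; field.
- by rewrite /D2; field.
- by field.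
have nd : \forall t \near (0 : R), barrier_dom (p + t *: h).
  by apply: near_line; apply: open_nbhs_nbhs; split=> //; exact: open_barrier_dom.
apply: filterS nd => t dt.
have e11 : (p + t *: h).1.1 = p.1.1 + t *: h.1.1 := erefl.
have e12 : (p + t *: h).1.2 = p.1.2 + t *: h.1.2 := erefl.
have e2 : (p + t *: h).2 = p.2 + t * h.2 := erefl.
rewrite (barrier_fin dt) -[fine _]/(rbarrier _) /rbarrier /slack e11 e12 e2.
set g := G (p.1.1 + t *: h.1.1) (p.1.2 + t *: h.1.2).
set l1 := ln (detr (p.1.1 + t *: h.1.1)).
set l2 := ln (detr (p.1.2 + t *: h.1.2)).
have -> : sg * p.2 + sg * h.2 * t + -1 * g = sg * (p.2 + t * h.2) - g.
  by move: p.2 h.2 => u v; ring.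
by move: (ln _) => l0; ring.
Qed.

Lemma Dk_barrier p h : barrier_dom p -> exists (a b c : R) (d e : 'I_n -> R),
  let D k := \sum_i d i ^+ k + \sum_i e i ^+ k in
  [/\ 0 <= b, `|c| <= 3 * Num.sqrt (D 2) * b &
   [/\ Dk 1 barrier p h = - a - D 1, Dk 2 barrier p h = a ^+ 2 + b + D 2 &
       Dk 3 barrier p h = c - 3 * a * b - 2 * a ^+ 3 - 2 * D 3]].
Proof.
move=> /(barrier_jet h)[a [b [c [d [e [b0 cb /jet_derive1n J]]]]]].
by exists a, b, c, d, e.
Qed.

Lemma sum_cube_le (r : R) (f : 'I_n -> R) : (forall i, `|f i| <= r) ->
  `|\sum_i f i ^+ 3| <= r * \sum_i f i ^+ 2.
Proof.
move=> fr; apply: (le_trans (ler_norm_sum _ _ _)); rewrite mulr_sumr.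
apply: ler_sum => i _; rewrite exprS normrM (ger0_norm (sqr_ge0 _)).
by rewrite ler_wpM2r ?sqr_ge0.
Qed.

(** With r the square root of D 2, the third derivative is bounded by
3 r b + 3 |a| b + 2 |a|^3 + 2 r^3. *)
Theorem self_concordant_barrier : self_concordant barrier.
Proof.
split.
- by move=> p; have [/barrier_fin ->|/barrier_out ->] := pselect (barrier_dom p).
- exact: econvex_barrier.
- by rewrite dom_barrier; exact: open_barrier_dom.
- exact: closed_epigraph_barrier.
rewrite dom_barrier; split; first exact: Ck_barrier.
move=> p h /(Dk_barrier h)[a [b [c [d [e [b0 cb [_ -> ->]]]]]]].
set D2 := \sum_i d i ^+ 2 + \sum_i e i ^+ 2.
pose r := Num.sqrt D2; have r0 : 0 <= r by exact: sqrtr_ge0.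
have D2E : D2 = r ^+ 2 by rewrite sqr_sqrtr// addr_ge0// sum_sqr_ge0.
have dr i : `|d i| <= r := norm_le_sqrt_sum d e i.
have er i : `|e i| <= r by rewrite /r /D2 addrC; exact: norm_le_sqrt_sum.
have D3 : `|\sum_i d i ^+ 3 + \sum_i e i ^+ 3| <= r ^+ 3.
  apply: (le_trans (ler_normD _ _)).
  apply: (le_trans (lerD (sum_cube_le dr) (sum_cube_le er))).
  by rewrite -mulrDr -/D2 D2E -exprS.
have := self_concordance_scalar (normr_ge0 a) b0 r0.
rewrite real_normK ?num_real// -D2E; apply: le_trans.
apply: (le_trans (ler_normB _ _)); apply: lerD; last first.
  by rewrite normrM (ger0_norm (ler0n _ _)) ler_wpM2l.
apply: (le_trans (ler_normB _ _)); apply: lerD; last first.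
  by rewrite normrM (ger0_norm (ler0n _ _)) normrX.
apply: (le_trans (ler_normB _ _)); apply: lerD; first exact: cb.
by rewrite !normrM (ger0_norm (ler0n _ _)) (ger0_norm b0).
Qed.

(** Each of the 2n + 1 logarithms contributes -2 x - x^2 <= 1, and the convexity term
b only helps. *)
Theorem barrier_has_parameter : has_parameter (2 * n + 1)%N%:R barrier.
Proof.
move=> p h; rewrite dom_barrier => /(Dk_barrier h)[a [b [c [d [e [b0 _ [-> -> _]]]]]]].
have sle (f : 'I_n -> R) : - (2 * \sum_i f i ^+ 1 + \sum_i f i ^+ 2) <= n%:R.
  rewrite -[X in _ <= X%:R]card_ord -sumr_const mulr_sumr -big_split -sumrN /=.
  by apply: ler_sum => i _; have := sqr_ge0 (f i + 1); rewrite expr1; nra.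
have := sle d; have := sle e; have := sqr_ge0 (a + 1).
rewrite natrD natrM sqrrD1.
move: (\sum_i d i ^+ 1) (\sum_i d i ^+ 2) (\sum_i e i ^+ 1) (\sum_i e i ^+ 2).
move=> *; lra.
Qed.

End AbstractBarrier.

(** * Closure of the domain of the barrier *)

Lemma continuous_pair (T A B : topologicalType) (f : T -> A) (g : T -> B) t :
  {for t, continuous f} -> {for t, continuous g} ->
  {for t, continuous (fun s => (f s, g s))}.
Proof.
move=> cf cg P [[B1 B2] [/= nB1 nB2] BP].
have h1 : \forall s \near t, B1 (f s) := cf _ nB1.
have h2 : \forall s \near t, B2 (g s) := cg _ nB2.
suff : \forall s \near t, P (f s, g s) by [].
by apply: filterS2 h1 h2 => s h1 h2; exact: (BP (f s, g s)).
Qed.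

Section BarrierClosure.
Variables (R : realType) (n : nat).
Local Notation H := (herm R n).
Local Notation E := (H * H * R)%type.
Local Notation I := (herm1 R n).
Variables (G : H -> H -> R) (sg : R).
Hypothesis sg2 : sg * sg = 1.
Hypothesis G_sublinear : pd_sublinear G.
Hypothesis G_smooth : pd_smooth G.
Implicit Types (X Y : H) (e w : R).

Definition shifted X Y e : R := G (X + e *: I) (Y + e *: I).

(** That the lower semicontinuous extension of G takes a value at most w at (X, Y).
By sublinearity, (X + e I, Y + e I) costs at most e G(I, I) more. *)
Definition closure_le X Y w := forall e, 0 < e -> shifted X Y e <= w + e * G I I.

Lemma pd_shift X e : psd X -> 0 < e -> pd (X + e *: I).
Proof. by move=> psX e0; rewrite addrC; apply: pd_psd_add => //; exact: pdZ (@pd1 R n). Qed.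

Lemma G_shift X Y e : pd X -> pd Y -> 0 < e ->
  G (X + e *: I) (Y + e *: I) <= G X Y + e * G I I.
Proof.
move=> pX pY e0; have := G_sublinear pX pY (@pd1 R n) (@pd1 R n) ler01 (ltW e0).
by rewrite addr_gt0// !scale1r mul1r => /(_ isT).
Qed.

Lemma continuous_shift (T : topologicalType) (f : T -> H) (g : T -> R) t :
  {for t, continuous f} -> {for t, continuous g} ->
  {for t, continuous (fun s => f s + g s *: I)}.
Proof.
move=> cf cg; apply: (@continuousD _ _ _ f (fun s => g s *: I)) => //.
by apply: (@continuous_comp _ _ _ g (fun s : R => s *: I)) => //; exact: scalel_continuous.
Qed.

Lemma continuous_G_comp (T : topologicalType) (f g : T -> H) t :
  {for t, continuous f} -> {for t, continuous g} -> pd (f t) -> pd (g t) ->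
  {for t, continuous (fun s => G (f s) (g s))}.
Proof.
move=> cf cg pf pg.
have cG := @continuous_G R n G G_smooth (f t, g t, 0) (conj pf pg).
apply: (@continuous_comp _ _ _ (fun s => (f s, g s, 0 : R)) (fun p : E => G p.1.1 p.1.2)) => //.
by do 2?apply: continuous_pair => //; exact: cst_continuous.
Qed.

Lemma continuous_shifted X Y e : pd (X + e *: I) -> pd (Y + e *: I) ->
  {for e, continuous (shifted X Y)}.
Proof.
move=> pX pY; apply: continuous_G_comp => //.
  by apply: continuous_shift; [exact: cst_continuous|exact: cvg_id].
by apply: continuous_shift; [exact: cst_continuous|exact: cvg_id].
Qed.

(** A limit point satisfies the shifted inequalities because the shifted pair is
positive definite, where G is continuous. Conversely, moving along
(I, I, sg (G(I, I) + 1)) enters the open domain. *)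
Lemma closure_barrier_dom :
  closure (barrier_dom G sg) =
  [set p : E | [/\ psd p.1.1, psd p.1.2 & closure_le p.1.1 p.1.2 (sg * p.2)]].
Proof.
have cX := @continuous_fst1 R n; have cY := @continuous_snd1 R n.
apply/seteqP; split => p.
  move=> cp; have psX : psd p.1.1 by apply: (closure_psd cp (cX p)) => y [[]].
  have psY : psd p.1.2 by apply: (closure_psd cp (cY p)) => y [[]].
  split; [exact: psX|exact: psY|].
  move=> e e0; rewrite -subr_ge0.
  apply: (closure_ge0 (f := fun p : E => sg * p.2 + e * G I I -
      G (p.1.1 + e *: I) (p.1.2 + e *: I)) cp).
    apply: (@continuousB _ _ _ (fun p : E => sg * p.2 + e * G I I)).
      apply: (@continuousD _ _ _ (fun p : E => sg * p.2) (cst (e * G I I))).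
        by apply: (@continuousM _ _ (cst sg) snd); [exact: cst_continuous|exact: cvg_snd].
      exact: cst_continuous.
    apply: continuous_G_comp; [| |exact: (pd_shift psX e0)|exact: (pd_shift psY e0)].
      by apply: continuous_shift; [exact: cX|exact: cst_continuous].
    by apply: continuous_shift; [exact: cY|exact: cst_continuous].
  move=> q [[pX pY] u0]; rewrite subr_ge0; apply: (le_trans (G_shift pX pY e0)).
  by rewrite lerD2r -subr_ge0 ltW.
move=> [psX psY hp] A nA.
pose c : E := (I, I, sg * (G I I + 1)).
have [d d0 [Ad _]] := near0_pos (near_line c nA).
exists (p + d *: c); split; last exact: Ad.
split; first by split; [exact: (pd_shift psX d0)|exact: (pd_shift psY d0)].
have := hp _ d0; rewrite /slack /shifted.
have -> : (p + d *: c).1.1 = p.1.1 + d *: I by [].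
have -> : (p + d *: c).1.2 = p.1.2 + d *: I by [].
have -> : (p + d *: c).2 = p.2 + d * (sg * (G I I + 1)) by [].
clear Ad; move: d d0 (G (_ + _) _) (G I I) p.2 => a a0 g g1 z h.
have -> : sg * (z + a * (sg * (g1 + 1))) = sg * z + (sg * sg) * (a * (g1 + 1)) by ring.
by rewrite sg2 mul1r; lra.
Qed.

(** The function e |-> G(X + e I, Y + e I) - e G(I, I) is nonincreasing by
sublinearity, so its limit at 0+ is its supremum. *)
Lemma shifted_limit X Y w0 : psd X -> psd Y -> closure_le X Y w0 ->
  exists2 l, shifted X Y e @[e --> 0^'+] --> l &
    forall w, closure_le X Y w <-> l <= w.
Proof.
move=> psX psY h0.
pose f e := shifted X Y e - e * G I I.
have fnincr a b : 0 < a -> a <= b -> f b <= f a.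
  move=> a0; rewrite le_eqVlt => /predU1P[->//|ab].
  rewrite /f /shifted.
  have := G_shift (pd_shift psX a0) (pd_shift psY a0) (e := b - a).
  rewrite subr_gt0 => /(_ ab).
  rewrite -!addrA -!scalerDl addrCA subrr addr0; lra.
pose A := [set f e | e in [set e | 0 < e]].
have Aub : has_sup A.
  split; first by exists (f 1), 1 => //=.
  by exists w0 => _ [e /= e0 <-]; rewrite /f lerBlDr; exact: h0.
have supP w : closure_le X Y w <-> sup A <= w.
  split=> [h|h e e0].
    apply: ge_sup; first by case: Aub.
    by move=> _ [e /= e0 <-]; rewrite /f lerBlDr; exact: h.
  rewrite -lerBlDr; apply: (le_trans _ h); apply: ub_le_sup; first by case: Aub.
  by exists e.
exists (sup A) => //.
have cf : f e @[e --> 0^'+] --> sup A.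
  apply/cvgrPdist_le => d d0.
  have [_ [e1 /= e10 <-] he1] := sup_adherent d0 Aub.
  near=> e.
  have e0 : 0 < e by near: e; exact: nbhs_right_gt.
  have ee1 : e <= e1 by near: e; exact: nbhs_right_le.
  rewrite ger0_norm ?subr_ge0; last by apply: ub_le_sup; [case: Aub|exists e].
  by have := fnincr _ _ e0 ee1; move: he1; lra.
have -> : shifted X Y = (fun e => f e + e * G I I).
  by apply/funext => e; rewrite /f subrK.
rewrite -[sup A]addr0; apply: cvgD => //.
rewrite -[X in _ --> X](mul0r (G I I)); apply: cvgMl.
apply: cvg_at_right_filter; exact: cvg_id.
Unshelve. all: by end_near. Qed.

Lemma closure_le_pd X Y w : pd X -> pd Y -> closure_le X Y w <-> G X Y <= w.
Proof.
move=> pX pY; split=> h; last first.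
  by move=> e e0; apply: (le_trans (G_shift pX pY e0)); rewrite lerD2r.
have [l cl lw] := shifted_limit (pd_psd pX) (pd_psd pY) h.
have -> : G X Y = l.
  have c0 : {for (0 : R), continuous (shifted X Y)}.
    by apply: continuous_shifted; rewrite scale0r addr0.
  have cl' : shifted X Y e @[e --> 0^'+] --> shifted X Y 0.
    by apply: cvg_at_right_filter; exact: c0.
  have := cvg_unique _ cl' cl; rewrite /shifted !scale0r !addr0; exact.
exact: (lw w).1.
Qed.

(** The shift is the same for the convex combination, so that this is sublinearity
of G at the shifted pairs. *)
Lemma closure_le_convex X1 Y1 X2 Y2 w1 w2 (a b : R) :
  psd X1 -> psd Y1 -> psd X2 -> psd Y2 -> 0 <= a -> 0 <= b -> a + b = 1 ->
  closure_le X1 Y1 w1 -> closure_le X2 Y2 w2 ->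
  closure_le (a *: X1 + b *: X2) (a *: Y1 + b *: Y2) (a * w1 + b * w2).
Proof.
move=> pX1 pY1 pX2 pY2 a0 b0 ab h1 h2 e e0.
have E0 (A B : H) : a *: A + b *: B + e *: I = a *: (A + e *: I) + b *: (B + e *: I).
  rewrite !scalerDr addrACA; congr (_ + _).
  by rewrite !scalerA -scalerDl -mulrDl ab mul1r.
have ab0 : 0 < a + b by rewrite ab.
rewrite /shifted !E0.
apply: (le_trans (G_sublinear (pd_shift pX1 e0) (pd_shift pY1 e0)
  (pd_shift pX2 e0) (pd_shift pY2 e0) a0 b0 ab0)).
apply: (le_trans (lerD (ler_wpM2l a0 (h1 e e0)) (ler_wpM2l b0 (h2 e e0)))).
by rewrite !mulrDr addrACA -[in X in _ <= _ + X](mul1r e) -ab; lra.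
Qed.

End BarrierClosure.

(** * Lower bounds on the parameter of a barrier *)

Section ScalarComparison.
Variable R : realType.
Implicit Types (f g : R -> R) (a b t : R).

Lemma increment_ge f g a b c : a <= b ->
  (forall t, a <= t <= b -> is_derive t (1 : R) f (g t)) ->
  (forall t, a <= t <= b -> c <= g t) -> c * (b - a) <= f b - f a.
Proof.
move=> ab df gc.
have [||t] := @MVT_segment R f g a b ab.
- by move=> t; rewrite in_itv/= => /andP[/ltW ta /ltW tb]; apply: df; rewrite ta.
- apply: derivable_within_continuous => t; rewrite in_itv/= => /df[//].
- by rewrite in_itv/= => /gc ct ->; rewrite ler_wpM2r// subr_ge0.
Qed.

Lemma increment_le f g a b c : a <= b ->
  (forall t, a <= t <= b -> is_derive t (1 : R) f (g t)) ->
  (forall t, a <= t <= b -> g t <= c) -> f b - f a <= c * (b - a).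
Proof.
move=> ab df gc.
have [||t] := @MVT_segment R f g a b ab.
- by move=> t; rewrite in_itv/= => /andP[/ltW ta /ltW tb]; apply: df; rewrite ta.
- apply: derivable_within_continuous => t; rewrite in_itv/= => /df[//].
- by rewrite in_itv/= => /gc ct ->; rewrite ler_wpM2r// subr_ge0.
Qed.

(** Maximize over s: the bound on all multiples of a direction yields
(Dg[h])^2 <= mu D^2 g[h]. *)
Lemma quadratic_bound (a b mu : R) : (forall s, 2 * s * a - s ^+ 2 * b <= mu) ->
  [/\ 0 <= mu, 0 <= b & a ^+ 2 <= mu * b].
Proof.
move=> h; have mu0 : 0 <= mu by have := h 0; rewrite expr0n mulr0 !mul0r subr0.
have b0 : 0 <= b.
  rewrite leNgt; apply/negP => b0.
  pose s := (2 * `|a| + mu + 1) / - b + 1.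
  have nb : 0 < - b by rewrite oppr_gt0.
  have s1 : 1 <= s by rewrite /s lerDr divr_ge0 ?(ltW nb)// !addr_ge0 ?mulr_ge0.
  have sb : 2 * `|a| + mu + 1 <= s * - b.
    have E : (2 * `|a| + mu + 1) / - b * - b = 2 * `|a| + mu + 1.
      by rewrite (divfK (lt0r_neq0 nb)).
    by rewrite /s [leRHS]mulrDl E mul1r lerDl ltW.
  have := h s; have := ler_norm (- a); rewrite normrN; have := normr_ge0 a.
  rewrite expr2; nra.
split=> //; have [bz|bn] := eqVneq b 0.
  have a0 : a = 0.
    apply/eqP; apply: contraT => an0.
    have := h ((mu + 1) / (2 * a)); rewrite bz mulr0 subr0.
    have -> : 2 * ((mu + 1) / (2 * a)) * a = mu + 1.
      by field.
    by rewrite -subr_ge0; lra.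
  by rewrite a0 bz expr0n mulr0.
have bp : 0 < b by rewrite lt_def bn.
have := h (a / b).
have -> : 2 * (a / b) * a - (a / b) ^+ 2 * b = a ^+ 2 / b by field.
by rewrite ler_pdivrMr.
Qed.

(** If f' >= f^2 / mu and f 0 > mu > 0, then 1/f decreases at speed at least 1/mu
and becomes negative before time 1. *)
Lemma riccati_upper (f g : R -> R) (mu : R) : 0 <= mu ->
  (forall t, 0 <= t <= 1 -> is_derive t (1 : R) f (g t)) ->
  (forall t, 0 <= t <= 1 -> 0 <= g t) ->
  (forall t, 0 <= t <= 1 -> f t ^+ 2 <= mu * g t) -> f 0 <= mu.
Proof.
move=> mu0 df g0 fg; rewrite leNgt; apply/negP => f0.
have fp : 0 < f 0 by exact: le_lt_trans f0.
have ft t : 0 <= t <= 1 -> f 0 <= f t.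
  move=> /andP[t0 t1]; rewrite -subr_ge0.
  have := @increment_ge f g 0 t 0 t0; rewrite mul0r; apply.
  - by move=> s /andP[s0 st]; apply: df; rewrite s0 (le_trans st).
  - by move=> s /andP[s0 st]; apply: g0; rewrite s0 (le_trans st).
have ftp t : 0 <= t <= 1 -> 0 < f t by move=> /ft; exact: lt_le_trans.
have mup : 0 < mu.
  rewrite lt_def mu0 andbT; apply/eqP => mz.
  have := fg 0; rewrite lexx ler01 mz mul0r => /(_ isT).
  by rewrite leNgt exprn_gt0.
have := @increment_le (fun t => (f t)^-1) (fun t => - g t * ((f t)^-1 * (f t)^-1))
  0 1 (- mu^-1) ler01.
rewrite subr0 mulr1 => H.
have : (f 1)^-1 - (f 0)^-1 <= - mu^-1.
  apply: H => t t01; have ftp' := ftp t t01.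
    by apply: is_derive_inv; [rewrite gt_eqF|exact: df].
  rewrite mulNr lerN2 -invfM -expr2 ler_pdivlMr ?exprn_gt0//.
  by rewrite mulrC ler_pdivrMr// mulrC fg.
have : 0 < (f 1)^-1 by rewrite invr_gt0 ftp// ler01 lexx.
have : (f 0)^-1 < mu^-1 by rewrite ltf_pV2.
lra.
Qed.

(** Along the half-line, 1 / sqrt f2 grows at speed at most 1, so that f2 t is at least
(1 / sqrt (f2 0) + t)^-2, whose integral is sqrt (f2 0); f1 could not stay
nonpositive if sqrt (f2 0) exceeded - f1 0. Adding e to f2 avoids dividing by 0. *)
Lemma self_concordant_recession (f1 f2 f3 : R -> R) :
  (forall t, 0 <= t -> is_derive t (1 : R) f1 (f2 t)) ->
  (forall t, 0 <= t -> is_derive t (1 : R) f2 (f3 t)) ->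
  (forall t, 0 <= t -> f1 t <= 0) -> (forall t, 0 <= t -> 0 <= f2 t) ->
  (forall t, 0 <= t -> `|f3 t| <= 2 * Num.sqrt (f2 t) ^+ 3) ->
  f2 0 <= f1 0 ^+ 2.
Proof.
move=> d1 d2 f1n f2p f3b.
suff H : Num.sqrt (f2 0) <= - f1 0.
  rewrite -[leLHS](sqr_sqrtr (f2p 0 (lexx 0))) -[f1 0]opprK sqrrN.
  by rewrite ler_pXn2r// nnegrE ?sqrtr_ge0// oppr_ge0 f1n.
apply/ler_addgt0Pr => d d0.
pose T := 2 / d; have T0 : 0 < T by rewrite divr_gt0.
pose e := T^-1 ^+ 2; have e0 : 0 < e by rewrite exprn_gt0// invr_gt0.
(* over a time T = 2/d both error terms e T and 1/T amount to d/2 *)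
pose s t := Num.sqrt (f2 t + e).
have q0 t : 0 <= t -> 0 < f2 t + e by move=> /f2p h; rewrite ltr_wpDl.
have s0 t : 0 <= t -> 0 < s t by move=> /q0; rewrite sqrtr_gt0.
have ss t : 0 <= t -> s t ^+ 2 = f2 t + e by move=> /q0/ltW; exact: sqr_sqrtr.
pose k0 := (s 0)^-1; have k00 : 0 < k0 by rewrite invr_gt0 s0.
have ds t : 0 <= t -> is_derive t (1 : R) s (f3 t / (2 * s t)).
  move=> t0; have h := is_derive_add (d2 t t0) (is_derive_cst e t (1 : R)).
  have h2 := is_derive1_sqrt (q0 t t0).
  have := is_derive1_comp (g := fun t => f2 t + e) h2 h.
  by move=> h3; apply: is_derive_eq h3 _; rewrite addr0 mulrC.
have ks t : 0 <= t -> (s t)^-1 <= k0 + t.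
  move=> t0; rewrite -lerBlDl -[X in _ <= X]subr0 -[X in _ <= X]mul1r.
  apply: (@increment_le (fun t => (s t)^-1)
    (fun t => - (f3 t / (2 * s t)) * ((s t)^-1 * (s t)^-1))) => // u /andP[u0 ut].
    by apply: is_derive_inv; [rewrite gt_eqF// s0|exact: ds].
  have su := s0 u u0; have sn : s u != 0 by rewrite gt_eqF.
  have -> : - (f3 u / (2 * s u)) * ((s u)^-1 * (s u)^-1) = - f3 u / (2 * s u ^+ 3).
    by field.
  rewrite ler_pdivrMr ?mulr_gt0 ?exprn_gt0// mul1r.
  apply: (le_trans (ler_norm _)); rewrite normrN; apply: (le_trans (f3b u u0)).
  rewrite ler_wpM2l// ler_pXn2r ?nnegrE ?sqrtr_ge0// ler_wsqrtr// lerDl.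
  exact: ltW.
pose F t := f1 t + ((k0 + t)^-1 + e * t).
have kt t : 0 <= t -> 0 < k0 + t by move=> t0; rewrite ltr_pwDl.
have : 0 * (T - 0) <= F T - F 0.
  apply: (@increment_ge F (fun t => f2 t + (- 1 * ((k0 + t)^-1 * (k0 + t)^-1) + e))).
  - exact: ltW.
  - move=> t /andP[t0 _]; apply: is_derive_add; first exact: d1.
    apply: is_derive_add.
      apply: (@is_derive_inv _ _ (fun t => k0 + t)); first by rewrite gt_eqF// kt.
      apply: is_derive_eq (is_derive_add (is_derive_cst k0 t (1 : R)) (is_derive_id t (1 : R))) _.
      by rewrite add0r.
    apply: is_derive_eq (is_derive_scale e (is_derive_id t (1 : R))) _.
    by rewrite mulr1.
  - move=> t /andP[t0 _]; rewrite mulN1r addrCA addrC subr_ge0 -ss// -expr2 exprVn.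
    rewrite -[s t]invrK exprVn lef_pV2 ?posrE ?exprn_gt0 ?kt ?invr_gt0 ?s0//.
    by rewrite ler_pXn2r ?nnegrE ?ks// ltW ?kt ?invr_gt0 ?s0.
rewrite mul0r subr_ge0 /F mulr0 !addr0 => H.
have k0E : k0^-1 = s 0 by rewrite invrK.
have s00 : Num.sqrt (f2 0) <= s 0 by rewrite ler_wsqrtr// lerDl ltW.
have eT : e * T = T^-1 by rewrite /e expr2 -mulrA mulVf ?mulr1// gt_eqF.
have kT : (k0 + T)^-1 <= T^-1 by rewrite lef_pV2 ?posrE ?kt ?(ltW T0)// lerDr (ltW k00).
have TE : T^-1 + T^-1 = d by rewrite /T; field; rewrite gt_eqF.
have := f1n T (ltW T0); move: H; rewrite k0E eT; lra.
Qed.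

(** Comparison with the solution of y' = y^2, which explodes at time 1 / y(0). *)
Lemma riccati_blowup (f g : R -> R) (b : R) : 0 <= f 0 -> 0 < b -> f 0 < b^-1 ->
  exists2 M, 0 <= M & forall t, 0 <= t <= b ->
    (forall u, 0 <= u <= t -> [/\ is_derive u (1 : R) f (g u), 0 <= f u & g u <= f u ^+ 2]) ->
    f t <= M.
Proof.
move=> f0 b0 fb.
pose e := (b^-1 - f 0) / 2; have e0 : 0 < e by rewrite divr_gt0// subr_gt0.
have fe : 0 < f 0 + e by rewrite ltr_wpDl.
have feb : f 0 + e < b^-1 by rewrite /e; move: fb; lra.
pose d := (f 0 + e)^-1 - b.
have d0 : 0 < d.
  by rewrite subr_gt0 -[b]invrK ltf_pV2 ?posrE ?invr_gt0.
exists d^-1; first by rewrite invr_ge0 ltW.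
move=> t /andP[t0 tb] h.
have fue u : 0 <= u <= t -> 0 < f u + e by move=> /h[_ fu _]; rewrite ltr_wpDl.
have H : (-1) * (t - 0) <= (f t + e)^-1 - (f 0 + e)^-1.
  apply: (@increment_ge (fun t => (f t + e)^-1)
    (fun t => - (g t + 0) * ((f t + e)^-1 * (f t + e)^-1))) => // u hu.
    apply: is_derive_inv; first by rewrite gt_eqF// fue.
    have [du _ _] := h u hu.
    exact: (is_derive_add du (is_derive_cst e u (1 : R))).
  have [_ fu gu] := h u hu; have fp := fue u hu.
  rewrite addr0 mulNr lerN2 -invfM -expr2 ler_pdivrMr ?exprn_gt0// mul1r.
  by apply: (le_trans gu); rewrite ler_pXn2r ?nnegrE ?(ltW fp)// lerDl ltW.
have tt : 0 <= t <= t by rewrite t0 lexx.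
have ft := fue t tt.
have : d <= (f t + e)^-1 by rewrite /d; move: H tb; lra.
move=> dle; have : f t + e <= d^-1.
  by rewrite -[f t + e]invrK lef_pV2 ?posrE ?invr_gt0.
by apply: le_trans; rewrite lerDl ltW.
Qed.

Lemma jet_dilate f (s a1 a2 a3 : R) : jet f a1 a2 a3 ->
  jet (fun t => f (s * t)) (s * a1) (s ^+ 2 * a2) (s ^+ 3 * a3).
Proof.
move=> [f1 [f2 [d1 d2 d3 <- <-]]].
have ds h h' (t : R) : is_derive (s * t) (1 : R) h (h' (s * t)) ->
    is_derive t (1 : R) (fun t => h (s * t)) (s * h' (s * t)).
  move=> dh.
  have hs : is_derive t (1 : R) (fun t => s * t) s.
    by apply: is_derive_eq (is_derive_scale s (is_derive_id t (1 : R))) _; rewrite mulr1.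
  apply: is_derive_eq (is_derive1_comp (g := fun t => s * t) dh hs) _.
  by rewrite mulrC.
have nb (P : R -> Prop) : (\forall t \near (0 : R), P t) ->
    \forall t \near (0 : R), P (s * t).
  move=> nP; have c0 : {for (0 : R), continuous (fun t : R => s * t)}.
    by apply: (@continuousM _ _ (cst s) id); [exact: cst_continuous|exact: cvg_id].
  by apply: (c0 P); rewrite mulr0.
exists (fun t => s * f1 (s * t)), (fun t => s ^+ 2 * f2 (s * t)); split.
- by apply: filterS (nb _ d1) => t; exact: ds.
- apply: filterS (nb _ d2) => t h.
  by apply: is_derive_eq (is_derive_scale s (ds _ _ _ h)) _; rewrite mulrA -expr2.
- have h : is_derive (s * 0) (1 : R) f2 ((fun=> a3) (s * 0)) by rewrite mulr0.
  by apply: is_derive_eq (is_derive_scale (s ^+ 2) (ds _ _ _ h)) _; rewrite mulrA -exprSr.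
- by rewrite mulr0.
- by rewrite mulr0.
Qed.

(** Fermat's rule, for a function only known near 0. *)
Lemma critical_min f f1 : (\forall t \near (0 : R), f 0 <= f t) ->
  (\forall t \near (0 : R), is_derive t (1 : R) f (f1 t)) -> f1 0 = 0.
Proof.
move=> fm df; have [d /= d0 hd] := filterI fm df.
have hd' t : t \in `]-d, d[ -> f 0 <= f t /\ is_derive t (1 : R) f (f1 t).
  by rewrite in_itv/= => td; apply: hd; rewrite /= sub0r normrN ltr_norml.
have d0' : (0 : R) \in `]-d, d[ by rewrite in_itv/= oppr_lt0 d0.
have [_ E] : is_derive (0 : R) (1 : R) f 0.
  apply: (@derive1_at_min _ f (-d) d) => //.
  - by rewrite ge0_cp// ltW.
  - by move=> t /hd'[_ []].
  - by move=> t /hd'[].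
by have [_ [_ <-]] := hd' _ d0'.
Qed.

End ScalarComparison.

Section ParameterLowerBound.
Variables (R : realType) (E : normedModType R) (g : E -> \bar R) (mu : R).
Hypothesis sc : self_concordant g.
Hypothesis par : has_parameter mu g.
Implicit Types (x y h p : E).

Local Notation V := (dom g).
Local Notation phi := (fine \o g).

Lemma sc_open : open V. Proof. by case: sc. Qed.

Lemma sc_fin x : V x -> g x = (phi x)%:E.
Proof.
case: sc => /(_ x) gx _ _ _ _; rewrite /dom /= => gy.
by rewrite fineK// fin_numE gx lt_eqF.
Qed.

Lemma sc_convex x y (t : R) : V x -> V y -> 0 <= t <= 1 ->
  V (t *: x + (1 - t) *: y) /\
  phi (t *: x + (1 - t) *: y) <= t * phi x + (1 - t) * phi y.
Proof.
move=> Vx Vy t01; case: sc => gN /(_ x y t t01) cv _ _ _.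
rewrite (sc_fin Vx) (sc_fin Vy) -!EFinM -EFinD in cv.
have Vz : V (t *: x + (1 - t) *: y) by rewrite /dom /=; apply: (le_lt_trans cv); exact: ltry.
by split=> //; move: cv; rewrite (sc_fin Vz) lee_fin.
Qed.

Lemma sc_near x h : V x -> \forall t \near (0 : R), V (x + t *: h).
Proof.
by move=> Vx; apply: near_line; apply: open_nbhs_nbhs; split=> //; exact: sc_open.
Qed.

Definition d1 h := 'D_h phi.
Definition d2 h := 'D_h (d1 h).
Definition d3 h := 'D_h (d2 h).

Lemma sc_derive h x : V x ->
  [/\ is_derive x h phi (d1 h x), is_derive x h (d1 h) (d2 h x) &
      is_derive x h (d2 h) (d3 h x)].
Proof.
move=> Vx; case: sc => _ _ _ _ [[_ /(_ h)[e1 [_ /(_ h)[e2 [_ /(_ h)[e3 _]]]]]] _].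
by split; apply: derivableP; [exact: e1|exact: e2|exact: e3].
Qed.

Lemma sc_jet h x : V x ->
  jet (fun t => phi (x + t *: h)) (d1 h x) (d2 h x) (d3 h x).
Proof.
move=> Vx; have nV := sc_near h Vx.
exists (fun t => d1 h (x + t *: h)), (fun t => d2 h (x + t *: h)).
split.
- by apply: filterS nV => t /(sc_derive h)[e _ _]; exact: (is_derive_along e).
- by apply: filterS nV => t /(sc_derive h)[_ e _]; exact: (is_derive_along e).
- by have [_ _ e] := sc_derive h Vx; apply/(is_derive_line0 (d2 h)).
- by rewrite scale0r addr0.
- by rewrite scale0r addr0.
Qed.

Lemma sc_jetZ h x (s : R) : V x -> jet (fun t => phi (x + t *: (s *: h)))
  (s * d1 h x) (s ^+ 2 * d2 h x) (s ^+ 3 * d3 h x).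
Proof.
move=> Vx; apply: jet_ext (jet_dilate s (sc_jet h Vx)).
by apply: filterE => t; rewrite scalerA mulrC.
Qed.

Lemma d1Z x h (s : R) : V x -> d1 (s *: h) x = s * d1 h x.
Proof. by move=> Vx; have [-> _ _] := jet_unique (sc_jet (s *: h) Vx) (sc_jetZ h s Vx). Qed.

Lemma sc_bounds h x : V x ->
  [/\ 0 <= mu, 0 <= d2 h x, d1 h x ^+ 2 <= mu * d2 h x &
      `|d3 h x| <= 2 * Num.sqrt (d2 h x) ^+ 3].
Proof.
move=> Vx; have [k1 k2 k3] := jet_derive1n (sc_jet h Vx).
have [m0 b0 ab] : [/\ 0 <= mu, 0 <= d2 h x & d1 h x ^+ 2 <= mu * d2 h x].
  apply: quadratic_bound => s.
  have [e1 e2 _] := jet_derive1n (sc_jetZ h s Vx).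
  by have := par (s *: h) Vx; rewrite /Dk e1 e2 mulrA.
split; [exact: m0|exact: b0|exact: ab|].
case: sc => _ _ _ _ [_ /(_ x h Vx)].
by rewrite /Dk k3 k2 powR_three_halves.
Qed.

Lemma sc_segment x y (t : R) : V x -> V y -> 0 <= t <= 1 -> V (x + t *: (y - x)).
Proof.
move=> Vx Vy t01; have [Vz _] := sc_convex Vy Vx t01.
by rewrite scalerBr addrCA -[x + - _]/(x - _) -[X in _ + (X - _)]scale1r -scalerBl.
Qed.

(** The derivative along the segment satisfies the Riccati inequality and exists up
to time 1, so it starts at mu at most. *)
Lemma derivative_le_parameter x y : V x -> V y -> d1 (y - x) x <= mu.
Proof.
move=> Vx Vy; set h := y - x.
have Vt t : 0 <= t <= 1 -> V (x + t *: h) by move=> t01; exact: sc_segment.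
have [mu0 _ _ _] := sc_bounds h Vx.
have := @riccati_upper R (fun t => d1 h (x + t *: h)) (fun t => d2 h (x + t *: h)) mu mu0.
rewrite scale0r addr0; apply=> t /Vt Vxt.
- by have [_ e _] := sc_derive h Vxt; exact: (is_derive_along e).
- by have [_ e _ _] := sc_bounds h Vxt; exact: e.
- by have [_ _ e _] := sc_bounds h Vxt; exact: e.
Qed.

Definition recession p := forall x (t : R), V x -> 0 <= t -> V (x + t *: p).

(** Otherwise a far enough point of the half-line contradicts the bound by mu. *)
Lemma recession_derivative_le0 p x : recession p -> V x -> d1 p x <= 0.
Proof.
move=> rp Vx; have [mu0 _ _ _] := sc_bounds p Vx.
rewrite leNgt; apply/negP => a0.
pose t := (mu + 1) / d1 p x.
have t0 : 0 <= t by rewrite divr_ge0 ?addr_ge0// ltW.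
have := derivative_le_parameter Vx (rp x t Vx t0).
have -> : x + t *: p - x = t *: p by rewrite addrAC subrr add0r.
by rewrite d1Z// /t divfK ?gt_eqF//; lra.
Qed.

Lemma recession_second_le p x : recession p -> V x -> d2 p x <= d1 p x ^+ 2.
Proof.
move=> rp Vx; have Vt t : 0 <= t -> V (x + t *: p) by exact: rp.
have := @self_concordant_recession R (fun t => d1 p (x + t *: p))
  (fun t => d2 p (x + t *: p)) (fun t => d3 p (x + t *: p)).
rewrite scale0r addr0; apply=> t /Vt Vxt.
- by have [_ e _] := sc_derive p Vxt; exact: (is_derive_along e).
- by have [_ _ e] := sc_derive p Vxt; exact: (is_derive_along e).
- exact: recession_derivative_le0.
- by have [_ e _ _] := sc_bounds p Vxt; exact: e.
- by have [_ _ _ e] := sc_bounds p Vxt; exact: e.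
Qed.

(** Backwards along p, f = - Dg[p] satisfies f' <= f^2. If f 0 < 1/b, it stays bounded up
to time b, and so does g; as the epigraph is closed, the domain cannot be
left before time b. *)
Lemma recession_derivative_ge p x b : recession p -> V x -> 0 < b ->
  ~ V (x - b *: p) -> b^-1 <= - d1 p x.
Proof.
move=> rp Vx b0 nV; rewrite leNgt; apply/negP => fb.
pose ln_ t := x + t *: (- p).
have lnE t : ln_ t = x - t *: p by rewrite /ln_ scalerN.
pose f t := - d1 p (ln_ t).
have dline (k : E -> R) k' t : is_derive (ln_ t) p k k' ->
    is_derive t (1 : R) (fun t => k (ln_ t)) (- k').
  move=> dk; have := is_derive_line k (ln_ t) p 0 k'.
  rewrite scale0r addr0 => -[/(_ dk) h _].
  have hm : is_derive t (1 : R) (fun s => t - s) (-1).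
    have := is_derive_add (is_derive_cst t t (1 : R)) (is_deriveN (is_derive_id t (1 : R))).
    by rewrite add0r.
  have h' : is_derive (t - t) (1 : R) (fun s => k (ln_ t + s *: p)) k' by rewrite subrr.
  have := is_derive1_comp (g := fun s => t - s) h' hm.
  rewrite mulrN1; congr (is_derive _ _ _ _); apply/funext => s /=.
  by rewrite /ln_ !scalerN -addrA -scaleNr -scalerDl; congr (k (x + _)); rewrite -scaleNr; congr (_ *: _); ring.
have f00 : 0 <= f 0 by rewrite /f /ln_ scale0r addr0 oppr_ge0; exact: recession_derivative_le0.
have fb' : f 0 < b^-1 by rewrite /f /ln_ scale0r addr0.
have [M M0 hM] := riccati_blowup (fun t => d2 p (ln_ t)) f00 b0 fb'.
have down t u : V (ln_ t) -> u <= t -> V (ln_ u).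
  move=> Vt ut; have := rp _ (t - u) Vt; rewrite subr_ge0 => /(_ ut).
  by rewrite /ln_ !scalerN -!scaleNr -addrA -scalerDl; congr (V (x + _ *: _)); ring.
have dphi t : V (ln_ t) -> is_derive t (1 : R) (fun t => phi (ln_ t)) (f t).
  by move=> Vt; apply: dline; case: (sc_derive p Vt).
have bound t : 0 <= t <= b -> V (ln_ t) -> phi (ln_ t) <= phi x + M * b.
  move=> /andP[t0 tb] Vt.
  have : phi (ln_ t) - phi (ln_ 0) <= M * (t - 0).
    apply: (@increment_le _ (fun t => phi (ln_ t)) f) => // u /andP[u0 ut].
      by apply: dphi; exact: down ut.
    apply: hM; first by rewrite u0 (le_trans ut).
    move=> v /andP[v0 vu]; have Vv : V (ln_ v) by apply: (down t) => //; exact: le_trans ut.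
    split.
    - rewrite /f -[d2 p _]opprK; apply: is_deriveN; apply: dline.
      by case: (sc_derive p Vv).
    - by rewrite /f oppr_ge0; exact: recession_derivative_le0.
    - by rewrite /f sqrrN; exact: recession_second_le.
  rewrite subr0 {2}/ln_ scale0r addr0 lerBlDl => /le_trans; apply.
  by rewrite lerD2l ler_wpM2l.
have cln : continuous ln_.
  move=> t; apply: (@continuousD _ _ _ (cst x) (fun t : R => t *: (- p))).
    exact: cst_continuous.
  exact: scalel_continuous.
pose A := [set t | 0 <= t <= b /\ V (ln_ t)].
have A0 : A 0 by split; [rewrite lexx ltW|rewrite /ln_ scale0r addr0].
have sA : has_sup A by split; [exists 0|exists b => t [/andP[]]].
pose T := sup A.
have T0 : 0 <= T by apply: ub_le_sup => //; case: sA.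
have Tb : T <= b by apply: ge_sup; [exists 0|move=> t [/andP[]]].
have belowT t : 0 <= t -> t < T -> V (ln_ t).
  move=> t0 tT; have [u [_ Vu] tu] := sup_gt sA.1 tT.
  by apply: down Vu _; exact: ltW.
have VT : V (ln_ T).
  case: sc => _ _ _ cl _.
  have : (g (ln_ T) <= (phi x + M * b)%:E)%E.
    apply: (cl (ln_ T, phi x + M * b)) => B [[B1 B2] [/= nB1 nB2] BB].
    have nT : \forall t \near T, B1 (ln_ t) by exact: (cln T _ nB1).
    have [d /= d0 hd] := nT.
    have [T00|Tp] := leP T 0.
      have TE : T = 0 by apply/eqP; rewrite eq_le T00.
      exists (x, phi x + M * b); split=> /=.
        by rewrite (sc_fin Vx) lee_fin lerDl mulr_ge0// ltW.
      apply: BB; split => /=; last exact: nbhs_singleton.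
      by have := nbhs_singleton nB1; rewrite TE /ln_ scale0r addr0.
    pose t := Num.max 0 (T - d / 2).
    have d2 : 0 < d / 2 by rewrite divr_gt0.
    have t0 : 0 <= t by rewrite le_max lexx.
    have tT : t < T by rewrite gt_max Tp ltrBlDr ltrDl.
    have Vt := belowT t t0 tT.
    exists (ln_ t, phi x + M * b); split=> /=.
      by rewrite (sc_fin Vt) lee_fin bound// t0 (le_trans (ltW tT)).
    apply: BB; split => /=; last exact: nbhs_singleton.
    apply: hd; rewrite /= gtr0_norm ?subr_gt0//.
    have : T - d / 2 <= t by rewrite le_max lexx orbT.
    have : d / 2 < d by rewrite ltr_pdivrMr// ltr_pMr// ltr1n.
    lra.
  by move=> h; rewrite /dom /=; apply: (le_lt_trans h); exact: ltry.
have TE : T = b.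
  apply/eqP; rewrite eq_le Tb /= leNgt; apply/negP => Tlt.
  have nT : \forall t \near T, V (ln_ t).
    by apply: (cln T V); apply: open_nbhs_nbhs; split=> //; exact: sc_open.
  have [d /= d0 hd] := nT.
  pose t := Num.min b (T + d / 2).
  have d2 : 0 < d / 2 by rewrite divr_gt0.
  have Tt : T < t by rewrite lt_min Tlt ltrDl.
  have At : A t.
    split; first by rewrite (le_trans T0 (ltW Tt)) ge_min lexx.
    apply: hd; rewrite /= ltr0_norm ?subr_lt0// opprB.
    have : t <= T + d / 2 by rewrite ge_min lexx orbT.
    have : d / 2 < d by rewrite ltr_pdivrMr// ltr_pMr// ltr1n.
    lra.
  by have := ub_le_sup sA.2 At; rewrite -/T leNgt Tt.
by apply: nV; rewrite -lnE -TE.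
Qed.

(** By convexity, the average of the increments along 2 h and 2 k minus the
increment along h + k has a minimum at 0. This gives additivity of the
derivative without any appeal to Frechet differentiability. *)
Lemma d1D x h k : V x -> d1 (h + k) x = d1 h x + d1 k x.
Proof.
move=> Vx.
have j1 := jet_scale (2^-1) (jet_dilate 2 (sc_jet h Vx)).
have j2 := jet_scale (2^-1) (jet_dilate 2 (sc_jet k Vx)).
have j3 := jet_scale (-1) (sc_jet (h + k) Vx).
have [f1 [f2 [df _ _ e _]]] := jet_add (jet_add j1 j2) j3.
have : f1 0 = 0.
  apply: critical_min df.
  have n1 := sc_near (2 *: h) Vx; have n2 := sc_near (2 *: k) Vx.
  apply: filterS2 n1 n2 => t V1 V2.
  rewrite mulr0 !scale0r !addr0 mulN1r.
  have -> : 2^-1 * phi x + 2^-1 * phi x - phi x = 0 by field.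
  have h01 : 0 <= (2^-1 : R) <= 1 by rewrite invr_ge0 ler0n invf_le1// ler1n.
  have [_] := sc_convex V1 V2 h01.
  have -> : 2^-1 *: (x + t *: (2 *: h)) + (1 - 2^-1) *: (x + t *: (2 *: k)) =
      x + t *: (h + k).
    have -> : 1 - 2^-1 = 2^-1 :> R by field.
    have tE : 2^-1 * (t * 2) = t by field.
    rewrite !scalerDr addrACA -scalerDl !scalerA tE.
    have -> : 2^-1 + 2^-1 = 1 :> R by field.
    by rewrite scale1r.
  have -> : 1 - 2^-1 = 2^-1 :> R by field.
  rewrite !scalerA !(mulrC t) mulN1r subr_ge0.
  by [].
rewrite e => /eqP; rewrite mulN1r subr_eq0 => /eqP <-.
by rewrite !mulrA mulVf ?pnatr_eq0// !mul1r.
Qed.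

Lemma d1_sum (I : eqType) (s : seq I) (F : I -> E) x : V x ->
  d1 (\sum_(i <- s) F i) x = \sum_(i <- s) d1 (F i) x.
Proof.
move=> Vx; elim: s => [|i s IH].
  by rewrite !big_nil -(scale0r (0 : E)) d1Z// mul0r.
by rewrite !big_cons d1D// IH.
Qed.

End ParameterLowerBound.

(** A barrier is given through the closure of its domain only; this recovers the
domain itself. Any w in W lies strictly between a point v0 of V and a point of W,
which can be approximated from V. *)
Lemma open_convex_subset_closure (R : realType) (E : normedModType R) (V W : set E) v0 :
  open V -> open W -> V v0 ->
  (forall x y (t : R), V x -> V y -> 0 <= t <= 1 -> V (t *: x + (1 - t) *: y)) ->
  W `<=` closure V -> W `<=` V.
Proof.
move=> oV oW Vv0 cV WV w Ww.
have nW : nbhs w W by exact: open_nbhs_nbhs.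
have [t t0 [Ww' _]] := near0_pos (near_line (w - v0) nW).
set w' := w + t *: (w - v0) in Ww'.
(* the point of V that completes v1 to a segment through w *)
pose v2 (v1 : E) := v0 + t^-1 *: (w' - v1).
have cv2 : {for w', continuous v2}.
  apply: (@continuousD _ _ _ (cst v0) (fun v1 => t^-1 *: (w' - v1))).
    exact: cst_continuous.
  apply: (@continuous_comp _ _ _ (fun v1 => w' - v1) (fun y => t^-1 *: y)).
    apply: (@continuousB _ _ _ (cst w') id); first exact: cst_continuous.
    exact: cvg_id.
  exact: scaler_continuous.
have nv : \forall v1 \near w', V (v2 v1).
  apply: (cv2 V); rewrite /v2 subrr scaler0 addr0; exact: open_nbhs_nbhs.
have [v1 [Vv1 Vv2]] := WV _ Ww' _ nv.
have t1 : 0 < 1 + t by rewrite addr_gt0.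
have h01 : 0 <= (1 + t)^-1 <= 1.
  by rewrite invr_ge0 (ltW t1) invf_le1// lerDl ltW.
have := cV _ _ _ Vv1 Vv2 h01; congr V.
have -> : 1 - (1 + t)^-1 = (1 + t)^-1 * t by field; rewrite gt_eqF.
rewrite -scalerA -scalerDr /v2 [t *: (_ + _)]scalerDr [t *: (_ *: _)]scalerA divff ?gt_eqF// scale1r.
rewrite addrCA [v1 + _]addrC subrK /w' addrCA -scalerDr [v0 + _]addrC subrK.
by rewrite -{1}[w]scale1r -scalerDl scalerA mulVf ?gt_eqF// scale1r.
Qed.

(** * Optimality of the parameter 2n + 1 *)

Section DiagonalMatrices.
Local Open Scope complex_scope.
Variables (R : realType) (n : nat).
Local Notation C := R[i].
Implicit Types (d e : 'I_n -> R).

(** Diagonal matrices suffice for the lower bound on the parameter. *)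
Definition hdiag d : herm R n := Herm (hermP (ctmx_cong 1%:M d)).

Lemma hdiagD d e : hdiag d + hdiag e = hdiag (fun i => d i + e i).
Proof. by apply/val_inj; rewrite /= congD. Qed.

Lemma hdiagZ (a : R) d : a *: hdiag d = hdiag (fun i => a * d i).
Proof. by apply/val_inj; rewrite /= congZ. Qed.

Lemma eq_hdiag d e : d =1 e -> hdiag d = hdiag e.
Proof. by move=> /funext ->. Qed.

Lemma herm1E : herm1 R n = hdiag (fun=> 1).
Proof. by apply/val_inj; rewrite /= cong1 trmx1 map_mx1 mulmx1. Qed.

Lemma hdiag0 : hdiag (fun=> 0) = 0.
Proof.
rewrite -(scale0r (hdiag (fun=> 0))) hdiagZ.
by apply: eq_hdiag => i; rewrite mul0r.
Qed.

Lemma pd_hdiag d : pd (hdiag d) <-> forall i, 0 < d i.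
Proof. exact: (pd_cong (unitmx1 _ _)). Qed.

Lemma qf_hdiag d v : qf (hdiag d) v = \sum_i d i * sqn (v i 0).
Proof. by rewrite qf_cong mul1mx. Qed.

Lemma trr_hdiag d : trr (hdiag d) = \sum_i d i.
Proof.
rewrite /trr trace_cong; apply: eq_bigr => i _.
rewrite (bigD1 i)//= big1 => [|j /negbTE ji].
  by rewrite mxE eqxx sqnR expr1n mulr1 addr0.
by rewrite mxE eq_sym ji sqnR expr0n mulr0.
Qed.

Lemma sum_hdiag (I : eqType) (s : seq I) (D : I -> 'I_n -> R) :
  \sum_(k <- s) hdiag (D k) = hdiag (fun i => \sum_(k <- s) D k i).
Proof.
elim: s => [|k s IH].
  by rewrite big_nil -hdiag0; apply: eq_hdiag => i; rewrite big_nil.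
by rewrite big_cons IH hdiagD; apply: eq_hdiag => i; rewrite big_cons.
Qed.

Definition ddelta (k : 'I_n) : 'I_n -> R := fun i => (i == k)%:R.

Lemma sum_ddelta i : \sum_k ddelta k i = 1.
Proof.
rewrite (bigD1 i)//= /ddelta eqxx big1 ?addr0// => k ki.
by rewrite eq_sym (negbTE ki).
Qed.

Lemma sum_ddelta_tr k : \sum_i ddelta k i = 1.
Proof.
rewrite (bigD1 k)//= /ddelta eqxx big1 ?addr0// => i ik.
by rewrite (negbTE ik).
Qed.

End DiagonalMatrices.

Section OptimalParameter.
Variables (R : realType) (n : nat).
Local Notation H := (herm R n).
Local Notation E := (H * H * R)%type.
Variables (G : H -> H -> R) (sg : R) (sw : bool).
Hypothesis sg2 : sg * sg = 1.
Hypothesis G_sublinear : pd_sublinear G.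
Hypothesis G_smooth : pd_smooth G.

(** Arranges that the first argument of Gsw is the one whose trace bounds the value;
it is the second argument of G when alpha < 0. *)
Definition swapped (X Y : H) : H * H := if sw then (Y, X) else (X, Y).
Lemma swapped_both (P : H -> Prop) X Y : P X -> P Y ->
  P (swapped X Y).1 /\ P (swapped X Y).2.
Proof.
move=> pX pY; rewrite /swapped.
by case: sw; split; [exact: pY|exact: pX|exact: pX|exact: pY].
Qed.

Definition Gsw X Y := G (swapped X Y).1 (swapped X Y).2.

Hypothesis G_le_trace : forall X Y, pd X -> pd Y ->
  (forall v, qf X v <= qf Y v) -> Gsw X Y <= trr X.

Local Notation W := (barrier_dom G sg).

Definition dpoint (a b : 'I_n -> R) (z : R) : E :=
  (swapped (hdiag a) (hdiag b), sg * z).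

Lemma dpointD a b z a' b' z' : dpoint a b z + dpoint a' b' z' =
  dpoint (fun i => a i + a' i) (fun i => b i + b' i) (z + z').
Proof.
rewrite /dpoint /swapped mulrDr -!hdiagD.
by case: sw.
Qed.

Lemma dpointZ (t : R) a b z : t *: dpoint a b z =
  dpoint (fun i => t * a i) (fun i => t * b i) (t * z).
Proof.
rewrite /dpoint /swapped mulrCA -!hdiagZ.
by case: sw.
Qed.

Lemma eq_dpoint a b z a' b' z' : a =1 a' -> b =1 b' -> z = z' ->
  dpoint a b z = dpoint a' b' z'.
Proof. by rewrite /dpoint => /eq_hdiag -> /eq_hdiag -> ->. Qed.

Lemma sum_dpoint (I : eqType) (s : seq I) (D1 D2 : I -> 'I_n -> R) (z : I -> R) :
  \sum_(k <- s) dpoint (D1 k) (D2 k) (z k) =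
  dpoint (fun i => \sum_(k <- s) D1 k i) (fun i => \sum_(k <- s) D2 k i)
    (\sum_(k <- s) z k).
Proof.
elim: s => [|k s IH].
  by rewrite /dpoint -!sum_hdiag !big_nil mulr0 /swapped; case: sw.
rewrite big_cons IH dpointD; apply: eq_dpoint => [i|i|]; by rewrite big_cons.
Qed.

Lemma pd_swapped X Y z : pd_pair (swapped X Y, z) <-> pd X /\ pd Y.
Proof.
rewrite /pd_pair /swapped; case: sw; last exact: iff_refl.
by split=> -[p q]; split; [exact: q|exact: p|exact: q|exact: p].
Qed.

Lemma dpoint_dom a b z : W (dpoint a b z) <->
  [/\ forall i, 0 < a i, forall i, 0 < b i & Gsw (hdiag a) (hdiag b) < z].
Proof.
rewrite /barrier_dom /= /slack /= -/(Gsw (hdiag a) (hdiag b)) mulrA sg2 mul1r subr_gt0.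
split=> [[/pd_swapped[/pd_hdiag p1 /pd_hdiag p2] h]|[p1 p2 h]].
  by split; [exact: p1|exact: p2|exact: h].
split; last exact: h.
by apply/pd_swapped; split; apply/pd_hdiag; [exact: p1|exact: p2].
Qed.

Lemma dpoint_in a b z : (forall i, 0 < a i <= b i) -> \sum_i a i < z ->
  W (dpoint a b z).
Proof.
move=> ab az; apply/dpoint_dom.
have a0 i : 0 < a i by case/andP: (ab i).
have b0 i : 0 < b i by apply: (lt_le_trans (a0 i)); case/andP: (ab i).
split=> //; apply: (le_lt_trans (G_le_trace _ _ _)).
- exact/pd_hdiag.
- exact/pd_hdiag.
- move=> v; rewrite !qf_hdiag; apply: ler_sum => i _.
  by rewrite ler_wpM2r ?sqn_ge0//; case/andP: (ab i).
- by rewrite trr_hdiag.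
Qed.

Let c := dpoint (fun=> 1) (fun=> 1) (n%:R + 1).

(** Closure points of an open convex cone are recession directions: move x slightly
backwards along c, and compensate inside the cone. *)
Lemma recession_dom p : (forall d : R, 0 < d -> W (p + d *: c)) ->
  forall x (t : R), W x -> 0 <= t -> W (x + t *: p).
Proof.
move=> hp x t Wx; rewrite le_eqVlt => /predU1P[<-|t0].
  by rewrite scale0r addr0.
have oW := open_barrier_dom G_smooth (sg := sg).
have nW : nbhs x W by exact: open_nbhs_nbhs.
have [s s0 [_ Ws]] := near0_pos (near_line c nW).
have t1 : 0 < 1 + t by rewrite addr_gt0.
have := convex_barrier_dom G_sublinear Ws (hp (s / t) (divr_gt0 s0 t0)) ler01 (ltW t0) t1.
rewrite scale1r scalerDr scalerA mulrCA divff ?gt_eqF// mulr1 addrACA scaleNr.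
by rewrite addNr addr0.
Qed.

(* recession directions; followed backwards, they leave the domain through the
   boundaries of the first cone, of the second cone and of the epigraph *)
Let p1 k := dpoint (ddelta R k) (ddelta R k) 1.
Let p2 k := dpoint (fun=> 0) (ddelta R k) 0.
Let p3 := dpoint (fun=> 0) (fun=> 0) 1.

Lemma sum_one : \sum_(i < n) (1 : R) = n%:R.
Proof. by rewrite sumr_const card_ord. Qed.

Lemma sum_ge (m : R) (F : 'I_n -> R) : (forall k, m <= F k) ->
  n%:R * m <= \sum_k F k.
Proof. by move=> h; rewrite -sum_one mulr_suml ler_sum// => k _; rewrite mul1r. Qed.

Lemma dom_p1 k d : 0 < d -> W (p1 k + d *: c).
Proof.
move=> d0; rewrite dpointZ dpointD; apply: dpoint_in => [i|].
  by rewrite mulr1 lexx andbT ltr_wpDl// ler0n.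
by rewrite big_split /= sum_ddelta_tr -mulr_sumr sum_one ltrD2l ltr_pM2l// ltrDl.
Qed.

Lemma dom_p2 k d : 0 < d -> W (p2 k + d *: c).
Proof.
move=> d0; rewrite dpointZ dpointD; apply: dpoint_in => [i|].
  by rewrite add0r mulr1 d0 lerDr ler0n.
by under eq_bigr do rewrite add0r; rewrite -mulr_sumr sum_one add0r ltr_pM2l// ltrDl.
Qed.

Lemma dom_p3 d : 0 < d -> W (p3 + d *: c).
Proof.
move=> d0; rewrite dpointZ dpointD; apply: dpoint_in => [i|].
  by rewrite add0r mulr1 d0 lexx.
under eq_bigr do rewrite add0r.
by rewrite -mulr_sumr sum_one ltr_pwDl// ler_pM2l// lerDl.
Qed.

(** At x = (1, y 1, z), going back along p1 k, p2 k and p3 leaves the domain after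
times 1, y and K, so the derivatives along them are at most -1, -1/y, -1/K. As
(e 1, e 1, n e + e) is x minus (1 - e) p1 k, (y - 1) p2 k and about K p3, the
parameter is at least (2n + 1)(1 - e). *)
Lemma optimal_parameter (g : E -> \bar R) mu :
  nu_sc_barrier mu (closure W) g -> (2 * n + 1)%N%:R <= mu.
Proof.
move=> [[sc clg] par].
have oW : open W := open_barrier_dom G_smooth (sg := sg).
have oV : open (dom g) := sc_open sc.
have Wc : W c.
  apply: dpoint_in => [i|]; first by rewrite ltr01 lexx.
  by rewrite sum_one ltrDl.
have VW : dom g = W.
  have Vne : exists v, dom g v.
    have : closure (dom g) c by rewrite clg; exact: subset_closure.
    by move=> /(_ _ filterT)[v [Vv _]]; exists v.
  have [v Vv] := Vne.
  (* both are open and convex with the same closure *)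
  apply/seteqP; split.
    apply: (open_convex_subset_closure oW oV Wc).
      move=> x y t Wx Wy /andP[t0 t1].
      have t1' : 0 <= 1 - t by rewrite subr_ge0.
      by apply: (convex_barrier_dom G_sublinear Wx Wy t0 t1'); rewrite addrC subrK.
    by rewrite -clg; exact: subset_closure.
  apply: (open_convex_subset_closure oV oW Vv).
    by move=> x y t Vx Vy t01; case: (sc_convex sc Vx Vy t01).
  by rewrite clg; exact: subset_closure.
have rec p : (forall d : R, 0 < d -> W (p + d *: c)) -> recession g p.
  by move=> hp x t; rewrite VW; exact: recession_dom.
have r1 k := rec _ (@dom_p1 k).
have r2 k := rec _ (@dom_p2 k).
have r3 := rec _ dom_p3.
suff H e : 0 < e < 1 -> (2 * n + 1)%N%:R * (1 - e) <= mu.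
  apply/ler_addgt0Pr => d d0.
  pose N : R := (2 * n + 1)%N%:R; have N0 : 0 < N by rewrite ltr0n addn1.
  pose e := Num.min (2^-1) (d / N).
  have e01 : 0 < e < 1.
    by rewrite /e lt_min invr_gt0 ltr0n divr_gt0//= gt_min invf_lt1// ltr1n.
  have : N * e <= d by rewrite mulrC -ler_pdivlMr// ge_min lexx orbT.
  by have := H e e01; rewrite -/N mulrBr mulr1; lra.
move=> /andP[e0 e1]; pose y := e^-1.
have y1 : 1 < y by rewrite invf_gt1.
have y0 : 0 < y by rewrite invr_gt0.
pose gam := Gsw (hdiag (fun=> 1)) (hdiag (fun=> y)).
(* large enough for a3 / K to be at least 1 - e *)
pose K := (n%:R + 1 + `|gam|) / e.
have K1 : n%:R + 1 + `|gam| < K.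
  by rewrite ltr_pdivlMr// gtr_pMr// ltr_wpDr// ltr_wpDl.
have K0 : 0 < K by apply: le_lt_trans K1; rewrite !addr_ge0.
pose z := gam + K.
pose x := dpoint (fun=> 1) (fun=> y) z.
have Vx : dom g x by rewrite VW; apply/dpoint_dom; split=> // ; rewrite ltrDl.
have q1 k : 1 <= - d1 g (p1 k) x.
  rewrite -invr1; apply: (recession_derivative_ge sc par (r1 k) Vx ltr01).
  rewrite VW -scaleNr dpointZ dpointD => /dpoint_dom[/(_ k)].
  by rewrite /ddelta eqxx mulr1 subrr ltxx.
have q2 k : e <= - d1 g (p2 k) x.
  rewrite -[X in X <= _]invrK; apply: (recession_derivative_ge sc par (r2 k) Vx y0).
  rewrite VW -scaleNr dpointZ dpointD => /dpoint_dom[_ /(_ k)].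
  by rewrite /ddelta eqxx mulr1 subrr ltxx.
have q3 : K^-1 <= - d1 g p3 x.
  apply: (recession_derivative_ge sc par r3 Vx K0).
  rewrite VW -scaleNr dpointZ dpointD => /dpoint_dom[_ _].
  rewrite (_ : hdiag _ = hdiag (fun=> 1)); last by apply: eq_hdiag => i; rewrite mulr0 addr0.
  rewrite (_ : hdiag (fun i => y + _) = hdiag (fun=> y)); last by apply: eq_hdiag => i; rewrite mulr0 addr0.
  by rewrite /z mulr1 addrK ltxx.
pose a3 := z - n%:R - e.
have a30 : 0 <= a3.
  by have := ler_norm (- gam); rewrite normrN /a3 /z; move: K1 e1; lra.
pose x' := dpoint (fun=> e) (fun=> e) (n%:R * e + e).
have Vx' : dom g x'.
  rewrite VW; apply: dpoint_in => [i|]; first by rewrite e0 lexx.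
  have -> : \sum_(i < n) e = n%:R * e by rewrite sumr_const card_ord mulr_natl.
  by rewrite ltrDl.
have xE : x' - x = (- (1 - e)) *: (\sum_k p1 k) +
    ((- (y - 1)) *: (\sum_k p2 k) + (- a3) *: p3).
  have S1 : \sum_k p1 k = dpoint (fun=> 1) (fun=> 1) n%:R.
    rewrite sum_dpoint sum_one; apply: eq_dpoint => // i; exact: sum_ddelta.
  have S2 : \sum_k p2 k = dpoint (fun=> 0) (fun=> 1) 0.
    rewrite sum_dpoint; apply: eq_dpoint => [i|i|]; rewrite ?big1_eq//.
    exact: sum_ddelta.
  rewrite S1 S2 -scaleN1r !dpointZ !dpointD; apply: eq_dpoint => [i|i|] /=; last 1 first.
  - rewrite /a3; ring.
  - ring.
  - ring.
have := derivative_le_parameter sc par Vx Vx'.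
rewrite xE !(d1D sc)// !(d1Z sc)// !(d1_sum sc)//.
rewrite !mulNr -!mulrN -!sumrN.
have h1 : n%:R * 1 <= \sum_k - d1 g (p1 k) x := sum_ge q1.
rewrite mulr1 in h1.
have h2 : n%:R * e <= \sum_k - d1 g (p2 k) x := sum_ge q2.
have h3 : 1 - e <= a3 * - d1 g p3 x.
  apply: (le_trans _ (ler_wpM2l a30 q3)).
  rewrite ler_pdivlMr// mulrBl mul1r /a3 /z.
  have -> : e * K = n%:R + 1 + `|gam| by rewrite mulrC divfK// gt_eqF.
  by have := ler_norm (- gam); rewrite normrN; move: e1; lra.
have e10 : 0 <= 1 - e by rewrite subr_ge0 ltW.
have y10 : 0 <= y - 1 by rewrite subr_ge0 ltW.
have := ler_wpM2l e10 h1; have := ler_wpM2l y10 h2.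
have -> : (y - 1) * (n%:R * e) = n%:R * (1 - e) by rewrite /y; field; rewrite gt_eqF.
rewrite natrD natrM.
move: (\sum_k _) (\sum_k _) (_ * - d1 _ _ _) h3 => u v w h3 i1 i2 i3.
by move: h3 i1 i2 i3; lra.
Qed.

End OptimalParameter.

(** * Averages of the trace of L Z^-1 L *)

Section CompatibleForms.
Local Open Scope complex_scope.
Local Open Scope sesquilinear_scope.
Variables (R : realType) (n : nat).
Local Notation C := R[i].
Local Notation H := (herm R n).
Implicit Types (L Z : H).

(** Sum of the cases of the real and imaginary parts, where the third derivative
is -3 l times the second. *)
Lemma jet_sqn_over_affine (a b : C) (l r : R) : `|l| <= r ->
  exists a1 a2 a3 : R,
  [/\ jet (fun t => sqn (1%:C * a + t%:C * b) / (1 + t * l)) a1 a2 a3,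
      0 <= a2 & `|a3| <= 3 * r * a2].
Proof.
move=> lr; case: a b => [a a'] [b b'].
have j := jet_add (jet_square_over_affine a b l) (jet_square_over_affine a' b' l).
do 3 eexists; split; first (apply: jet_ext j; apply: filterE => t).
- rewrite -mulrDl [l * t]mulrC /sqn /=.
  by congr (_ / _); ring.
- by rewrite -mulrDr mulr_ge0// addr_ge0// sqr_ge0.
rewrite -mulrDr normrM -mulrDr normrM.
set q := (b - l * a) ^+ 2 + _; have q0 : 0 <= q by rewrite addr_ge0 ?sqr_ge0.
rewrite (ger0_norm q0) normrN (ger0_norm (ler0n _ 6)) mulrA ler_wpM2r//.
have -> : 3 * r * 2 = 6 * r by ring.
by rewrite ler_wpM2l.
Qed.

(** Diagonalizing Z and Z' together yields a sum of squares over affine functions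
1 + d t, and the hypothesis says |d| <= r. *)
Lemma kform_compatible L L' Z Z' r : pd Z ->
  (forall v : 'cV[C]_n, `|qf Z' v| <= r * qf Z v) ->
  exists a1 a2 a3 : R,
  [/\ jet (fun t => kform (L + t *: L' : H) (Z + t *: Z' : H)) a1 a2 a3,
      0 <= a2 & `|a3| <= 3 * r * a2].
Proof.
move=> pZ hr; have [B [d [uB E1 E2]]] := simultaneous_cong Z' pZ.
have dr i : `|d i| <= r.
  by have := hr (invmx B *m delta_mx i 0); rewrite E1 E2 !qf_basis// mulr1.
pose a i j := ((invmx B) ^t* *m L) i j; pose b i j := ((invmx B) ^t* *m L') i j.
have h (ij : 'I_n * 'I_n) := jet_sqn_over_affine (a ij.1 ij.2) (b ij.1 ij.2) (dr ij.1).
have [c1 /choice[c2 /choice[c3 hc]]] := choice h.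
have hj ij : jet (fun t => sqn (1%:C * a ij.1 ij.2 + t%:C * b ij.1 ij.2) / (1 + t * d ij.1))
    (c1 ij) (c2 ij) (c3 ij) by case: (hc ij).
have j := jet_sum (index_enum ('I_n * 'I_n)%type) hj.
do 3 eexists; split; first (apply: jet_ext j).
- have nd i : \forall t \near (0 : R), 0 < 1 + t * d i.
    have [/derivable1_diffP/differentiable_continuous cf _] := is_derive_affine 1 (d i) 0.
    have : \forall t \near (0 : R), 0 < 1 + d i * t.
      by apply: (cvgr_gt _ cf); rewrite mulr0 addr0.
    by apply: filterS => t; rewrite mulrC.
  have {}nd := @filter_forall R 'I_n (fun i t => 0 < 1 + t * d i) (nbhs (0 : R)) (nbhs_filter (0 : R)) nd.
  apply: filterS nd => t ht.
  have := kform_pencil L L' uB E1 E2 ht; rewrite !scale1r => ->.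
  by rewrite pair_bigA.
- by apply: sumr_ge0 => ij _; case: (hc ij).
apply: (le_trans (ler_norm_sum _ _ _)); rewrite mulr_sumr.
by apply: ler_sum => ij _; case: (hc ij).
Qed.

End CompatibleForms.

Section RepresentedFunction.
Local Open Scope complex_scope.
Variables (R : realType) (n : nat).
Local Notation C := R[i].
Local Notation H := (herm R n).
Local Notation E := (H * H * R)%type.
Variables (J : (R -> R) -> R) (w : R -> R) (a b k1 k2 : R).
Hypothesis posJ : positive_functional J.
Hypothesis cw : continuous w.
Hypothesis w0 : forall x, 0 <= w x.
Implicit Types (X Y : H) (x : R).

Definition pencil x X Y : H := (1 - clamp x) *: Y + clamp x *: X.
Definition lcomb X Y : H := a *: X + b *: Y.

(** The matrix counterpart of an average of w (a + b t)^2 / ((1 - v) t + v) plus an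
affine function of t: t is replaced by Y and 1 by X. *)
Definition repG X Y : R := k1 * trr X + k2 * trr Y +
  J (fun x => w x * kform (lcomb X Y) (pencil x X Y)).

Lemma pd_pencil x X Y : pd X -> pd Y -> pd (pencil x X Y).
Proof.
move=> pX pY; have /andP[c0 c1] := clamp_itv x.
by apply: pd_comb => //; rewrite ?subr_ge0// subrK.
Qed.

Lemma pencil_line x X Y X' Y' (t : R) :
  pencil x (X + t *: X') (Y + t *: Y') = pencil x X Y + t *: pencil x X' Y'.
Proof.
by rewrite /pencil !scalerDr !scalerA addrACA ![_ * t]mulrC.
Qed.

Lemma lcomb_line X Y X' Y' (t : R) :
  lcomb (X + t *: X') (Y + t *: Y') = lcomb X Y + t *: lcomb X' Y'.
Proof.
by rewrite /lcomb !scalerDr !scalerA addrACA ![_ * t]mulrC.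
Qed.

Lemma pencil_comb x X1 Y1 X2 Y2 (p q : R) :
  pencil x (p *: X1 + q *: X2) (p *: Y1 + q *: Y2) =
  p *: pencil x X1 Y1 + q *: pencil x X2 Y2.
Proof.
by rewrite /pencil !scalerDr !scalerA addrACA ![_ * p]mulrC ![_ * q]mulrC.
Qed.

Lemma lcomb_comb X1 Y1 X2 Y2 (p q : R) :
  lcomb (p *: X1 + q *: X2) (p *: Y1 + q *: Y2) =
  p *: lcomb X1 Y1 + q *: lcomb X2 Y2.
Proof.
by rewrite /lcomb !scalerDr !scalerA addrACA ![_ * p]mulrC ![_ * q]mulrC.
Qed.

Lemma cfam_fst k i j : smooth_cfamily (@pd_pair R n) k (fun _ p => p.1.1 i j).
Proof.
apply: (@cfam_herm R n E _ k (fun p => p.1.1)) => //; first exact: open_pd_pair.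
exact: continuous_fst1.
Qed.

Lemma cfam_snd k i j : smooth_cfamily (@pd_pair R n) k (fun _ p => p.1.2 i j).
Proof.
apply: (@cfam_herm R n E _ k (fun p => p.1.2)) => //; first exact: open_pd_pair.
exact: continuous_snd1.
Qed.

Lemma cfam_real k (f : R -> R) : continuous f ->
  smooth_cfamily (@pd_pair R n) k (fun x _ => (f x)%:C).
Proof.
move=> cf; split; first exact: (fam_cst _ _ cf).
exact: (fam_cst _ _ (@continuous_cstR R 0)).
Qed.

Lemma fam_integrand k : smooth_family (@pd_pair R n) k
  (fun x p => w x * kform (lcomb p.1.1 p.1.2) (pencil x p.1.1 p.1.2)).
Proof.
have oU := @open_pd_pair R n.
apply: fam_mul; first exact: (fam_cst _ _ cw).
apply: (fam_kform oU (L := fun x p => lcomb p.1.1 p.1.2)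
  (Z := fun x p => pencil x p.1.1 p.1.2)).
- by move=> x p [pX pY]; exact: (pd_pencil x pX pY).
- move=> i j.
  have h := cfam_add oU (cfam_mul oU (cfam_real k (@continuous_cstR R a)) (cfam_fst k i j))
                        (cfam_mul oU (cfam_real k (@continuous_cstR R b)) (cfam_snd k i j)).
  by apply: (cfam_ext oU _ h) => x p _; rewrite herm_valD !herm_valZ !mxE.
- move=> i j.
  have c1 : continuous (fun x : R => 1 - clamp x).
    by apply: continuous_sub; [exact: continuous_cstR|exact: continuous_clamp].
  have h := cfam_add oU (cfam_mul oU (cfam_real k c1) (cfam_snd k i j))
                        (cfam_mul oU (cfam_real k (@continuous_clamp R)) (cfam_fst k i j)).
  by apply: (cfam_ext oU _ h) => x p _; rewrite herm_valD !herm_valZ !mxE.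
Qed.

Lemma continuous_integrand X Y : pd X -> pd Y ->
  continuous (fun x => w x * kform (lcomb X Y) (pencil x X Y)).
Proof.
move=> pX pY.
exact: (@joint_cont_fst _ _ _ _ (X, Y, 0 : R) (fam_joint_cont (fam_integrand 0)) (conj pX pY)).
Qed.

Lemma fam_trr k : smooth_family (@pd_pair R n) k (fun _ p => k1 * trr p.1.1 + k2 * trr p.1.2).
Proof.
apply: fam_linear.
- by move=> p q /=; rewrite !trrD; move: (trr _) (trr _) (trr _) (trr _) => *; ring.
- by move=> t p /=; rewrite !trrZ; move: (trr _) (trr _) => *; ring.
move=> p; apply: (@continuousD _ _ _ (fun p : E => k1 * trr p.1.1) (fun p : E => k2 * trr p.1.2)).
  apply: (@continuousM _ _ (cst k1) (fun p : E => trr p.1.1)); first exact: cst_continuous.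
  by apply: (@continuous_comp _ _ _ (fun p : E => p.1.1) (@trr R n)); [exact: continuous_fst1|exact: continuous_trr].
apply: (@continuousM _ _ (cst k2) (fun p : E => trr p.1.2)); first exact: cst_continuous.
by apply: (@continuous_comp _ _ _ (fun p : E => p.1.2) (@trr R n)); [exact: continuous_snd1|exact: continuous_trr].
Qed.

Lemma repG_smooth : pd_smooth repG.
Proof.
exact: (fam_add (fam_trr 3) (fam_J (@open_pd_pair R n) posJ (fam_integrand 3))).
Qed.

Lemma repG_sublinear : pd_sublinear repG.
Proof.
move=> X1 Y1 X2 Y2 p q pX1 pY1 pX2 pY2 p0 q0 pq.
have c1 := continuous_integrand pX1 pY1; have c2 := continuous_integrand pX2 pY2.
have c3 := continuous_integrand (pd_comb pX1 pX2 p0 q0 pq) (pd_comb pY1 pY2 p0 q0 pq).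
have : J (fun x => w x * kform (lcomb (p *: X1 + q *: X2) (p *: Y1 + q *: Y2))
      (pencil x (p *: X1 + q *: X2) (p *: Y1 + q *: Y2))) <=
    p * J (fun x => w x * kform (lcomb X1 Y1) (pencil x X1 Y1)) +
    q * J (fun x => w x * kform (lcomb X2 Y2) (pencil x X2 Y2)).
  rewrite -(Jscale posJ p c1) -(Jscale posJ q c2).
  rewrite -(Jadd posJ (continuous_scale (a := p) c1) (continuous_scale (a := q) c2)).
  apply: (Jle posJ c3).
    exact: continuous_add (continuous_scale (a := p) c1) (continuous_scale (a := q) c2).
  move=> x _; rewrite pencil_comb lcomb_comb.
  have := kform_sublinear (lcomb X1 Y1) (lcomb X2 Y2) (pd_pencil x pX1 pY1) (pd_pencil x pX2 pY2) p0 q0 pq.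
  move/(ler_wpM2l (w0 x)); rewrite mulrDr.
  by rewrite [w x * (p * _)]mulrCA [w x * (q * _)]mulrCA.
rewrite /repG !trrD !trrZ; move: (J _) (J _) (J _) (trr _) (trr _) (trr _) (trr _).
by move=> *; lra.
Qed.

(** The trace terms are linear, and the integrand is compatible for every value
of the parameter with the same r. *)
Lemma repG_compatible : pd_compatible repG.
Proof.
move=> X Y X' Y' r a1 a2 a3 pX pY r0 hX hY jG.
have [b1 [b2 [b3 [[c1 c2 c3] [jg jJ]]]]] :=
  fam_jet (@open_pd_pair R n) posJ (X', Y', 0 : R) (fam_integrand 3)
    (conj pX pY : @pd_pair R n (X, Y, 0)).
have hb s : 0 <= b2 s /\ `|b3 s| <= 3 * r * b2 s.
  have hZ v : `|qf (pencil s X' Y') v| <= r * qf (pencil s X Y) v.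
    have /andP[s0 s1] := clamp_itv s.
    rewrite !herm_valD !herm_valZ !qfD !qfZ mulrDr.
    apply: (le_trans (ler_normD _ _)); apply: lerD.
      by rewrite normrM ger0_norm ?subr_ge0// mulrCA ler_wpM2l ?subr_ge0.
    by rewrite normrM ger0_norm// mulrCA ler_wpM2l.
  have [e1 [e2 [e3 [je e20 e3r]]]] :=
    kform_compatible (lcomb X Y) (lcomb X' Y') (pd_pencil s pX pY) hZ.
  have jw := jet_scale (w s) je.
  have jw' : jet (fun t => w s * kform (lcomb ((X, Y, 0 : R) + t *: (X', Y', 0 : R) : E).1.1
       ((X, Y, 0 : R) + t *: (X', Y', 0 : R) : E).1.2) (pencil s ((X, Y, 0 : R) + t *: (X', Y', 0 : R) : E).1.1
       ((X, Y, 0 : R) + t *: (X', Y', 0 : R) : E).1.2)) (w s * e1) (w s * e2) (w s * e3).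
    by apply: jet_ext jw; apply: filterE => t; rewrite -lcomb_line -pencil_line.
  have [_ -> ->] := jet_unique (jg s) jw'.
  split; first exact: mulr_ge0.
  by rewrite normrM ger0_norm// mulrCA ler_wpM2l.
have jA := jet_add (jet_affine (k1 * trr X + k2 * trr Y) (k1 * trr X' + k2 * trr Y')) jJ.
rewrite !add0r in jA.
have jG' : jet (fun t => repG (X + t *: X') (Y + t *: Y'))
    (k1 * trr X' + k2 * trr Y' + J b1) (J b2) (J b3).
  apply: jet_ext jA; apply: filterE => t; rewrite /repG /=; congr (_ + _).
  by rewrite !trrD !trrZ; move: (trr _) (trr _) (trr _) (trr _) => *; ring.
have [_ -> ->] := jet_unique jG jG'.
split; first by apply: (Jge0 posJ) => // s _; case: (hb s).
rewrite -(Jscale posJ)//; apply: (Jnorm_le posJ) => //; first exact: continuous_scale.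
by move=> s _; case: (hb s).
Qed.

Lemma Jintegrand_ge0 X Y : pd X -> pd Y ->
  0 <= J (fun x => w x * kform (lcomb X Y) (pencil x X Y)).
Proof.
move=> pX pY; apply: (Jge0 posJ); first exact: continuous_integrand.
by move=> x _; rewrite mulr_ge0// //; apply: kform_ge0; exact: (pd_pencil x pX pY).
Qed.

Lemma trr_ge0 X : psd X -> 0 <= trr X.
Proof.
move=> psX; have [B [d [uB _ E]]] := herm_spectral X.
have d0 := (psd_cong uB E).1 psX.
rewrite /trr E trace_cong; do 2 (apply: sumr_ge0 => ? _).
by rewrite mulr_ge0 ?sqn_ge0.
Qed.

Lemma repG_lower : pd_trace_bounded repG.
Proof.
exists (`|k1| + `|k2|) => X Y pX pY; have := Jintegrand_ge0 pX pY.
have := trr_ge0 (pd_psd pX); have := trr_ge0 (pd_psd pY).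
rewrite /repG; move: (J _) (trr X) (trr Y) => j x y y0 x0 j0.
have := mulr_ge0 (normr_ge0 k1) y0; have := mulr_ge0 (normr_ge0 k2) x0.
have h (k z : R) : 0 <= z -> - (`|k| * z) <= k * z.
  by move=> z0; rewrite -mulNr ler_wpM2r// lerNl; have := ler_norm (- k); rewrite normrN.
by have := h k1 x x0; have := h k2 y y0; move=> *; lra.
Qed.

End RepresentedFunction.

(** * Integral representation of the quasi-entropies *)

Lemma continuous_clampC (R : realType) : continuous (fun x : R => 1 - clamp x).
Proof. by apply: continuous_sub; [exact: continuous_cstR|exact: continuous_clamp]. Qed.

Section RelativeEigenvalues.
Local Open Scope complex_scope.
Variables (R : realType) (n : nat).
Local Notation C := R[i].
Local Notation H := (herm R n).
Variables (J : (R -> R) -> R) (w : R -> R) (a b k1 k2 : R).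
Hypothesis posJ : positive_functional J.
Hypothesis cw : continuous w.
Implicit Types (X Y : H) (x t : R).

(** The value of the represented function at the 1 by 1 pair (1, t). *)
Definition rep_scalar t : R := k1 + k2 * t +
  J (fun x => w x * ((a + b * t) ^+ 2 / ((1 - clamp x) * t + clamp x))).

Lemma pencil_gt0 x t : 0 < t -> 0 < (1 - clamp x) * t + clamp x.
Proof.
move=> t0; have /andP[c0 c1] := clamp_itv x.
by rewrite -[X in _ + X]mulr1; apply: comb_gt0; rewrite ?subr_ge0 ?subrK.
Qed.

Lemma continuous_rep_scalar (c t : R) : 0 < t ->
  continuous (fun x => w x * (c / ((1 - clamp x) * t + clamp x))).
Proof.
move=> t0 x; apply: (@continuousM _ _ w (fun x => c / ((1 - clamp x) * t + clamp x))); first exact: cw.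
apply: (@continuousM _ _ (cst c) (fun x => ((1 - clamp x) * t + clamp x)^-1)); first exact: cst_continuous.
apply: (@continuousV _ _ (fun x => (1 - clamp x) * t + clamp x)).
  by rewrite gt_eqF// pencil_gt0.
apply: (@continuousD _ _ _ (fun x => (1 - clamp x) * t) (@clamp R)); last exact: continuous_clamp.
apply: (@continuousM _ _ (fun x => 1 - clamp x) (cst t)); last exact: cst_continuous.
exact: continuous_clampC.
Qed.

(** In a basis that diagonalizes X and Y together everything reduces to the scalar
function at the relative eigenvalues. *)
Lemma repG_cong (B : 'M[C]_n) d X Y : B \in unitmx ->
  (X : 'M[C]_n) = cong B (fun=> 1) -> (Y : 'M[C]_n) = cong B d -> (forall i, 0 < d i) ->
  repG J w a b k1 k2 X Y = \sum_i \sum_j rep_scalar (d i) * sqn (B i j).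
Proof.
move=> uB EX EY d0.
have F (ij : 'I_n * 'I_n) : continuous (fun x => sqn (B ij.1 ij.2) *
    (w x * ((a + b * d ij.1) ^+ 2 / ((1 - clamp x) * d ij.1 + clamp x)))).
  by apply: continuous_scale; apply: continuous_rep_scalar.
have EJ : J (fun x => w x * kform (lcomb a b X Y) (pencil x X Y)) =
    \sum_ij sqn (B ij.1 ij.2) * J (fun x => w x * ((a + b * d ij.1) ^+ 2 / ((1 - clamp x) * d ij.1 + clamp x))).
  transitivity (J (fun x => \sum_ij sqn (B ij.1 ij.2) *
    (w x * ((a + b * d ij.1) ^+ 2 / ((1 - clamp x) * d ij.1 + clamp x))))).
    congr J; apply/funext => x.
    have -> : herm_val (lcomb a b X Y) = cong B (fun i => a + b * d i).
      exact: pencil_cong.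
    have -> : herm_val (pencil x X Y) = cong B (fun i => (1 - clamp x) * d i + clamp x).
      rewrite /pencil addrC (pencil_cong _ _ EX EY); apply: eq_cong => i; exact: addrC.
    rewrite kform_cong2//; last by move=> i; rewrite gt_eqF// pencil_gt0.
    rewrite pair_bigA mulr_sumr; apply: eq_bigr => ij _ /=.
    by rewrite mulrA [RHS]mulrC.
  rewrite (Jsum posJ)//; apply: eq_bigr => ij _.
  by rewrite (Jscale posJ)//; exact: continuous_rep_scalar.
have TX : trr X = \sum_ij sqn (B ij.1 ij.2).
  rewrite /trr EX trace_cong pair_bigA; apply: eq_bigr => ij _; exact: mul1r.
have TY : trr Y = \sum_ij d ij.1 * sqn (B ij.1 ij.2).
  by rewrite /trr EY trace_cong pair_bigA.
rewrite /repG EJ TX TY pair_bigA !mulr_sumr -!big_split; apply: eq_bigr => ij _ /=.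
by rewrite /rep_scalar; move: (J _) => j; ring.
Qed.

Lemma repG_Qpd (alpha sg : R) X Y :
  (forall t, 0 < t -> rep_scalar t = sg * t `^ (1 - alpha)) -> pd X -> pd Y ->
  repG J w a b k1 k2 X Y = sg * Qpd alpha X Y.
Proof.
move=> hs pX pY; have [B [d [uB EX EY EQ]]] := Qpd_cong pX pY.
have d0 := (pd_cong uB EY).1 pY.
rewrite (repG_cong uB EX EY d0) EQ mulr_sumr; apply: eq_bigr => i _.
rewrite mulr_sumr; apply: eq_bigr => j _; rewrite hs//; ring.
Qed.

End RelativeEigenvalues.

Section PowerRepresentations.
Variables (R : realType) (J : (R -> R) -> R).
Hypothesis posJ : positive_functional J.
Implicit Types (s t : R).

Lemma represents_power_mass s : represents_power J s -> J (fun=> 1) = 1.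
Proof.
move=> hJ; have := hJ 1 ltr01; rewrite powR1 => {2}<-; congr (J _).
by apply/funext => x; rewrite mulr1 subrK divr1.
Qed.

Lemma continuous_cst1 : continuous (fun _ : R => 1 : R).
Proof. exact: continuous_cstR. Qed.

Lemma rep_scalar_left s t : represents_power J s -> 0 < t ->
  rep_scalar J (fun=> 1) 1 0 0 0 t = t `^ (s - 1).
Proof.
move=> hJ t0; rewrite /rep_scalar mul0r !add0r.
have -> : (fun x => 1 * ((1 + 0) ^+ 2 / ((1 - clamp x) * t + clamp x))) =
   (fun x => t^-1 * (1 * (t / ((1 - clamp x) * t + clamp x)))).
  apply/funext => x; rewrite !mul1r addr0 expr1n mul1r mulrA mulVf ?mul1r//.
  by rewrite gt_eqF.
rewrite (Jscale posJ); last exact: (continuous_rep_scalar continuous_cst1).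
under [X in J X]eq_fun do rewrite mul1r.
rewrite hJ// powRB; last by rewrite (gt_eqF t0) implybT.
by rewrite powRr1 ?(ltW t0)// mulrC.
Qed.

Lemma rep_scalar_right s t : represents_power J s -> 0 < t ->
  rep_scalar J (fun=> 1) 0 1 0 0 t = t `^ (s + 1).
Proof.
move=> hJ t0; rewrite /rep_scalar mul0r !add0r.
have -> : (fun x => 1 * ((1 * t) ^+ 2 / ((1 - clamp x) * t + clamp x))) =
   (fun x => t * (1 * (t / ((1 - clamp x) * t + clamp x)))).
  by apply/funext => x; rewrite !mul1r expr2 mulrA.
rewrite (Jscale posJ); last exact: (continuous_rep_scalar continuous_cst1).
under [X in J X]eq_fun do rewrite mul1r.
rewrite hJ// powRD; last by rewrite (gt_eqF t0) implybT.
by rewrite powRr1 ?(ltW t0)// mulrC.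
Qed.

Definition clamp_gap (x : R) := clamp x * (1 - clamp x).

Lemma continuous_clamp_gap : continuous clamp_gap.
Proof.
move=> x; apply: (@continuousM _ _ (@clamp R) (fun x => 1 - clamp x)).
  exact: continuous_clamp.
exact: continuous_clampC.
Qed.

Lemma clamp_gap_ge0 x : 0 <= clamp_gap x.
Proof. by have /andP[c0 c1] := clamp_itv x; rewrite mulr_ge0 ?subr_ge0. Qed.

(** The weighted arithmetic mean of 1 and t exceeds the harmonic one by
v (1 - v) (t - 1)^2 / ((1 - v) t + v), whence the affine correction. *)
Lemma rep_scalar_concave s t : represents_power J s -> 0 < t ->
  rep_scalar J clamp_gap (-1) 1 (J (@clamp R) - 1) (- J (@clamp R)) t = - t `^ s.
Proof.
move=> hJ t0; have J1 := represents_power_mass hJ.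
have cc := @continuous_clamp R.
have c1 : continuous (fun x : R => 1 - clamp x).
  exact: continuous_clampC.
have c2 : continuous (fun x : R => t * clamp x) by exact: continuous_scale.
have c3 : continuous (fun x : R => (1 - clamp x) + t * clamp x) by exact: continuous_add.
have c4 := continuous_rep_scalar continuous_cst1 (c := t) t0.
rewrite /rep_scalar.
have -> : (fun x => clamp_gap x * ((-1 + 1 * t) ^+ 2 / ((1 - clamp x) * t + clamp x))) =
   (fun x => ((1 - clamp x) + t * clamp x) - 1 * (t / ((1 - clamp x) * t + clamp x))).
  apply/funext => x; have := pencil_gt0 x t0; rewrite /clamp_gap.
  move: (clamp x) => v v0; field; rewrite gt_eqF//.
rewrite (Jsub posJ)// (Jadd posJ)// (Jsub posJ) ?J1//; last exact: continuous_cst1.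
rewrite (Jscale posJ)//; under [X in _ - J X]eq_fun do rewrite mul1r.
by rewrite hJ//; ring.
Qed.

End PowerRepresentations.

(** * Finiteness at the boundary *)

Section KernelDomination.
Local Open Scope complex_scope.
Local Open Scope sesquilinear_scope.
Variables (R : realType) (n : nat).
Local Notation C := R[i].
Local Notation H := (herm R n).
Implicit Types (X Y : H).

Lemma sum_sqn_eq0 (u : 'cV[C]_n) : \sum_i sqn (u i 0) = 0 -> u = 0.
Proof.
by move=> u0; apply/eqP; apply: contra_eqT u0 => /sum_sqn_gt0/lt0r_neq0.
Qed.

Lemma psd_qf_eq0 X (v : 'cV[C]_n) : psd X -> qf X v = 0 -> (X : 'M[C]_n) *m v = 0.
Proof.
move=> /psd_factor[M EX]; rewrite EX qf_factor => /sum_sqn_eq0 Mv.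
by rewrite -mulmxA Mv mulmx0.
Qed.

Lemma qf_ker X (v : 'cV[C]_n) : (X : 'M[C]_n) *m v = 0 -> qf X v = 0.
Proof. by move=> Xv; rewrite /qf -mulmxA Xv mulmx0 mxE. Qed.

(** Write X = M* M and Y = N* N. The inclusion of kernels gives M = D N, and the
constant comes from the norm of D. *)
Lemma abs_cont_dominated X Y : psd X -> psd Y -> abs_cont X Y ->
  exists2 c, 1 <= c & forall v : 'cV[C]_n, qf X v <= c * qf Y v.
Proof.
move=> /psd_factor[M EX] /psd_factor[N EY] ac.
have kerMN (v : 'cV[C]_n) : N *m v = 0 -> M *m v = 0.
  move=> Nv; have : (Y : 'M[C]_n) *m v = 0 by rewrite EY -mulmxA Nv mulmx0.
  by move=> /ac/qf_ker; rewrite EX qf_factor => /sum_sqn_eq0.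
have : (M <= N)%MS.
  rewrite submxE; apply/eqP/matrixP => i j; rewrite [RHS]mxE.
  have Nc : N *m col j (cokermx N) = 0 by rewrite colE mulmxA mulmx_coker mul0mx.
  by have /colP/(_ i) := kerMN _ Nc; rewrite colE mulmxA -colE !mxE.
move=> /submxP[D ED].
exists (\sum_i \sum_j sqn (D i j) + 1).
  by rewrite lerDr; do 2 (apply: sumr_ge0 => ? _); exact: sqn_ge0.
move=> v; rewrite EX EY !qf_factor ED -mulmxA.
apply: (le_trans (sqn_mulmx_le _ _)); rewrite ler_wpM2r ?lerDl//.
by apply: sumr_ge0 => i _; exact: sqn_ge0.
Qed.

End KernelDomination.

Section SwappedBounds.
Local Open Scope complex_scope.
Variables (R : realType) (n : nat).
Local Notation C := R[i].
Local Notation H := (herm R n).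
Local Notation I := (herm1 R n).
Variables (G : H -> H -> R) (sw : bool).
Hypothesis G_sublinear : pd_sublinear G.
Hypothesis G_dominated : forall X Y c, pd X -> pd Y -> 1 <= c ->
  (forall v, qf X v <= c * qf Y v) -> Gsw G sw X Y <= c * trr X.
Implicit Types (X Y : H).

Definition closure_le_sw X Y M :=
  closure_le G (swapped sw X Y).1 (swapped sw X Y).2 M.

Lemma shifted_sw X Y (e : R) :
  shifted G (swapped sw X Y).1 (swapped sw X Y).2 e =
  Gsw G sw (X + e *: I) (Y + e *: I).
Proof. by rewrite /shifted /Gsw /swapped; case: sw. Qed.

(** By monotonicity only small shifts matter. *)
Lemma closure_le_bounded X Y M : psd X -> psd Y ->
  (forall e : R, 0 < e <= 1 -> shifted G X Y e <= M) ->
  closure_le G X Y (M + `|G I I|).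
Proof.
move=> psX psY h e e0.
have GI0 := ler_norm (G I I).
have GI1 := ler_norm (- G I I); rewrite normrN in GI1.
have [e1|e1] := leP e 1.
  have := h e; rewrite e0 e1 => /(_ isT).
  have := ler_wpM2l (ltW e0) GI1.
  have : e * `|G I I| <= `|G I I| by rewrite ler_piMl.
  by move: (e * `|_|) => u; rewrite mulrN; move: (e * _) => u'; lra.
(* larger shifts are obtained from the shift by 1 *)
have := h 1; rewrite ltr01 lexx => /(_ isT).
have e10 : 0 < e - 1 by rewrite subr_gt0.
have := G_shift G_sublinear (pd_shift psX ltr01) (pd_shift psY ltr01) e10.
have E (A : H) : A + 1 *: I + (e - 1) *: I = A + e *: I.
  by rewrite -addrA -scalerDl addrCA subrr addr0.
rewrite !E -/(shifted G X Y e) -/(shifted G X Y 1) mulrBl mul1r.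
by move: (e * _) => u; lra.
Qed.

Lemma trr1 : trr I = n%:R.
Proof. by rewrite herm1E trr_hdiag sumr_const card_ord. Qed.

(** If X <= c Y with c >= 1, then the shifted pair satisfies the same inequality, and
the entropy is at most c times the trace. *)
Lemma closure_le_dominated X Y : psd X -> psd Y -> abs_cont X Y ->
  exists M, closure_le_sw X Y M.
Proof.
move=> psX psY /(abs_cont_dominated psX psY)[c c1 hc].
have c0 : 0 <= c by rewrite (le_trans ler01).
have [ps1 ps2] := swapped_both sw psX psY.
exists (c * (trr X + n%:R) + `|G I I|); apply: (closure_le_bounded ps1 ps2).
move=> e /andP[e0 e1]; rewrite shifted_sw.
have h : forall v, qf (X + e *: I : H) v <= c * qf (Y + e *: I : H) v.
  move=> v; rewrite !herm_valD !herm_valZ !qfD !qfZ mulrDr lerD//.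
  rewrite ler_peMl// mulr_ge0 ?(ltW e0)//.
  by have /psdE := pd_psd (@pd1 R n).
apply: (le_trans (G_dominated (pd_shift psX e0) (pd_shift psY e0) c1 h)).
by rewrite ler_wpM2l// trrD trrZ trr1 lerD2l ler_piMl.
Qed.

Lemma powR_unbounded (a r K : R) : 0 < a -> 0 < r ->
  exists2 e, 0 < e <= 1 & K < (a / e) `^ r.
Proof.
move=> a0 r0; pose u := Num.max a ((`|K| + 1) `^ r^-1).
have k0 : 0 < `|K| + 1 by rewrite ltr_wpDl.
have u0 : 0 < u by rewrite lt_max a0.
exists (a / u).
  by rewrite divr_gt0//= ler_pdivrMr// mul1r le_max lexx.
have -> : a / (a / u) = u by field; rewrite !gt_eqF.
apply: (@lt_le_trans _ _ (`|K| + 1)).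
  by rewrite ltr_pwDr// ler_norm.
have -> : `|K| + 1 = ((`|K| + 1) `^ r^-1) `^ r.
  by rewrite -powRrM mulVf ?gt_eqF// powRr1// ltW.
rewrite ge0_ler_powR ?nnegrE ?powR_ge0 ?(ltW u0) ?(ltW r0)//.
by rewrite le_max lexx orbT.
Qed.

(** For v in the kernel of Y with qf X v > 0, the shifted values are at least a
constant times a power of qf X v / (e |v|^2), which is unbounded. *)
Lemma closure_le_abs_cont (r : R) X Y M : 0 < r ->
  (forall X Y v, pd X -> pd Y -> v != 0 ->
    qf X v * (qf X v / qf Y v) `^ r <= Gsw G sw X Y * \sum_i sqn (v i 0)) ->
  psd X -> psd Y -> closure_le_sw X Y M -> abs_cont X Y.
Proof.
move=> r0 blow psX psY hM v Yv; apply: psd_qf_eq0 => //.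
apply/eqP; rewrite eq_le ((psdE X).1 psX v) andbT leNgt; apply/negP => A0.
have v0 : v != 0 by apply: contraTneq A0 => ->; rewrite /qf mulmx0 mxE /= ltxx.
set A := qf X v in A0; set S := \sum_i sqn (v i 0).
have S0 : 0 < S by exact: sum_sqn_gt0.
have q1 : qf I v = S by rewrite herm1E qf_hdiag; apply: eq_bigr => i _; rewrite mul1r.
pose K := (`|M| + `|G I I|) * S / A.
have [e /andP[e0 e1] hK] := @powR_unbounded (A / S) r K (divr_gt0 A0 S0) r0.
have := blow _ _ v (pd_shift psX e0) (pd_shift psY e0) v0.
rewrite -shifted_sw !herm_valD !herm_valZ !qfD !qfZ q1 (qf_ker Yv) add0r -/A -/S.
have eS : 0 < e * S by rewrite mulr_gt0.
have h1 : (A / S / e) `^ r <= ((A + e * S) / (e * S)) `^ r.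
  rewrite ge0_ler_powR ?nnegrE ?(ltW r0)//.
  - by rewrite !divr_ge0// ltW.
  - by rewrite divr_ge0 ?addr_ge0// ltW.
  - rewrite -mulrA -invfM [S * e]mulrC ler_wpM2r ?invr_ge0 ?(ltW eS)//.
    by rewrite lerDl ltW.
have h2 := hM e e0.
have h3 : M + e * G I I <= `|M| + `|G I I|.
  rewrite lerD ?ler_norm//; apply: (le_trans (ler_norm _)).
  by rewrite normrM ger0_norm ?(ltW e0)// ler_piMl.
have h4 : shifted G (swapped sw X Y).1 (swapped sw X Y).2 e * S <= K * A.
  rewrite /K divfK ?gt_eqF// ler_wpM2r ?(ltW S0)//; exact: le_trans h3.
apply/negP; rewrite -ltNge; apply: (le_lt_trans h4).
rewrite mulrC; apply: (@lt_le_trans _ _ (A * (A / S / e) `^ r)).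
  by rewrite ltr_pM2l.
apply: ler_pM => //; first exact: ltW.
  exact: powR_ge0.
by rewrite lerDl ltW.
Qed.

End SwappedBounds.

Section RepresentedBounds.
Local Open Scope complex_scope.
Variables (R : realType) (n : nat).
Local Notation C := R[i].
Local Notation H := (herm R n).
Variables (J : (R -> R) -> R) (a b : R).
Hypothesis posJ : positive_functional J.
Implicit Types (X Y : H).

Local Notation G := (repG J (fun=> 1) a b 0 0).

Lemma repG_le X Y c : J (fun=> 1) = 1 -> pd X -> pd Y -> psd (lcomb a b X Y) ->
  (forall x v, qf (lcomb a b X Y) v <= c * qf (pencil x X Y) v) ->
  G X Y <= c * trr (lcomb a b X Y).
Proof.
move=> J1 pX pY psL h; rewrite /repG !mul0r !add0r.
have -> : c * trr (lcomb a b X Y) = J (fun=> c * trr (lcomb a b X Y)).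
  by rewrite (Jcst posJ) J1 mulr1.
apply: (Jle posJ).
- exact: (continuous_integrand (a := a) (b := b) (@continuous_cst1 R) pX pY).
- exact: continuous_cstR.
by move=> x _; rewrite mul1r; exact: (kform_le_trace (pd_pencil x pX pY) psL (h x)).
Qed.

Lemma rep_scalar_bound (p q x y c k S : R) : 0 < x ->
  0 < (1 - c) * (y / x) + c ->
  (p * x + q * y) ^+ 2 <= ((1 - c) * y + c * x) * k * S ->
  x * ((p + q * (y / x)) ^+ 2 / ((1 - c) * (y / x) + c)) <= S * k.
Proof.
move=> x0 d0; have xn : x != 0 by rewrite gt_eqF.
set d := _ + c in d0 *.
have -> : (1 - c) * y + c * x = x * d by rewrite /d; field.
have -> : p * x + q * y = x * (p + q * (y / x)) by field.
set e := p + _ => h; rewrite mulrA ler_pdivrMr// -(ler_pM2l x0).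
have -> : x * (x * e ^+ 2) = (x * e) ^+ 2 by ring.
by have -> : x * (S * k * d) = x * d * k * S by ring.
Qed.

(** Testing the integrand on a single vector v, as in Cauchy-Schwarz, bounds the
function below by its value at the 1 by 1 pair (qf X v, qf Y v). *)
Lemma repG_test_vector X Y (v : 'cV[C]_n) : pd X -> pd Y -> v != 0 ->
  qf X v * rep_scalar J (fun=> 1) a b 0 0 (qf Y v / qf X v) <=
  G X Y * \sum_i sqn (v i 0).
Proof.
move=> pX pY v0.
have x0 : 0 < qf X v by exact: (pdE X).1.
have y0 : 0 < qf Y v by exact: (pdE Y).1.
set x := qf X v in x0 *; set y := qf Y v in y0 *; set S := \sum_i _.
have S0 : 0 < S by exact: sum_sqn_gt0.
have t0 : 0 < y / x by rewrite divr_gt0.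
have c1 := continuous_rep_scalar (@continuous_cst1 R) (c := (a + b * (y / x)) ^+ 2) t0.
have c2 := continuous_integrand (a := a) (b := b) (@continuous_cst1 R) pX pY.
rewrite /rep_scalar /repG !mul0r !add0r [leRHS]mulrC.
rewrite -(Jscale posJ x c1) -(Jscale posJ S c2); apply: (Jle posJ).
- exact: (continuous_scale (a := x) c1).
- exact: (continuous_scale (a := S) c2).
move=> u _; rewrite !mul1r.
have := kform_lower (lcomb a b X Y) v (pd_pencil u pX pY).
rewrite -/S /pencil /lcomb; set k := kform _ _.
rewrite !herm_valD !herm_valZ !qfD !qfZ -/x -/y.
exact: (rep_scalar_bound x0 (pencil_gt0 u t0)).
Qed.

End RepresentedBounds.

(** * From the represented function to the quasi-entropy *)

Section ConvexityCriteria.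
Variables (R : realType) (E : lmodType R) (D : set E).
Implicit Types (x y : E) (t : R).

Lemma convex_set_intro :
  (forall x y t, D x -> D y -> 0 <= t <= 1 -> D (t *: x + (1 - t) *: y)) ->
  convex_set (D : set (convex_lmodType E)).
Proof.
move=> h x y t /set_mem Dx /set_mem Dy; apply/mem_set.
by apply: (h x y t%:num Dx Dy); rewrite ge0 le1.
Qed.

Lemma convex_function_intro (f : E -> R) :
  (forall x y t, D x -> D y -> 0 <= t <= 1 ->
    f (t *: x + (1 - t) *: y) <= t * f x + (1 - t) * f y) ->
  convex_function (D : set (convex_lmodType E)) f.
Proof.
move=> h t x y /set_mem Dx /set_mem Dy.
by apply: (h x y t%:num Dx Dy); rewrite ge0 le1.
Qed.

End ConvexityCriteria.

Section Assembly.
Local Open Scope complex_scope.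
Variables (R : realType) (n : nat).
Local Notation C := R[i].
Local Notation H := (herm R n).
Local Notation E := (H * H * R)%type.
Local Notation I := (herm1 R n).
Variables (alpha : R) (G : H -> H -> R) (sg : R) (D : set (H * H)).
Implicit Types (X Y : H) (p : E).
Hypothesis sg2 : sg * sg = 1.
Hypothesis G_sublinear : pd_sublinear G.
Hypothesis G_smooth : pd_smooth G.
Hypothesis G_Qpd : forall X Y, pd X -> pd Y -> G X Y = sg * Qpd alpha X Y.
Hypothesis D_psd : forall X Y, D (X, Y) -> psd X /\ psd Y.
Hypothesis D_bounded : forall X Y, psd X -> psd Y ->
  D (X, Y) <-> exists M, closure_le G X Y M.

Lemma sgK (x : R) : sg * (sg * x) = x.
Proof. by rewrite mulrA sg2 mul1r. Qed.

(** Finiteness of the extension forces convergence of the shifted values, and the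
limit is the least bound w in closure_le. *)
Lemma Qeps_cvg X Y : D (X, Y) -> exists l,
  (Qeps alpha X Y e @[e --> 0^'+] --> sg * l) /\
  forall w, closure_le G X Y w <-> l <= w.
Proof.
move=> DXY; have [psX psY] := D_psd DXY.
have [M hM] := (D_bounded psX psY).1 DXY.
have [l cl lw] := shifted_limit G_sublinear psX psY hM.
exists l; split; last exact: lw.
have : (fun e => sg * shifted G X Y e) @ 0^'+ --> sg * l.
  by apply: cvgM; [exact: cvg_cst|exact: cl].
apply: cvg_trans; apply: near_eq_cvg; near=> e.
have e0 : 0 < e by near: e; exact: nbhs_right_gt.
rewrite /shifted /Qeps G_Qpd ?sgK//.
  exact: (pd_shift psX e0).
exact: (pd_shift psY e0).
Unshelve. all: by end_near. Qed.

Lemma Qhat_well_defined_on : Qhat_well_defined alpha D.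
Proof.
by move=> [X Y] /Qeps_cvg[l [cl _]] _; apply/cvg_ex; exists (sg * l).
Qed.

Lemma closure_le_Qhat X Y w : D (X, Y) ->
  closure_le G X Y w <-> sg * Qhat alpha X Y <= w.
Proof.
move=> DXY; rewrite /Qhat; case: asboolP => [[pX pY]|_].
  by rewrite -G_Qpd//; exact: (closure_le_pd G_sublinear G_smooth).
have [l [cl lw]] := Qeps_cvg DXY.
by rewrite (cvg_lim _ cl)// sgK.
Qed.

(** Membership in D is finiteness of the extension, so convexity of the domain and
of the function come together. *)
Lemma D_convex X1 Y1 X2 Y2 (t : R) : D (X1, Y1) -> D (X2, Y2) -> 0 <= t <= 1 ->
  D (t *: X1 + (1 - t) *: X2, t *: Y1 + (1 - t) *: Y2) /\
  sg * Qhat alpha (t *: X1 + (1 - t) *: X2) (t *: Y1 + (1 - t) *: Y2) <=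
  t * (sg * Qhat alpha X1 Y1) + (1 - t) * (sg * Qhat alpha X2 Y2).
Proof.
move=> D1 D2 /andP[t0 t1]; have t1' : 0 <= 1 - t by rewrite subr_ge0.
have tt : t + (1 - t) = 1 by rewrite addrC subrK.
have [pX1 pY1] := D_psd D1; have [pX2 pY2] := D_psd D2.
have h1 := (closure_le_Qhat _ D1).2 (lexx _).
have h2 := (closure_le_Qhat _ D2).2 (lexx _).
have h := closure_le_convex G_sublinear pX1 pY1 pX2 pY2 t0 t1' tt h1 h2.
have D3 : D (t *: X1 + (1 - t) *: X2, t *: Y1 + (1 - t) *: Y2).
  apply/D_bounded; last by eexists; exact: h.
  - by apply: psdD; apply: psdZ.
  - by apply: psdD; apply: psdZ.
by split=> //; exact: (closure_le_Qhat _ D3).1.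
Qed.

Lemma Qhat_convex_on : convex_on D (fun P => sg * Qhat alpha P.1 P.2).
Proof.
split.
  apply: convex_set_intro => -[X1 Y1] [X2 Y2] t D1 D2 t01.
  by have [h _] := D_convex D1 D2 t01.
apply: convex_function_intro => -[X1 Y1] [X2 Y2] t D1 D2 t01.
by have [_ h] := D_convex D1 D2 t01.
Qed.

Lemma closure_barrier_domE : closure (barrier_dom G sg) =
  [set p | [/\ psd_pairs p.1, D p.1 & sg * Qhat alpha p.1.1 p.1.2 <= sg * p.2]].
Proof.
rewrite (closure_barrier_dom sg2 G_sublinear G_smooth).
apply/seteqP; split => -[[X Y] z] /=.
  move=> [psX psY h]; have DXY : D (X, Y) by apply/D_bounded => //; exists (sg * z).
  by split=> //; exact: (closure_le_Qhat _ DXY).1.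
move=> [[/= psX psY] DXY h]; split=> //.
exact: (closure_le_Qhat _ DXY).2.
Qed.

Lemma barrierE (X Y : H) (z : R) : barrier G sg (X, Y, z) =
  if `[< pd X /\ pd Y >]
  then (- lne (sg * (z - Qhat alpha X Y))%:E - logdet X - logdet Y)%E else +oo%E.
Proof.
rewrite /barrier /slack /=; case: asboolP => // -[pX pY].
by rewrite G_Qpd// mulrBr /Qhat asboolT.
Qed.

End Assembly.

Section HomogeneousBarrier.
Local Open Scope complex_scope.
Variables (R : realType) (n : nat).
Local Notation H := (herm R n).
Local Notation E := (H * H * R)%type.
Variables (G : H -> H -> R) (sg : R).
Implicit Types (X Y : H) (p : E).
Hypothesis G_sublinear : pd_sublinear G.

(** Sublinearity used for t and for 1/t. *)
Lemma G_homogeneous X Y (t : R) : pd X -> pd Y -> 0 < t ->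
  G (t *: X) (t *: Y) = t * G X Y.
Proof.
have half (s : R) A B : pd A -> pd B -> 0 < s -> G (s *: A) (s *: B) <= s * G A B.
  move=> pA pB s0; have := G_sublinear pA pB pA pB (ltW s0) (lexx 0).
  by rewrite !scale0r !addr0 mul0r addr0 => /(_ s0).
move=> pX pY t0; apply/eqP; rewrite eq_le half//=.
have ti : 0 < t^-1 by rewrite invr_gt0.
have := half t^-1 _ _ (pdZ t0 pX) (pdZ t0 pY) ti.
by rewrite !scalerA mulVf ?gt_eqF// !scale1r mulrC ler_pdivlMr// mulrC.
Qed.

Lemma detrZ X (t : R) : detr (t *: X) = t ^+ n * detr X.
Proof. by rewrite /detr herm_valZ detZ -rmorphXn ReM_real. Qed.

Lemma barrier_log_homogeneous :
  log_homogeneous (2 * n + 1)%N%:R (barrier G sg).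
Proof.
split.
  rewrite dom_barrier; apply: convex_set_intro => x y t Wx Wy /andP[t0 t1].
  have t1' : 0 <= 1 - t by rewrite subr_ge0.
  by apply: (convex_barrier_dom G_sublinear Wx Wy t0 t1'); rewrite addrC subrK.
move=> p t; rewrite dom_barrier => dp t0.
have [[pX pY] u0] := dp.
have us : slack G sg (t *: p) = t * slack G sg p.
  by rewrite /slack /= G_homogeneous// mulrBr [t * (sg * _)]mulrCA.
have dt : barrier_dom G sg (t *: p).
  split; last by rewrite us mulr_gt0.
  by split; [exact: (pdZ t0 pX)|exact: (pdZ t0 pY)].
split=> //; rewrite !barrier_fin// -EFinB; congr (_%:E).
have [dX _] := pd_detr pX; have [dY _] := pd_detr pY.
have tn : 0 < t ^+ n by rewrite exprn_gt0.
rewrite /rbarrier us.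
have -> : detr (t *: p).1.1 = t ^+ n * detr p.1.1 by exact: detrZ.
have -> : detr (t *: p).1.2 = t ^+ n * detr p.1.2 by exact: detrZ.
rewrite !lnM ?posrE// lnXn// natrD natrM -mulr_natl.
by move: (ln _) (ln _) (ln _) (ln _) => *; ring.
Qed.

End HomogeneousBarrier.

(** * The three ranges of alpha *)

Section GeometricQuasiEntropies.
Local Open Scope complex_scope.
Variables (R : realType) (n : nat).
Local Notation C := R[i].
Local Notation H := (herm R n).
Implicit Types (X Y : H) (alpha : R).

Lemma Qpd_ge0 alpha X Y : pd X -> pd Y -> 0 <= Qpd alpha X Y.
Proof.
move=> pX pY; have [B [d [_ _ _ ->]]] := Qpd_cong pX pY.
by do 2 (apply: sumr_ge0 => ? _); rewrite mulr_ge0 ?powR_ge0 ?sqn_ge0.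
Qed.

(** The pencil is a convex combination of X and Y, whatever their order. *)
Lemma pencil_dominates sw (x c : R) X Y (v : 'cV[C]_n) : 1 <= c -> psd X ->
  qf X v <= c * qf Y v ->
  qf X v <= c * qf (pencil x (swapped sw X Y).1 (swapped sw X Y).2) v.
Proof.
move=> c1 /psdE/(_ v) q0 h; have /andP[u0 u1] := clamp_itv x.
have u10 : 0 <= 1 - clamp x by rewrite subr_ge0.
have qX : qf X v <= c * qf X v by rewrite ler_peMl.
have E : qf X v = (1 - clamp x) * qf X v + clamp x * qf X v by ring.
rewrite /pencil !herm_valD !herm_valZ !qfD !qfZ {1}E mulrDr ![c * (_ * _)]mulrCA.
by rewrite /swapped; case: sw => /=; rewrite lerD// ler_wpM2l.
Qed.

(** Here -Q is represented, with L = Y - X and weight v (1 - v), and it is bounded above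
by 0, so that every positive semidefinite pair belongs to the domain. *)
Lemma hypo_statement alpha : 0 <= alpha <= 1 ->
  [/\ Qhat_well_defined alpha (@psd_pairs R n),
      concave_on (@psd_pairs R n) (fun P => Qhat alpha P.1 P.2),
      lh_sc_barrier (2 * n + 1)%N%:R (@hypoQ R n alpha) (@hypo_barrier R n alpha) &
      parameters_at_least (2 * n + 1)%N%:R (@hypoQ R n alpha)].
Proof.
move=> /andP[a0 a1].
have s01 : 0 <= 1 - alpha <= 1 by rewrite subr_ge0 a1 gerBl.
have [J [posJ hJ]] := exists_power_functional s01.
pose G := @repG R n J (@clamp_gap R) (-1) 1 (J (@clamp R) - 1) (- J (@clamp R)).
have cg := @continuous_clamp_gap R; have g0 := @clamp_gap_ge0 R.
have sg2 : -1 * -1 = 1 :> R by rewrite mulrNN mulr1.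
have GQ X Y : pd X -> pd Y -> G X Y = -1 * Qpd alpha X Y.
  move=> pX pY; apply: (repG_Qpd posJ cg _ pX pY) => t t0.
  by rewrite (rep_scalar_concave posJ hJ t0) mulN1r.
have Gn X Y : pd X -> pd Y -> G X Y <= 0.
  by move=> pX pY; rewrite GQ// mulN1r oppr_le0 Qpd_ge0.
have Gsub : pd_sublinear G := @repG_sublinear R n J _ _ _ _ _ posJ cg g0.
have Gsm : pd_smooth G := @repG_smooth R n J _ _ _ _ _ posJ cg.
have Gcomp : pd_compatible G := @repG_compatible R n J _ _ _ _ _ posJ cg g0.
have Glow : pd_trace_bounded G := @repG_lower R n J _ _ _ _ _ posJ cg g0.
have Dpsd X Y : psd_pairs (X, Y) -> psd X /\ psd Y by [].
have Dbd X Y : psd X -> psd Y -> psd_pairs (X, Y) <-> exists M, closure_le G X Y M.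
  move=> psX psY; split=> // _; exists (0 + `|G (herm1 R n) (herm1 R n)|).
  apply: (closure_le_bounded Gsub psX psY) => e /andP[e0 _].
  exact: Gn (pd_shift psX e0) (pd_shift psY e0).
have clE : closure (barrier_dom G (-1)) = @hypoQ R n alpha.
  rewrite (closure_barrier_domE sg2 Gsub Gsm GQ Dpsd Dbd).
  apply/seteqP; split => p; rewrite /hypoQ /= !mulN1r lerN2 => -[]//.
have bE : @hypo_barrier R n alpha = barrier G (-1).
  apply/funext => -[[X Y] z]; rewrite (barrierE GQ) /=.
  by rewrite mulN1r opprB.
have Gtr X Y : pd X -> pd Y -> (forall v, qf X v <= qf Y v) -> Gsw G false X Y <= trr X.
  move=> pX pY _; apply: (le_trans (Gn X Y pX pY)).
  exact: trr_ge0 (pd_psd pX).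
split.
- exact: (Qhat_well_defined_on sg2 Gsub GQ Dpsd Dbd).
- have := Qhat_convex_on sg2 Gsub Gsm GQ Dpsd Dbd.
  by under [X in convex_on _ X]eq_fun do rewrite mulN1r.
- rewrite bE -clE; split; last exact: barrier_log_homogeneous.
  split; last by rewrite dom_barrier.
  exact: (self_concordant_barrier _ Gsub Gsm Gcomp Glow).
- by move=> g mu; rewrite -clE; exact: (optimal_parameter sg2 Gsub Gsm Gtr).
Qed.

(** Common to both ranges: L is the argument that has to be dominated, X for
alpha > 1 and Y for alpha < 0. The last hypothesis makes the lower bound of
the entropy by a test vector explode when the quadratic form of the other
argument tends to 0 there. *)
Lemma epi_statement_of_rep alpha J a b sw (r : R) : alpha < 0 = sw ->
  positive_functional J -> J (fun=> 1) = 1 ->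
  (forall t, 0 < t -> rep_scalar J (fun=> 1) a b 0 0 t = t `^ (1 - alpha)) ->
  (forall X Y, lcomb a b (swapped sw X Y).1 (swapped sw X Y).2 = X) ->
  0 < r ->
  (forall x y : R, 0 < x -> 0 < y -> x * (x / y) `^ r =
     if sw then y * (x / y) `^ (1 - alpha) else x * (y / x) `^ (1 - alpha)) ->
  [/\ Qhat_well_defined alpha (@Dhat R n alpha),
      convex_on (@Dhat R n alpha) (fun P => Qhat alpha P.1 P.2),
      nu_sc_barrier (2 * n + 1)%N%:R (@epiQ R n alpha) (@epi_barrier R n alpha) &
      parameters_at_least (2 * n + 1)%N%:R (@epiQ R n alpha)].
Proof.
move=> asw posJ J1 hJ hL r0 hr.
pose G := @repG R n J (fun=> 1) a b 0 0.
have cg := @continuous_cst1 R; have g0 : forall x : R, 0 <= 1 :> R by [].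
have sg2 : 1 * 1 = 1 :> R by rewrite mulr1.
have GQ X Y : pd X -> pd Y -> G X Y = 1 * Qpd alpha X Y.
  move=> pX pY; apply: (repG_Qpd posJ cg _ pX pY) => t t0.
  by rewrite hJ// mul1r.
have Gsub : pd_sublinear G := @repG_sublinear R n J _ _ _ _ _ posJ cg g0.
have Gsm : pd_smooth G := @repG_smooth R n J _ _ _ _ _ posJ cg.
have Gcomp : pd_compatible G := @repG_compatible R n J _ _ _ _ _ posJ cg g0.
have Glow : pd_trace_bounded G := @repG_lower R n J _ _ _ _ _ posJ cg g0.
have Gdom X Y c : pd X -> pd Y -> 1 <= c -> (forall v, qf X v <= c * qf Y v) ->
    Gsw G sw X Y <= c * trr X.
  move=> pX pY c1 h; rewrite -{2}(hL X Y).
  have [p1 p2] := swapped_both sw pX pY.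
  apply: (repG_le posJ J1 p1 p2) => [|x v]; rewrite hL; first exact: pd_psd.
  exact: (pencil_dominates sw x c1 (pd_psd pX) (h v)).
have Gtr X Y : pd X -> pd Y -> (forall v, qf X v <= qf Y v) -> Gsw G sw X Y <= trr X.
  move=> pX pY h; rewrite -[leRHS]mul1r; apply: Gdom => // v.
  by rewrite mul1r.
have blow X Y v : pd X -> pd Y -> v != 0 ->
    qf X v * (qf X v / qf Y v) `^ r <= Gsw G sw X Y * \sum_i sqn (v i 0).
  move=> pX pY v0.
  have x0 : 0 < qf X v by exact: (pdE X).1.
  have y0 : 0 < qf Y v by exact: (pdE Y).1.
  have [p1 p2] := swapped_both sw pX pY.
  have := repG_test_vector a b posJ p1 p2 v0; rewrite -/G -/(Gsw G sw X Y).
  rewrite hr// hJ; last by rewrite divr_gt0 ?((pdE _).1 p1) ?((pdE _).1 p2).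
  by rewrite /swapped; case: (sw) => h; exact: h.
have Dpsd X Y : Dhat alpha (X, Y) -> psd X /\ psd Y by case.
have Dbd X Y : psd X -> psd Y -> Dhat alpha (X, Y) <-> exists M, closure_le G X Y M.
  move=> psX psY; have hd := closure_le_dominated Gsub Gdom.
  have ha := fun A B M => @closure_le_abs_cont R n G sw r A B M r0 blow.
  split.
    rewrite /Dhat /= asw => -[_]; move: hd; rewrite /closure_le_sw /swapped.
    by case: (sw) => hd h; exact: hd h.
  move=> [M hM]; rewrite /Dhat /= asw; split=> //.
  move: ha hM; rewrite /closure_le_sw /swapped.
  by case: (sw) => ha hM; exact: ha hM.
have clE : closure (barrier_dom G 1) = @epiQ R n alpha.
  rewrite (closure_barrier_domE sg2 Gsub Gsm GQ Dpsd Dbd).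
  by apply/seteqP; split => p; rewrite /epiQ /= !mul1r.
have bE : @epi_barrier R n alpha = barrier G 1.
  by apply/funext => -[[X Y] z]; rewrite (barrierE GQ) /= mul1r.
split.
- exact: (Qhat_well_defined_on sg2 Gsub GQ Dpsd Dbd).
- have := Qhat_convex_on sg2 Gsub Gsm GQ Dpsd Dbd.
  by under [X in convex_on _ X]eq_fun do rewrite mul1r.
- rewrite bE -clE; split; last exact: (barrier_has_parameter Gsm Gcomp).
  split; last by rewrite dom_barrier.
  exact: (self_concordant_barrier _ Gsub Gsm Gcomp Glow).
- by move=> g mu; rewrite -clE; exact: (optimal_parameter sg2 Gsub Gsm Gtr).
Qed.

(** For alpha < 0, t^(1-alpha) is t times t^-alpha with -alpha in [0, 1]; for alpha > 1 it
is t^(2-alpha) / t with 2 - alpha in [0, 1]. *)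
Lemma epi_statement alpha : -1 <= alpha < 0 \/ 1 < alpha <= 2 ->
  [/\ Qhat_well_defined alpha (@Dhat R n alpha),
      convex_on (@Dhat R n alpha) (fun P => Qhat alpha P.1 P.2),
      nu_sc_barrier (2 * n + 1)%N%:R (@epiQ R n alpha) (@epi_barrier R n alpha) &
      parameters_at_least (2 * n + 1)%N%:R (@epiQ R n alpha)].
Proof.
move=> [/andP[a0 a1]|/andP[a0 a1]].
  have s01 : 0 <= - alpha <= 1 by rewrite oppr_ge0 (ltW a1) lerNl.
  have [J [posJ hJ]] := exists_power_functional s01.
  apply: (@epi_statement_of_rep alpha J 0 1 true (- alpha)) => //.
  - exact: represents_power_mass hJ.
  - by move=> t t0; rewrite (rep_scalar_right posJ hJ t0) addrC.
  - by move=> X Y; rewrite /lcomb scale0r add0r scale1r.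
  - by rewrite oppr_gt0.
  - move=> x y x0 y0; have t0 : 0 < x / y by rewrite divr_gt0.
    rewrite powRD; last by rewrite (gt_eqF t0) implybT.
    by rewrite powRr1 ?(ltW t0)// mulrA mulrCA divff ?gt_eqF// mulr1.
have s01 : 0 <= 2 - alpha <= 1 by apply/andP; split; move: a0 a1; lra.
have [J [posJ hJ]] := exists_power_functional s01.
apply: (@epi_statement_of_rep alpha J 1 0 false (alpha - 1)) => //.
- by apply/negbTE; rewrite -leNgt; move: a0; lra.
- exact: represents_power_mass hJ.
- by move=> t t0; rewrite (rep_scalar_left posJ hJ t0); congr powR; ring.
- by move=> X Y; rewrite /lcomb scale0r addr0 scale1r.
- by rewrite subr_gt0.
- move=> x y x0 y0; congr (_ * _).
  have t0 : 0 < x / y by rewrite divr_gt0.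
  rewrite -[y / x]invf_div -(powR_inv1 (ltW t0)) -powRrM; congr powR; ring.
Qed.

End GeometricQuasiEntropies.

Local Close Scope classical_set_scope.
Unset Implicit Arguments.

Theorem corollary1p4 (R : realType) (n : nat) (n_gt0 : (0 < n)%N) (alpha : R) :
  (0 <= alpha <= 1 ->
     [/\ Qhat_well_defined alpha (@psd_pairs R n),
         concave_on (@psd_pairs R n) (fun P => Qhat alpha P.1 P.2),
         lh_sc_barrier (2 * n + 1)%N%:R (@hypoQ R n alpha) (@hypo_barrier R n alpha) &
         parameters_at_least (2 * n + 1)%N%:R (@hypoQ R n alpha)]) /\
  (-1 <= alpha < 0 \/ 1 < alpha <= 2 ->
     [/\ Qhat_well_defined alpha (@Dhat R n alpha),
         convex_on (@Dhat R n alpha) (fun P => Qhat alpha P.1 P.2),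
         nu_sc_barrier (2 * n + 1)%N%:R (@epiQ R n alpha) (@epi_barrier R n alpha) &
         parameters_at_least (2 * n + 1)%N%:R (@epiQ R n alpha)]).
Proof.
by split; [exact: hypo_statement|exact: epi_statement].
Qed.
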